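(* Let $n\ge1$, $s\in(0,2)$. Let either $p=1$ and $\beta\in(0,n)$, or $\beta\in(0,1)$ and $p\in(n/(n+\beta),1)$. Let $q_0\in[p,\infty)$ and let $\mu$ be a nonnegative Radon measure on $\mathbb{R}^{n+1}_+$. For $f\in C_0^\infty(\mathbb{R}^n)$ let $u(x,t)=p^s_t\ast f(x)$ be its Caffarelli–Silvestre extension. Then the following statements are equivalent (in (i)–(iii) the constant $C<\infty$ is independent of $f$). (i) There is $C$ with $\|u\|_{L^{q_0,p}_\mu(\mathbb{R}^{n+1}_+)}\le C\|f\|_{\dot\Lambda^{p,p}_\beta(\mathbb{R}^n)}$ for all $f\in C_0^\infty(\mathbb{R}^n)$. (ii) There is $C$ with $\|u\|_{L^{q_0}_\mu(\mathbb{R}^{n+1}_+)}\le C\|f\|_{\dot\Lambda^{p,p}_\beta(\mathbb{R}^n)}$ for all $f\in C_0^\infty(\mathbb{R}^n)$. (iii) There is $C$ with $\|u\|_{L^{q_0,\infty}_\mu(\mathbb{R}^{n+1}_+)}\le C\|f\|_{\dot\Lambda^{p,p}_\beta(\mathbb{R}^n)}$ for all $f\in C_0^\infty(\mathbb{R}^n)$. (iv) $\displaystyle\sup_{t>0}\frac{t^{p/q_0}}{c^\beta_{p,p}(\mu;t)}<\infty.$ (v) $\displaystyle\sup\left\{\frac{(\mu(T(O)))^{p/q_0}}{C^{p,p}_\beta(O)}:\ O\subset\mathbb{R}^n\text{ open}\right\}<\infty.$ (vi) $\displaystyle\sup_{(x,r)\in\mathbb{R}^{n+1}_+}\frac{(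\mu(T(B(x,r))))^{p/q_0}}{r^{n-p\beta}}<\infty.$
   Context: $\mathbb{R}^{n+1}_+=\mathbb{R}^n\times(0,\infty)$. The fractional Poisson kernel is $p^s_t(x)=\dfrac{c(n,s)\,t^s}{(|x|^2+t^2)^{(n+s)/2}}$, $c(n,s)=\dfrac{\Gamma((n+s)/2)}{\pi^{n/2}\Gamma(s/2)}$, and $p^s_t\ast f(x)=\int_{\mathbb{R}^n}p^s_t(x-y)f(y)\,dy$. Besov norm: for $\beta,p,q\in(0,\infty)$, $\|f\|_{\dot\Lambda^{p,q}_\beta(\mathbb{R}^n)}=\left(\int_{\mathbb{R}^n}\|\Delta_h^kf\|_{L^p(\mathbb{R}^n)}^q|h|^{-(n+\beta q)}dh\right)^{1/q}$, where $k=1+[\beta]$, $[\beta]$ is the integer part of $\beta$, $\Delta_h^1f(x)=f(x+h)-f(x)$ and $\Delta_h^kf=\Delta_h^1\Delta_h^{k-1}f$. Lorentz and Lebesgue spaces: for $0<p,q<\infty$, $\|g\|_{L^{q,p}_\mu(\mathbb{R}^{n+1}_+)}=\left\{\int_0^\infty\bigl(\mu(\{(x,t)\in\mathbb{R}^{n+1}_+:|g(x,t)|>\lambda\})\bigr)^{p/q}d\lambda^p\right\}^{1/p}$ with $d\lambda^p=p\lambda^{p-1}d\lambda$; $\|g\|_{L^q_\mu(\mathbb{R}^{n+1}_+)}=\left(\int_{\mathbb{R}^{n+1}_+}|g|^qd\mu\right)^{1/q}$; $\|g\|_{L^{q,\infty}_\mu(\mathbb{R}^{n+1}_+)}=\sup_{\lambda>0}\lambda\,\bigl(\mu(\{(x,t)\in\mathbb{R}^{n+1}_+:|g(x,t)|>\lambda\})\bigr)^{1/q}$.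 Besov capacity: for compact $K\subset\mathbb{R}^n$, $C^{p,q}_\beta(K)=\inf\{\|f\|^p_{\dot\Lambda^{p,q}_\beta(\mathbb{R}^n)}: f\in C_0^\infty(\mathbb{R}^n),\ f\ge1_K\}$, where $1_K$ is the characteristic function of $K$; for any $E\subset\mathbb{R}^n$, $C^{p,q}_\beta(E)=\inf_{O\supseteq E,\,O\text{ open}}\ \sup_{K\subseteq O,\,K\text{ compact}}C^{p,q}_\beta(K)$. Tent: for open $O\subset\mathbb{R}^n$, $T(O)=\{(x,t)\in\mathbb{R}^{n+1}_+:B(x,t)\subset O\}$, where $B(x,t)$ is the ball in $\mathbb{R}^n$ with centre $x$ and radius $t$. Variational capacity minimizing function: for $\lambda>0$, $c^\beta_{p,q}(\mu;\lambda)=\inf\{C^{p,q}_\beta(O): O\subseteq\mathbb{R}^n\text{ open},\ \mu(T(O))>\lambda\}$, with $\inf\emptyset=+\infty$. Finiteness of a supremum of ratios is read as: there is a finite constant $C$ with numerator $\le C\cdot$ denominator in every instance. *)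

(* Defs.v *)
From HB Require Import structures.
From mathcomp Require Import all_boot all_order all_algebra.
From mathcomp Require Import all_classical all_reals all_analysis.
From mathcomp Require Import measurable_realfun.
Set Implicit Arguments.
Unset Strict Implicit.
Unset Printing Implicit Defensive.
Import Order.TTheory GRing.Theory Num.Theory.
Import numFieldNormedType.Exports.
Local Open Scope classical_set_scope.
Local Open Scope ring_scope.

Section borel_rV.
Context {R : realType} {n : nat}.

Let Borel : set (set 'rV[R]_n) := <<s [set A : set 'rV[R]_n | open A] >>.
Let b0 : Borel set0. Proof. exact: sigma_algebra0. Qed.
Let bC A : Borel A -> Borel (~` A). Proof. exact: sigma_algebraC. Qed.
Let bU (F : (set 'rV[R]_n)^nat) :
  (forall i, Borel (F i)) -> Borel (\bigcup_i F i).
Proof. exact: sigma_algebra_bigcup. Qed.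

HB.instance Definition _ :=
  @isMeasurable.Build default_measure_display 'rV[R]_n Borel b0 bC bU.
End borel_rV.

Section lebesgue_rV.
Context {R : realType}.

Lemma rV_open_measurable n (A : set 'rV[R]_n) : open A -> measurable A.
Proof. by move=> oA; apply: sub_sigma_algebra. Qed.

Lemma measurable_coord n (i : 'I_n) :
  measurable_fun [set: 'rV[R]_n] (fun x : 'rV[R]_n => x ord0 i).
Proof.
apply: (measurability (@RGenOInfty.G R)).
  exact: RGenOInfty.measurableE.
move=> _ [_ [a ->] <-].
rewrite setTI; apply: rV_open_measurable.
apply: open_comp => [x _|]; first exact: coord_continuous.
exact: interval_open.
Qed.

Lemma rV_open_bigcup n (A : set 'rV[R]_n) : open A ->
  A = \bigcup_(c : 'rV[rat]_n * rat)
    (if `[< ball (map_mx ratr c.1 : 'rV[R]_n) (ratr c.2) `<=` A >]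
     then ball (map_mx ratr c.1 : 'rV[R]_n) (ratr c.2) else set0).
Proof.
move=> oA; apply/seteqP; split => [x Ax|x [c _]]; last by case: asboolP => // cA /cA.
have /nbhs_ballP[e /= e0 xeA] := open_nbhs_nbhs (conj oA Ax : open_nbhs x A).
have [q] : exists q : rat, ratr q \in `]0, e / 2[.
  by apply: rat_in_itvoo; rewrite divr_gt0.
rewrite in_itv/= => /andP[q0 qe].
have H j : exists p : rat, ratr p \in `]x ord0 j - ratr q, x ord0 j + ratr q[.
  by apply: rat_in_itvoo; rewrite ltrBlDr -addrA ltrDl addr_gt0.
have [c cP] := choice H.
have xc : ball (map_mx ratr (\row_j c j) : 'rV[R]_n) (ratr q) x.
  split=> // i j; rewrite !mxE (ord1 i); move: (cP j).
  rewrite in_itv/= => /andP[h1 h2]; rewrite -ball_normE/= ltr_distlC.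
  by rewrite ltrBlDr h2 -ltrBlDr h1.
exists (\row_j c j, q) => //=; case: asboolP => // -[].
apply: subset_trans xeA => y yc.
apply: (@le_ball _ _ _ (ratr q + ratr q)).
  by rewrite (splitr e) lerD// ltW.
by apply: ball_triangle yc; exact: ball_sym.
Qed.

Lemma measurable_rVP d (T : measurableType d) n (f : T -> 'rV[R]_n) :
  (forall i, measurable_fun [set: T] (fun t => f t ord0 i)) ->
  measurable_fun [set: T] f.
Proof.
move=> mf; apply: (measurability [set A : set 'rV[R]_n | open A]) => //.
move=> _ [A oA <-]; rewrite setTI (rV_open_bigcup oA) preimage_bigcup.
apply: countable_bigcupT_measurable => [|c].
  exact: countableP.
case: ifPn => _; last by rewrite preimage_set0.
have [r0|r0] := ltP 0 (ratr c.2 : R); last first.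
  rewrite (_ : _ @^-1` _ = set0)//; apply/seteqP; split => // t [+ _].
  by rewrite ltNge r0.
rewrite (_ : _ @^-1` _ = \bigcap_(i in [set: 'I_n])
   ((fun t => f t ord0 i) @^-1` ball (ratr (c.1 ord0 i) : R) (ratr c.2 : R))); last first.
  apply/seteqP; split => [t [_ h] i _|t h].
    by have := h ord0 i; rewrite mxE.
  by split => // i j; rewrite (ord1 i) mxE; exact: h.
apply: fin_bigcap_measurable => // i _; rewrite -[X in measurable X]setTI.
by apply: mf => //; exact: measurable_ball.
Qed.

(* Lebesgue measure on R^n, by recursion on n: the image of the product of the
   Lebesgue measure on R and the Lebesgue measure on R^n under the
   identification R * R^n = R^n.+1; see lebesgue_rV_box. *)
Definition rV_cons n (p : R * 'rV[R]_n) : 'rV[R]_n.+1 :=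
  row_mx (p.1%:M : 'rV[R]_1) p.2.

Definition rV_uncons n (x : 'rV[R]_n.+1) : R * 'rV[R]_n :=
  (x ord0 ord0, rsubmx (x : 'rV[R]_(1 + n))).

Lemma rV_cons0 n (p : R * 'rV[R]_n) : rV_cons p ord0 ord0 = p.1.
Proof.
transitivity (row_mx (p.1%:M : 'rV[R]_1) p.2 ord0 (lshift n ord0)).
  by congr (row_mx _ _ _ _); exact: val_inj.
by rewrite row_mxEl mxE eqxx mulr1n.
Qed.

Lemma rV_consS n (p : R * 'rV[R]_n) i : rV_cons p ord0 (lift ord0 i) = p.2 ord0 i.
Proof.
transitivity (row_mx (p.1%:M : 'rV[R]_1) p.2 ord0 (rshift 1 i)).
  by congr (row_mx _ _ _ _); exact: val_inj.
by rewrite row_mxEr.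
Qed.

Lemma rV_consK n : cancel (@rV_cons n) (@rV_uncons n).
Proof.
by move=> p; rewrite /rV_uncons rV_cons0 /rV_cons row_mxKr -surjective_pairing.
Qed.

Lemma rV_unconsK n : cancel (@rV_uncons n) (@rV_cons n).
Proof.
move=> x; apply/rowP => i; case: (unliftP ord0 i) => [j ->|->].
  rewrite rV_consS /= mxE; congr (x _ _); exact: val_inj.
by rewrite rV_cons0.
Qed.

Lemma measurable_rV_cons n :
  measurable_fun [set: measurableTypeR R * 'rV[R]_n] (@rV_cons n).
Proof.
apply: measurable_rVP => i; case: (unliftP ord0 i) => [j ->|->].
  under eq_fun do rewrite rV_consS.
  exact: (measurableT_comp (measurable_coord j) measurable_snd).
under eq_fun do rewrite rV_cons0.
exact: measurable_fst.
Qed.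

Lemma measurable_rV_uncons n :
  measurable_fun [set: 'rV[R]_n.+1]
    (@rV_uncons n : _ -> measurableTypeR R * 'rV[R]_n).
Proof.
apply: measurable_fun_pair; first exact: measurable_coord.
apply: measurable_rVP => i; under eq_fun do rewrite mxE.
exact: measurable_coord.
Qed.

Section step.
Context n (mu : {sigma_finite_measure set 'rV[R]_n -> \bar R}).
Local Open Scope ereal_scope.

Definition lebesgue_rV_step : set 'rV[R]_n.+1 -> \bar R :=
  pushforward (lebesgue_measure \x mu) (@rV_cons n).

Let step0 : lebesgue_rV_step set0 = 0.
Proof. by rewrite /lebesgue_rV_step /pushforward preimage_set0 measure0. Qed.

Let step_ge0 A : 0 <= lebesgue_rV_step A.
Proof. by rewrite /lebesgue_rV_step /pushforward measure_ge0. Qed.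

Let step_sigma_additive : semi_sigma_additive lebesgue_rV_step.
Proof.
move=> F mF tF mUF; rewrite /lebesgue_rV_step /pushforward preimage_bigcup.
apply: measure_semi_sigma_additive.
- by move=> k; rewrite -[X in measurable X]setTI; exact: measurable_rV_cons.
- apply/trivIsetP => /= i j _ _ ij; rewrite -preimage_setI.
  by move/trivIsetP : tF => /(_ _ _ _ _ ij) ->//; rewrite preimage_set0.
- by rewrite -preimage_bigcup -[X in measurable X]setTI; exact: measurable_rV_cons.
Qed.

HB.instance Definition _ := isMeasure.Build _ _ _ lebesgue_rV_step
  step0 step_ge0 step_sigma_additive.

Let step_sigma_finite : sigma_finite setT lebesgue_rV_step.
Proof.
have /sigma_finiteP[F [TF ndF Foo]] := @sigma_finiteT _ _ _ (@lebesgue_measure R).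
have /sigma_finiteP[G [TG ndG Goo]] := sigma_finiteT mu.
have mU (B : set (measurableTypeR R * 'rV[R]_n)) :
    measurable B -> measurable (@rV_uncons n @^-1` B).
  by move=> mB; rewrite -[X in measurable X]setTI; exact: measurable_rV_uncons.
exists (fun k => @rV_uncons n @^-1` (F k `*` G k)) => [|k].
  rewrite -preimage_bigcup -[RHS]setTI; apply/seteqP; split => // x _; split => //.
  have : (\bigcup_k F k) (rV_uncons x).1 by rewrite -TF.
  have : (\bigcup_k G k) (rV_uncons x).2 by rewrite -TG.
  move=> [k _ Gk] [l _ Fl]; exists (maxn k l) => //; split.
  - by move: Fl; apply/subsetPset/ndF/leq_maxr.
  - by move: Gk; apply/subsetPset/ndG/leq_maxl.
have [mF Fkoo] := Foo k; have [mG Gkoo] := Goo k.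
split; first by apply: mU; exact: measurableX.
rewrite /lebesgue_rV_step /pushforward -comp_preimage.
rewrite (_ : _ \o _ = id); last by apply/funext => p; exact: rV_consK.
by rewrite preimage_id product_measure1E// lte_mul_pinfty// ge0_fin_numE.
Qed.

HB.instance Definition _ := Measure_isSigmaFinite.Build _ _ _ lebesgue_rV_step
  step_sigma_finite.
End step.

Fixpoint lebesgue_rV n : {sigma_finite_measure set 'rV[R]_n -> \bar R} :=
  match n with
  | 0 => \d_(0%R : 'rV[R]_0)
  | m.+1 => lebesgue_rV_step (lebesgue_rV m)
  end.

Lemma lebesgue_rV_box n (A : 'I_n -> set R) :
  (forall i, measurable (A i)) ->
  lebesgue_rV n [set x : 'rV[R]_n | forall i, A i (x ord0 i)] =
  (\prod_(i < n) lebesgue_measure (A i))%E.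
Proof.
elim: n A => [|n ih] A mA.
  rewrite big_ord0 /= diracE mem_set// => -[]//.
rewrite big_ord_recl -ih //= /lebesgue_rV_step /pushforward.
rewrite -product_measure1E; last 2 first.
- exact: mA.
- rewrite (_ : mkset _ = \bigcap_(i in [set: 'I_n])
     ((fun x : 'rV[R]_n => x ord0 i) @^-1` A (lift ord0 i))).
    apply: fin_bigcap_measurable => // i _; rewrite -[X in measurable X]setTI.
    exact: measurable_coord.
  by apply/seteqP; split => [x h i _|x h i]; exact: h.
congr ((lebesgue_measure \x lebesgue_rV n) _)%E; apply/seteqP; split => [[a x] /= h|[a x] /= [h0 h] i].
  by split => [|i]; [have := h ord0; rewrite rV_cons0|have := h (lift ord0 i); rewrite rV_consS].
by case: (unliftP ord0 i) => [j ->|->]; rewrite ?rV_consS ?rV_cons0.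
Qed.

End lebesgue_rV.

Section euclidean.
Context {R : realType} {n : nat}.
Implicit Types (x y h : 'rV[R]_n) (f : 'rV[R]_n -> R).

(* The library's norm on 'rV[R]_n is the max norm; the topologies agree. *)
Definition enorm x : R := Num.sqrt (\sum_(i < n) x ord0 i ^+ 2).

Definition eball x (r : R) : set 'rV[R]_n := [set y | enorm (y - x) < r].

Fixpoint Ck (k : nat) f : Prop :=
  continuous f /\
  match k with
  | 0 => True
  | j.+1 => forall i : 'I_n,
      (forall x, derivable f x (delta_mx ord0 i)) /\
      Ck j (fun x => 'D_(delta_mx ord0 i) f x)
  end.

Definition Cc_smooth f : Prop :=
  (forall k, Ck k f) /\ compact (closure [set x | f x != 0]).

Definition fdiff h f : 'rV[R]_n -> R := fun x => f (x + h) - f x.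

Local Open Scope ereal_scope.

(* At h = 0 the weight is 0 by convention of powR, which is harmless since
   {0} is negligible for n >= 1. *)
Definition besov_norm (beta p q : R) f : \bar R :=
  (\int[lebesgue_rV n]_h
     (('N[lebesgue_rV n]_(p%:E) [EFin \o iter (Num.truncn beta).+1 (fdiff h) f])
        `^ q
      * (enorm h `^ (- (n%:R + beta * q)))%:E)) `^ q^-1.

Definition besov_cap_compact (beta p q : R) (K : set 'rV[R]_n) : \bar R :=
  ereal_inf [set besov_norm beta p q f `^ p |
    f in [set f | Cc_smooth f /\ forall x, (\1_K x <= f x)%R]].

Definition besov_cap (beta p q : R) (E : set 'rV[R]_n) : \bar R :=
  ereal_inf [set ereal_sup [set besov_cap_compact beta p q K |
                              K in [set K | compact K /\ K `<=` O]] |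
    O in [set O : set 'rV[R]_n | open O /\ E `<=` O]].

End euclidean.

Section fractional_poisson.
Context {R : realType} {n : nat}.

Definition Gamma (a : R) : R :=
  \int[lebesgue_measure]_(t in `]0%R, +oo[) (t `^ (a - 1) * expR (- t)).

Definition poisson_const (s : R) : R :=
  Gamma ((n%:R + s) / 2) / (pi `^ (n%:R / 2) * Gamma (s / 2)).

Definition poisson_kernel (s t : R) (x : 'rV[R]_n) : R :=
  poisson_const s * t `^ s / (enorm x ^+ 2 + t ^+ 2) `^ ((n%:R + s) / 2).

Definition cs_extension (s : R) (f : 'rV[R]_n -> R) (z : 'rV[R]_n * R) : R :=
  \int[lebesgue_rV n]_y (poisson_kernel s z.2 (z.1 - y) * f y).

End fractional_poisson.

Section half_space.
Context {R : realType} {n : nat}.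

Definition half_space : set ('rV[R]_n * R) := [set z | 0 < z.2].

Definition tent (O : set 'rV[R]_n) : set ('rV[R]_n * R) :=
  [set z | half_space z /\ eball z.1 z.2 `<=` O].

Local Open Scope ereal_scope.
Implicit Types (mu : {measure set ('rV[R]_n * R) -> \bar R})
  (g : 'rV[R]_n * R -> R) (p q : R).

(* A measure on the open half space is represented by any extension to a Borel
   measure on R^n * R: only its values on subsets of half_space are ever used,
   and it may be infinite near the boundary {t = 0}. On the half space, a Borel
   measure that is finite on compact sets is automatically regular. *)
Definition half_space_radon mu : Prop :=
  forall K, compact K -> K `<=` half_space -> mu K < +oo.

Definition level_set g (l : R) : set ('rV[R]_n * R) :=
  [set z | half_space z /\ (l < `|g z|)%R].

Definition lorentz_norm mu q p g : \bar R :=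
  (\int[lebesgue_measure]_(l in `]0%R, +oo[)
     (mu (level_set g l) `^ (p / q) * (p * l `^ (p - 1))%:E)) `^ p^-1.

Definition lebesgue_norm mu q g : \bar R :=
  (\int[mu]_(z in half_space) (`|g z| `^ q)%:E) `^ q^-1.

Definition weak_norm mu q g : \bar R :=
  ereal_sup [set l%:E * mu (level_set g l) `^ q^-1 | l in [set l : R | (0 < l)%R]].

Definition cap_min (beta p q : R) mu (l : R) : \bar R :=
  ereal_inf [set besov_cap beta p q O |
    O in [set O : set 'rV[R]_n | open O /\ l%:E < mu (tent O)]].

End half_space.

(* Main.v *)
(** The main implication is (vi) => (i). On every dyadic scale [f] is compared
with the sampling average [T^v f = \sum_i c_i f(. + i v)]: since
[f - T^v f] is a k-th difference of [f] up to sign and the [T^v] commute, the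
telescoping sum over scales gives a pointwise bound [|f| <= \sum_Q A_Q 1_Q]
over dyadic cubes, with [\sum_Q A_Q^p l(Q)^(n - p beta)] controlled by the
p-th power of the Besov norm. The Poisson extension of [1_Q] is dominated by
[\sum_l 2^(-l n)] times the indicator of the tent over the ball of radius
[~ 2^l l(Q)] around [Q]. As [p <= 1] and [p / q0 <= 1], the Choquet integral
of [mu^(p / q0)] is subadditive (the set function is strongly subadditive by
concavity), and the resulting series in [l] converges because
[p > n / (n + beta)].

The Lebesgue and weak estimates follow by layer cake and Chebyshev. From the
weak estimate, [u >= c > 0] on the tent over an open set if [f >= 1] on large
compact subsets of it, which yields (iv) and (v); smooth bumps bound the
capacity of a ball of radius [r] by [C r^(n - p beta)], which yields (vi). *)
Require Import Defs.
From HB Require Import structures.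
From mathcomp Require Import all_boot all_order all_algebra.
From mathcomp Require Import all_classical all_reals all_analysis.
From mathcomp Require Import measurable_realfun ring lra.
Set Implicit Arguments.
Unset Strict Implicit.
Unset Printing Implicit Defensive.
Import Order.TTheory GRing.Theory Num.Theory.
Import numFieldNormedType.Exports.
Local Open Scope classical_set_scope.
Local Open Scope ring_scope.

(** For [p < 1] only p-th powers can be estimated, and this shapes the constructions. A mean of
    [T^v f] over [v] is not controlled by means of p-th powers, so at each point and scale one value
    [T^v f (x)] is selected whose deviation from the others, in p-th power, is at most average.
    Selected values at consecutive scales are compared by a triangle inequality integrated over all
    pairs of steps; the bound holds for every base point near [x], so averaging it over the cube
    containing [x] leaves one number per cube. The telescoping leaves no remainder: fine-scale
    values tend to [f x] by continuity, coarse-scale ones to [0] because [f] is p-integrable. Cubes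
    of side [r] together carry [r ^ (- (n + p beta))] times the energy of the steps [|h| < r], and
    the sum over [r > |h|] is geometric and returns the Besov weight. In the same spirit [|u| ^ p],
    not [u], is expanded over boxes, so that the Lorentz integral becomes a Choquet integral in
    [s = l ^ p]. Cubes and boxes use the max norm, tents the Euclidean one; passing between them
    costs factors of [n]. *)

Section powR_inequalities.
Context {R : realType}.

(** Both [a + b] and [a + c] lie between [a] and [a + b + c], with complementary barycentric
    weights, so the two chord inequalities for the concave power [th] add up to the claim. *)
Lemma powR_concave3 (th a b c : R) : (0 < th <= 1)%R ->
  (0 <= a)%R -> (0 <= b)%R -> (0 <= c)%R ->
  ((a + b + c) `^ th + a `^ th <= (a + b) `^ th + (a + c) `^ th)%R.
Proof.
move=> /andP[th0 th1] a0 b0 c0.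
have [bc0|bc0] := eqVneq (b + c)%R 0%R.
  have [-> ->] : b = 0%R /\ c = 0%R by split; lra.
  by rewrite !addr0.
have bcp : (0 < b + c)%R by rewrite lt_neqAle eq_sym bc0 addr_ge0.
have thV : (1 <= th^-1)%R by rewrite invf_ge1.
(* Concavity of the power [th] is read off from convexity of the power [th^-1 >= 1] at the points
   [a ^ th] and [(a + b + c) ^ th]. *)
have key (l : R) : (0 <= l <= 1)%R ->
    (l * a `^ th + (1 - l) * (a + b + c) `^ th <=
     (l * a + (1 - l) * (a + b + c)) `^ th)%R.
  move=> l01; have [l0 l1] := andP l01.
  have := @convex_powR R th^-1 thV (Itv01 (andP l01).1 (andP l01).2)
     (a `^ th)%R ((a + b + c) `^ th)%R.
  rewrite !inE/= !in_itv/= !andbT !powR_ge0 => /(_ isT isT).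
  rewrite /conv/= /unstable.onem -!powRrM mulfV ?gt_eqF// !powRr1//; last by rewrite !addr_ge0.
  rewrite !/(_ *: _)/= => h.
  have h0 : (0 <= l * a `^ th + (1 - l) * (a + b + c) `^ th)%R.
    by apply: addr_ge0; apply: mulr_ge0; rewrite ?powR_ge0 ?subr_ge0.
  have := ge0_ler_powR (ltW th0) _ _ h; rewrite -powRrM mulVf ?gt_eqF// powRr1//.
  apply; rewrite nnegrE ?powR_ge0//.
  by apply: addr_ge0; apply: mulr_ge0 => //; [rewrite subr_ge0|rewrite !addr_ge0].
have l1 : (0 <= c / (b + c) <= 1)%R.
  by rewrite divr_ge0 ?(ltW bcp)//= ler_pdivrMr//; lra.
have l2 : (0 <= b / (b + c) <= 1)%R.
  by rewrite divr_ge0 ?(ltW bcp)//= ler_pdivrMr//; lra.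
have := key _ l1; have := key _ l2.
have -> : (c / (b + c) * a + (1 - c / (b + c)) * (a + b + c) = a + b)%R by field.
have -> : (b / (b + c) * a + (1 - b / (b + c)) * (a + b + c) = a + c)%R by field.
move=> h1 h2; apply: le_trans (lerD h2 h1).
rewrite le_eqVlt; apply/orP; left; apply/eqP; field.
exact: bc0.
Qed.

Lemma powR_subadd (th a b : R) : (0 < th <= 1)%R -> (0 <= a)%R -> (0 <= b)%R ->
  ((a + b) `^ th <= a `^ th + b `^ th)%R.
Proof.
move=> th01 a0 b0; have := @powR_concave3 th 0 a b th01 (lexx _) a0 b0.
by rewrite powR0 ?addr0 ?add0r//; case/andP: th01 => /gt_eqF ->.
Qed.

Lemma powR2_lt1 (e : R) : 0 < e -> 2 `^ (- e) < 1 :> R.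
Proof.
move=> e0; rewrite powRN invf_lt1 ?powR_gt0//.
have : 1 `^ e < 2 `^ e :> R by apply: gt0_ltr_powR; rewrite ?nnegrE//; lra.
by rewrite powR1.
Qed.

Lemma le_powRN (d u g : R) : 0 < d -> d <= u -> 0 <= g -> u `^ (- g) <= d `^ (- g).
Proof.
move=> d0 du g0; have u0 : 0 < u by exact: lt_le_trans du.
rewrite !powRN lef_pV2 ?posrE ?powR_gt0//.
by apply: ge0_ler_powR; rewrite ?nnegrE ?(ltW d0) ?(ltW u0).
Qed.

Lemma powR_exprC (a e : R) (m : nat) : 0 <= a -> (a ^+ m) `^ e = (a `^ e) ^+ m.
Proof.
by move=> a0; rewrite -(powR_mulrn m a0) -(powR_mulrn m (powR_ge0 a e)) -!powRrM mulrC.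
Qed.

End powR_inequalities.

(** * Sums and integrals of nonnegative functions *)

Section nonneg_toolkit.
Context {R : realType}.
Local Open Scope ereal_scope.
Import HBNNSimple.

(* Unlike ge0_le_integral, no measurability is needed: the integral of a
   nonnegative function is a supremum over simple functions below it. *)
Lemma le_nnint d (T : measurableType d) (mu : {measure set T -> \bar R})
    (D : set T) (f g : T -> \bar R) :
  (forall x, D x -> 0 <= f x) -> (forall x, D x -> f x <= g x) ->
  \int[mu]_(x in D) f x <= \int[mu]_(x in D) g x.
Proof.
move=> f0 fg; have g0 x : D x -> 0 <= g x.
  by move=> Dx; exact: le_trans (f0 _ Dx) (fg _ Dx).
rewrite !ge0_integralE//; apply: ereal_sup_le => _ [h/= hf <-].
exists h => // x; apply: le_trans (hf x) _.
by rewrite /patch; case: ifPn => //; rewrite inE => /fg.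
Qed.

Lemma le_nnint_subset d (T : measurableType d) (mu : {measure set T -> \bar R})
    (D E : set T) (f : T -> \bar R) :
  (forall x, E x -> 0 <= f x) -> D `<=` E ->
  \int[mu]_(x in D) f x <= \int[mu]_(x in E) f x.
Proof.
move=> f0 DE; rewrite integral_mkcond [leRHS]integral_mkcond.
apply: le_nnint => x _; rewrite /patch.
  by case: ifPn => //; rewrite inE => /DE/f0.
case: ifPn => [|_]; first by rewrite inE => /DE Ex; rewrite mem_set.
by case: ifPn => //; rewrite inE => /f0.
Qed.

Lemma poweR_concave3 (th : R) (a b c : \bar R) : (0 < th <= 1)%R ->
  0 <= a -> 0 <= b -> 0 <= c ->
  (a + b + c) `^ th + a `^ th <= (a + b) `^ th + (a + c) `^ th.
Proof.
move=> th01; have th0 : (th != 0)%R by case/andP: th01 => /gt_eqF ->.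
case: a => [a||]// a0; case: b => [b||]// b0; case: c => [c||]// c0.
  by rewrite !poweR_EFin -!EFinD lee_fin powR_concave3.
all: by rewrite ?(addey,addye)// ?poweRyr// ?addye// ?addey// ?leey.
Qed.

Lemma poweR_subadd (th : R) (a b : \bar R) : (0 < th <= 1)%R ->
  0 <= a -> 0 <= b -> (a + b) `^ th <= a `^ th + b `^ th.
Proof.
move=> th01 a0 b0; have := @poweR_concave3 th 0 a b th01 (lexx _) a0 b0.
by rewrite poweR0r ?adde0 ?add0e//; case/andP: th01 => /gt_eqF ->.
Qed.

Lemma poweR_sum_subadd (th : R) (I : Type) (s : seq I) (P : pred I)
    (a : I -> \bar R) : (0 < th <= 1)%R -> (forall i, 0 <= a i) ->
  (\sum_(i <- s | P i) a i) `^ th <= \sum_(i <- s | P i) a i `^ th.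
Proof.
move=> th01 a0; elim: s => [|i s ih].
  by rewrite !big_nil poweR0r//; case/andP: th01 => /gt_eqF ->.
rewrite !big_cons; case: ifP => // _; apply: (le_trans (poweR_subadd th01 _ _)) => //; first exact: sume_ge0.
exact: leeD2l.
Qed.

Lemma le_poweR (r : R) (x y : \bar R) : (0 <= r)%R -> 0 <= x -> x <= y ->
  x `^ r <= y `^ r.
Proof.
move=> r0 x0 xy; apply: gt0_ler_poweR => //; rewrite in_itv/= leey andbT//.
exact: le_trans xy.
Qed.

Lemma poweRK (r : R) (x : \bar R) : (r != 0)%R -> 0 <= x -> (x `^ r) `^ r^-1 = x.
Proof. by move=> r0 x0; rewrite -poweRrM divff// poweRe1. Qed.

Lemma poweRVK (r : R) (x : \bar R) : (r != 0)%R -> 0 <= x -> (x `^ r^-1) `^ r = x.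
Proof. by move=> r0 x0; rewrite -poweRrM mulVf// poweRe1. Qed.

End nonneg_toolkit.

Section countable_sums.
Context {R : realType}.
Local Open Scope ereal_scope.

(** Makes the convergence theorems for series over [nat] available for sums over any countable type;
    a code that decodes to nothing contributes [0]. *)
Lemma esum_countable (I : countType) (a : I -> \bar R) : (forall i, 0 <= a i) ->
  \esum_(i in setT) a i = \sum_(0 <= k <oo) oapp a 0 (pickle_inv k).
Proof.
move=> a0; rewrite nneseries_esumT; last by move=> n; case: (pickle_inv n).
pose b k : \bar R := oapp a 0 (@pickle_inv I k).
transitivity (\esum_(j in (@pickle I) @` setT) b j).
  rewrite esum_image; last by move=> x y _ _ /(pcan_inj (@pickleK_inv I)).
  by apply: eq_esum => i _; rewrite /b pickleK_inv.
rewrite esum_mkcond; apply: eq_esum => k _; case: ifPn => //.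
rewrite notin_setE => h; rewrite /b; case E : (pickle_inv k) => [x|]//=.
by exfalso; apply: h; exists x => //; have := @pickle_invK I k; rewrite E.
Qed.

Lemma integral_esum d (T : measurableType d) (mu : {measure set T -> \bar R})
    (D : set T) (I : countType) (f : I -> T -> \bar R) : measurable D ->
  (forall i, measurable_fun D (f i)) -> (forall i x, 0 <= f i x) ->
  \int[mu]_(x in D) (\esum_(i in setT) f i x) = \esum_(i in setT) \int[mu]_(x in D) f i x.
Proof.
move=> mD mf f0.
rewrite esum_countable; last by move=> i; exact: integral_ge0.
under eq_integral do rewrite esum_countable//.
pose g k : T -> \bar R := oapp f (cst 0) (@pickle_inv I k).
transitivity (\int[mu]_(x in D) \sum_(0 <= k <oo) g k x).
  apply: eq_integral => x _; apply: eq_eseriesr => k _.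
  by rewrite /g; case: (pickle_inv k) => [i|]/=.
rewrite integral_nneseries//; last 2 first.
- by move=> k; rewrite /g; case: (pickle_inv k) => [i|]/=; [exact: mf|exact: measurable_cst].
- by move=> k x _; rewrite /g; case: (pickle_inv k) => [i|]/=.
apply: eq_eseriesr => k _; rewrite /g; case: (pickle_inv k) => //=.
by rewrite integral0.
Qed.

Lemma esum_ub (I : choiceType) (a : I -> \bar R) i : (forall i, 0 <= a i) ->
  a i <= \esum_(i in setT) a i.
Proof.
move=> a0; apply: esum_ge; exists [set i]; first by split.
by rewrite fsbig_set1.
Qed.

Lemma esum_le (I : choiceType) (a : I -> \bar R) M :
  (forall s : seq I, uniq s -> \sum_(i <- s) a i <= M) ->
  \esum_(i in setT) a i <= M.
Proof.
move=> h; apply: ge_ereal_sup => _ [X [fX _] <-].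
by rewrite fsbig_finite//=; apply: h; exact: finmap.fset_uniq.
Qed.

Lemma esum_seq (I : choiceType) (a : I -> \bar R) (s : seq I) :
  (forall i, 0 <= a i) -> uniq s -> \sum_(i <- s) a i <= \esum_(i in setT) a i.
Proof.
move=> a0 us; apply: esum_ge; exists [set` s]; first by split.
by rewrite -fsbig_seq.
Qed.

Lemma esumZl (I : choiceType) (a : I -> \bar R) (k : R) : (0 <= k)%R ->
  (forall i, 0 <= a i) ->
  \esum_(i in setT) (k%:E * a i) = k%:E * \esum_(i in setT) a i.
Proof.
move=> k0 a0; have le (c : R) (b : I -> \bar R) : (0 <= c)%R -> (forall i, 0 <= b i) ->
    \esum_(i in setT) (c%:E * b i) <= c%:E * \esum_(i in setT) b i.
  move=> c0 b0; apply: esum_le => s us; rewrite -ge0_sume_distrr//.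
  by rewrite lee_wpmul2l// esum_seq.
apply/eqP; rewrite eq_le le//=; have [->|kn0] := eqVneq k 0%R.
  by rewrite mul0e; apply: esum_ge0 => i _; rewrite mul0e.
have kp : (0 < k)%R by rewrite lt_neqAle eq_sym kn0.
rewrite -lee_pdivlMl//; apply: le_trans (le k^-1%R _ _ _); rewrite ?invr_ge0//.
  apply: le_esum => i _; rewrite muleA -EFinM mulVf// mul1e//.
by move=> i; rewrite mule_ge0.
Qed.

Lemma poweR_esum_subadd (th : R) (I : countType) (a : I -> \bar R) :
  (0 < th <= 1)%R -> (forall i, 0 <= a i) ->
  (\esum_(i in setT) a i) `^ th <= \esum_(i in setT) a i `^ th.
Proof.
move=> th01 a0; have th0 : (0 < th)%R by case/andP : th01.
(* Comparing [th]-th roots leaves the unordered sum alone on the left, so that it is enough to bound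
   finite sums. *)
rewrite -[leRHS](@poweRVK R th) ?gt_eqF//; last first.
  by apply: esum_ge0 => i _; exact: poweR_ge0.
apply: le_poweR; [exact: ltW|exact: esum_ge0|].
apply: esum_le => s us.
rewrite -[leLHS](@poweRK R th) ?gt_eqF//; last exact: sume_ge0.
apply: le_poweR; [by rewrite invr_ge0 ltW|exact: poweR_ge0|].
apply: (le_trans (poweR_sum_subadd _ _ th01 a0)).
by apply: esum_seq => // i; exact: poweR_ge0.
Qed.

End countable_sums.

Section lebesgue_one_dim.
Context {R : realType}.
Local Open Scope ereal_scope.

(** Uniqueness of Lebesgue measure: its image under [x -> a + c x], multiplied by [c], agrees with
    it on half-open intervals. *)
Lemma integral_affine (a c : R) (f : R -> \bar R) : (0 < c)%R ->
  measurable_fun setT f -> (forall x, 0 <= f x) ->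
  \int[lebesgue_measure]_x f (a + c * x)%R =
  c^-1%:E * \int[lebesgue_measure]_x f x.
Proof.
move=> c0 mf f0.
have mphi : measurable_fun (setT : set (measurableTypeR R))
    ((fun x => a + c * x)%R : _ -> measurableTypeR R).
  by apply: measurable_funD => //; exact: measurable_funM.
pose phi : measurableTypeR R -> measurableTypeR R := (fun x => a + c * x)%R.
pose m0 : {measure set (measurableTypeR R) -> \bar R} :=
  mscale (NngNum (ltW c0)) (pushforward lebesgue_measure phi).
pose m := m0 mphi.
have mE A : measurable A -> lebesgue_measure A = m A.
  apply: lebesgue_measure_unique => _ [[u v] _ <-].
  change (lebesgue_measure (`]u, v]%classic : set R) = c%:E * lebesgue_measure (phi @^-1` `]u, v]%classic)).
  have -> : phi @^-1` `]u, v]%classic =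
      `] ((u - a) / c)%R, ((v - a) / c)%R]%classic.
    apply/seteqP; split => x /=; rewrite /phi !in_itv/= ltr_pdivrMr// ler_pdivlMr//;
      by rewrite ltrBlDl lerBrDl mulrC.
  rewrite !lebesgue_measure_itv/= !lte_fin ltr_pM2r ?invr_gt0// ltrD2r.
  case: ifPn => _; last by rewrite mule0.
  by rewrite -!EFinB -EFinM; congr EFin; field; rewrite gt_eqF.
rewrite (@eq_measure_integral _ _ _ setT m lebesgue_measure f); last by move=> A mA _; exact: mE.
rewrite ge0_integral_mscale//= ge0_integral_pushforward//= muleA -EFinM.
by rewrite mulVf ?gt_eqF// mul1e.
Qed.

(** Superlevel sets of a monotone function are intervals. This is how all distribution functions
    below are seen to be measurable. *)
Lemma nonincreasing_measurable (F : R -> \bar R) :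
  {homo F : x y / (x <= y)%R >-> y <= x} -> measurable_fun setT F.
Proof.
move=> nF; apply: (measurability (@ErealGenOInfty.G R)).
  exact: ErealGenOInfty.measurableE.
move=> _ [_ [x ->] <-]; rewrite setTI; apply: is_interval_measurable.
move=> u v /= _; rewrite !in_itv/= !andbT => Fv z /andP[uz zv].
by rewrite in_itv/= andbT; apply: lt_le_trans Fv (nF _ _ zv).
Qed.

End lebesgue_one_dim.

(** * Choquet integrals of powers of a measure *)

Section capacity_subadditive.
Context d (T : measurableType d) (R : realType) (mu : {measure set T -> \bar R}).
Context (th : R) (th01 : (0 < th <= 1)%R).
Local Open Scope ereal_scope.

Let th0 : (0 < th)%R. Proof. by case/andP: th01. Qed.

Let meas_gt (g : T -> R) (s : R) : measurable_fun setT g -> measurable [set z | (s < g z)%R].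
Proof.
move=> mg; rewrite (_ : mkset _ = g @^-1` `]s, +oo[%classic).
  by rewrite -[X in measurable X]setTI; apply: mg => //; exact: measurable_itv.
by apply/seteqP; split => z /=; rewrite in_itv/= andbT.
Qed.

Let layer_nonincr (g : T -> R) (E : set T) : measurable_fun setT g -> measurable E ->
  {homo (fun s => mu (E `&` [set z | (s < g z)%R]) `^ th) : x y / (x <= y)%R >-> y <= x}.
Proof.
move=> mg mE x y xy; apply: le_poweR; [exact: ltW|by []|].
apply: le_measure; rewrite ?inE; [by apply: measurableI => //; exact: meas_gt..|].
by apply: setIS => z /=; exact: le_lt_trans.
Qed.

(** This is [poweR_concave3] with [a], [b], [c] the measures of the intersection and of the two
    differences of [U] and [V]. *)
Lemma poweR_measure_submodular (U V : set T) : measurable U -> measurable V ->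
  mu (U `|` V) `^ th + mu (U `&` V) `^ th <= mu U `^ th + mu V `^ th.
Proof.
move=> mU mV; have mUV := measurableI _ _ mU mV.
have mUD := measurableD mU mV; have mVD := measurableD mV mU.
have UE : mu U = mu (U `&` V) + mu (U `\` V) by rewrite addeC -measureDI.
have VE : mu V = mu (U `&` V) + mu (V `\` U) by rewrite addeC setIC -measureDI.
have -> : mu (U `|` V) = mu (U `&` V) + mu (U `\` V) + mu (V `\` U).
  rewrite -UE -measureU//; last by apply/seteqP; split => x // -[? []].
  congr (mu _); apply/seteqP; split => x; last by case=> [|[]]; [left|right].
  by move=> h; have [Ux|Ux] := pselect (U x); [left|right; case: h].
by rewrite UE VE; exact: poweR_concave3.
Qed.

(* Strong subadditivity of mu^th is what makes its Choquet integral subadditive. *)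
Lemma choquet_add1 (g : T -> R) (E : set T) (w : R) :
  measurable_fun setT g -> (forall z, 0 <= g z)%R -> measurable E -> (0 <= w)%R ->
  \int[lebesgue_measure]_(s in `]0%R, +oo[)
      mu [set z | (s < g z + w * \1_E z)%R] `^ th <=
  \int[lebesgue_measure]_(s in `]0%R, +oo[) mu [set z | (s < g z)%R] `^ th
  + w%:E * mu E `^ th.
Proof.
move=> mg g0 mE w0.
pose psi s := mu (E `&` [set z | (s < g z)%R]) `^ th.
pose A s := mu [set z | (s < g z)%R] `^ th.
have nipsi : {homo psi : x y / (x <= y)%R >-> y <= x} by exact: layer_nonincr.
have mpsi : measurable_fun setT psi by exact: nonincreasing_measurable.
have psi0 s : 0 <= psi s by exact: poweR_ge0.
have mA : measurable_fun setT A.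
  apply: nonincreasing_measurable => x y xy.
  by have := @layer_nonincr g setT mg measurableT _ _ xy; rewrite !setTI.
pose g' z := (g z + w * \1_E z)%R.
have mg' : measurable_fun setT g'.
  by apply: measurable_funD => //; apply: measurable_funM => //; exact: measurable_indic.
pose B s := mu [set z | (s < g' z)%R] `^ th.
have mB : measurable_fun setT B.
  apply: nonincreasing_measurable => x y xy.
  by have := @layer_nonincr g' setT mg' measurableT _ _ xy; rewrite !setTI.
have psiA s : psi s <= A s.
  apply: le_poweR; [exact: ltW|by []|].
  by apply: le_measure; rewrite ?inE//; [apply: measurableI => //; exact: meas_gt|exact: meas_gt].
set I := `]0%R, +oo[%classic.
have mI : measurable (I : set R) by exact: measurable_itv.
rewrite -/A.
have mS (F : R -> \bar R) : measurable_fun setT F -> measurable_fun I F.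
  by move=> mF; exact: measurable_funS mF.
(* The integral of [psi] is going to be added to both sides and cancelled, which requires it to be
   finite. If it is infinite, so is the right-hand side, because [psi <= A]. *)
have [psioo|psifin] := eqVneq (\int[lebesgue_measure]_(s in I) psi s) +oo.
  suff -> : \int[lebesgue_measure]_(s in I) A s = +oo.
    by rewrite addye ?leey// gt_eqF// (lt_le_trans ltNy0)// mule_ge0// poweR_ge0.
  by apply/eqP; rewrite -leye_eq -psioo; apply: le_nnint.
have psifn : \int[lebesgue_measure]_(s in I) psi s \is a fin_num.
  by rewrite ge0_fin_numE ?integral_ge0// ltey.
(* The superlevel set of [g + w 1_E] at [s] is the union of [P] and of the part of [E] inside [Q];
   these two sets meet exactly in the part of [E] inside [P], so submodularity applies. *)
have pt (s : R) : B s + psi s <= A s + psi (s - w)%R.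
  pose P := [set z | (s < g z)%R]; pose Q := [set z | (s - w < g z)%R].
  have PQ : P `<=` Q by move=> z; rewrite /P /Q/= => h; lra.
  have -> : B s = mu (P `|` (E `&` Q)) `^ th.
    rewrite /B; congr (mu _ `^ _); apply/seteqP; split => z /=; rewrite /g' /P /Q/= indicE.
      have [zE|zE] := pselect (E z); last by rewrite memNset// mulr0 addr0; left.
      by rewrite mem_set// mulr1 => h; right; split => //; lra.
    have [zE|zE] := pselect (E z); last by rewrite memNset// mulr0 addr0 => -[|[]].
    by rewrite mem_set// mulr1 => -[|[_]]; lra.
  have -> : psi s = mu (P `&` (E `&` Q)) `^ th.
    rewrite /psi; congr (mu _ `^ _); apply/seteqP; split => z [h1].
      by move=> h2; split=> //; split=> //; exact: PQ.
    by case.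
  apply: poweR_measure_submodular; first exact: meas_gt.
  by apply: measurableI => //; exact: meas_gt.
rewrite -(leeD2rE _ _ psifn) -ge0_integralD//; last 3 first.
- by move=> x _; exact: poweR_ge0.
- exact: mS.
- exact: mS.
apply: (@le_trans _ _ (\int[lebesgue_measure]_(s in I) (A s + psi (s - w)%R))).
  apply: le_nnint => s _; last exact: pt.
  by rewrite adde_ge0 ?poweR_ge0.
have mpsiw : measurable_fun setT (fun s : R => psi (s - w)%R).
  by apply: nonincreasing_measurable => x y xy; apply: nipsi; lra.
rewrite ge0_integralD//; last 3 first.
- by move=> x _; exact: poweR_ge0.
- exact: mS.
- exact: mS.
rewrite -[leRHS]addeA; apply: leeD2l.
(* Translation by [w] turns the integral of [psi (s - w)] over [s > 0] into that of [psi] over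
   [s > - w]. The part over [s > 0] cancels, and the remaining interval of length [w] contributes at
   most [w * mu E ^ th]. *)
rewrite integral_mkcond.
rewrite (_ : (fun s : R => psi (s - w)%R) \_ I = fun s : R => (psi \_ `](- w)%R, +oo[%classic) (- w + 1 * s)%R); last first.
  apply/funext => s; rewrite /patch !mem_setE/= !in_itv/= !andbT mul1r addrC.
  by rewrite ltrDl.
rewrite (@integral_affine R (- w)%R 1%R)//; last 2 first.
- by apply/(measurable_restrictT _ _).1 => //; exact: measurable_funS mpsi.
- by move=> x; rewrite /patch; case: ifPn.
rewrite invr1 mul1e -integral_mkcond.
rewrite (_ : `](- w)%R, +oo[%classic = `](- w)%R, 0%R]%classic `|` I); last first.
  rewrite /I; apply/seteqP; split => x /=; rewrite !in_itv/= !andbT.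
    by move=> h; have [x0|x0] := leP x 0%R; [left; rewrite h|right].
  by case=> [/andP[]//|h]; lra.
rewrite ge0_integral_setU//; last 2 first.
- by apply: measurable_funS mpsi.
- rewrite /I; apply/disj_setPS => x []/=; rewrite !in_itv/= !andbT => /andP[_ h1 h2]; lra.
apply: leeD2r.
apply: (@le_trans _ _ (\int[lebesgue_measure]_(s in `](- w)%R, 0%R]) (cst (mu E `^ th) s))).
  apply: le_nnint => s _ //; apply: le_poweR; [exact: ltW|by []|].
  by apply: le_measure; rewrite ?inE//; apply: measurableI => //; exact: meas_gt.
rewrite integral_cst//= lebesgue_measure_itv/= lte_fin oppr_lt0 muleC.
case: ifPn => [_|]; first by rewrite -EFinD add0r opprK.
by rewrite -leNgt => w1; rewrite mul0e mule_ge0 ?poweR_ge0.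
Qed.

(** Finite sums follow from [choquet_add1] by induction. For the series, the superlevel sets of the
    partial sums increase to that of the limit, and continuity of [mu] from below and monotone
    convergence pass to the limit. *)
Lemma choquet_subadditive (w : nat -> R) (E : nat -> set T) :
  (forall i, 0 <= w i)%R -> (forall i, measurable (E i)) ->
  \int[lebesgue_measure]_(s in `]0%R, +oo[)
      mu [set z | s%:E < \sum_(0 <= i <oo) (w i * \1_(E i) z)%:E] `^ th <=
  \sum_(0 <= i <oo) ((w i)%:E * mu (E i) `^ th).
Proof.
move=> w0 mE.
pose g N z := (\sum_(0 <= i < N) w i * \1_(E i) z)%R.
have mg N : measurable_fun setT (g N).
  by apply: measurable_sum => i; apply: measurable_funM => //; exact: measurable_indic.
have g0 N z : (0 <= g N z)%R by apply: sumr_ge0 => i _; rewrite mulr_ge0.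
have gnd z : nondecreasing_seq (g ^~ z).
  by apply/nondecreasing_seqP => N; rewrite /g big_nat_recr//= lerDl mulr_ge0.
pose F N s := mu [set z | (s < g N z)%R] `^ th.
have mF N : measurable_fun setT (F N).
  apply: nonincreasing_measurable => x y xy.
  by have := @layer_nonincr (g N) setT (mg N) measurableT _ _ xy; rewrite !setTI.
have Fnd s : {homo F^~ s : n m / (n <= m)%N >-> n <= m}.
  move=> n m nm; apply: le_poweR; [exact: ltW|by []|].
  apply: le_measure; rewrite ?inE; [exact: meas_gt..|].
  by move=> z /= /lt_le_trans; apply; exact: gnd.
have partial N : \int[lebesgue_measure]_(s in `]0%R, +oo[) F N s <=
    \sum_(0 <= i < N) ((w i)%:E * mu (E i) `^ th).
  elim: N => [|N ih].
    rewrite big_nil integral0_eq// => s/=; rewrite in_itv/= andbT => s0.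
    rewrite /F (_ : mkset _ = set0) ?measure0 ?poweR0r ?gt_eqF//.
    by apply/seteqP; split => z //=; rewrite /g big_nil ltNge (ltW s0).
  rewrite big_nat_recr//=; apply: le_trans (leeD2r _ ih).
  rewrite /F; under eq_integral do under eq_set do rewrite /g big_nat_recr//=.
  exact: (choquet_add1 (mg N) (g0 N) (mE N) (w0 N)).
have -> : \int[lebesgue_measure]_(s in `]0%R, +oo[)
      mu [set z | s%:E < \sum_(0 <= i <oo) (w i * \1_(E i) z)%:E] `^ th =
    \int[lebesgue_measure]_(s in `]0%R, +oo[) limn (F^~ s).
  apply: eq_integral => s _.
  have -> : [set z | s%:E < \sum_(0 <= i <oo) (w i * \1_(E i) z)%:E] =
      \bigcup_N [set z | (s < g N z)%R].
    have gE N z : (g N z)%:E = \sum_(0 <= i < N) (w i * \1_(E i) z)%:E.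
      by rewrite sumEFin.
    apply/seteqP; split => z /=.
      move=> h; apply: contrapT => nh; move: h; apply/negP; rewrite -leNgt.
      apply: lime_le; first by apply: is_cvg_nneseries => i _ _; rewrite lee_fin mulr_ge0.
      apply: nearW => N; rewrite -gE lee_fin leNgt; apply/negP => h.
      by apply: nh; exists N.
    move=> [N _ /=]; rewrite -lte_fin gE => /lt_le_trans; apply.
    by apply: nneseries_lim_ge => i _; rewrite lee_fin mulr_ge0.
  have cv : mu [set z | (s < g N z)%R] @[N --> \oo] --> mu (\bigcup_N [set z | (s < g N z)%R]).
    apply: nondecreasing_cvg_mu; first by move=> N; exact: meas_gt.
    - by apply: bigcupT_measurable => N; exact: meas_gt.
    - by move=> n m nm; apply/subsetPset => z /= /lt_le_trans; apply; exact: gnd.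
  have cF : cvgn (F^~ s) by apply: ereal_nondecreasing_is_cvgn => n m; exact: Fnd.
  apply/eqP; rewrite eq_le; apply/andP; split; last first.
    apply: lime_le => //; apply: nearW => N; apply: le_poweR; [exact: ltW|by []|].
    apply: le_measure; rewrite ?inE; [exact: meas_gt| |].
      by apply: bigcupT_measurable => n; exact: meas_gt.
    by move=> z; exists N.
  have L0 : 0 <= limn (F^~ s).
    by apply: lime_ge => //; apply: nearW => N; exact: poweR_ge0.
  rewrite -[leRHS](@poweRVK R th) ?gt_eqF//; apply: le_poweR; [exact: ltW|by []|].
  rewrite -(cvg_lim _ cv)//; apply: lime_le; first by apply/cvg_ex; eexists; exact: cv.
  apply: nearW => N; rewrite -[leLHS](@poweRK R th) ?gt_eqF//.
  apply: le_poweR; [by rewrite invr_ge0 ltW|exact: poweR_ge0|].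
  apply: lime_ge => //; exists N => // M /= NM; exact: Fnd.
have cvI := @cvg_monotone_convergence _ _ R lebesgue_measure `]0%R, +oo[%classic
   (measurable_itv _) F (fun N => measurable_funS measurableT (@subsetT _ _) (mF N))
   (fun N s _ => poweR_ge0 _ _) (fun s _ => Fnd s).
rewrite -(cvg_lim _ cvI)//; apply: lime_le; first by apply/cvg_ex; eexists; exact: cvI.
apply: nearW => N; apply: le_trans (partial N) _.
by apply: nneseries_lim_ge => i _; rewrite mule_ge0 ?lee_fin ?poweR_ge0.
Qed.

End capacity_subadditive.

(** * Norm, measurability and integration on row vectors *)

Section rV_norm.
Context {R : realType} {n : nat}.
Implicit Types (x y : 'rV[R]_n) (r : R).

Lemma rV_norm_le x r : 0 <= r -> (forall i, `|x ord0 i| <= r) -> `|x| <= r.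
Proof.
move=> r0 h; rewrite /Num.norm/= mx_normrE; apply: bigmax_le => // -[i j] _ /=.
by rewrite (ord1 i).
Qed.

Lemma rV_norm_lt x r : 0 < r -> (forall i, `|x ord0 i| < r) -> `|x| < r.
Proof.
move=> r0 h; rewrite /Num.norm/= mx_normrE; apply: bigmax_lt => // -[i j] _ /=.
by rewrite (ord1 i).
Qed.

Lemma rV_coord_le x i : `|x ord0 i| <= `|x|.
Proof.
rewrite [leRHS]/Num.norm/= mx_normrE.
exact: (@le_bigmax _ _ _ 0 (fun k : 'I_1 * 'I_n => `|x k.1 k.2|) (ord0, i)).
Qed.

Lemma enorm_ge0 x : 0 <= enorm x. Proof. exact: sqrtr_ge0. Qed.

Lemma norm_le_enorm x : `|x| <= enorm x.
Proof.
apply: rV_norm_le => [|i]; first exact: enorm_ge0.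
rewrite -sqrtr_sqr ler_wsqrtr// (bigD1 i)//= lerDl sumr_ge0// => j _.
exact: sqr_ge0.
Qed.

Lemma enorm_le_norm x : enorm x <= n%:R * `|x|.
Proof.
rewrite -[leRHS]ger0_norm ?mulr_ge0// -sqrtr_sqr ler_wsqrtr//.
apply: (@le_trans _ _ (\sum_(i < n) `|x| ^+ 2)).
  apply: ler_sum => i _; rewrite -[leLHS]real_normK ?num_real//.
  by rewrite lerXn2r ?nnegrE// rV_coord_le.
rewrite sumr_const card_ord exprMn -[leLHS]mulr_natl.
apply: ler_wpM2r; first exact: exprn_ge0.
by case: n => [|k]; rewrite ?expr0n// expr2 ler_peMr// ler1n.
Qed.

Lemma enorm_continuous : continuous (@enorm R n).
Proof.
have cs : continuous (fun y : 'rV[R]_n => \sum_(i < n) y ord0 i ^+ 2).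
  apply: continuous_big => [|i _ y]; first exact: add_continuous.
  exact: (continuous_comp (@coord_continuous R 1 n ord0 i y) (@exprn_continuous _ 2 _)).
by move=> x; apply: continuous_comp; [exact: cs|exact: sqrt_continuous].
Qed.

End rV_norm.

Section rV_measurability.
Context {R : realType}.

Lemma continuous_rV_measurable n (f : 'rV[R]_n -> R) : continuous f ->
  measurable_fun setT f.
Proof.
move=> cf; apply: (measurability (@RGenOInfty.G R)).
  exact: RGenOInfty.measurableE.
move=> _ [_ [a ->] <-]; rewrite setTI; apply: rV_open_measurable.
by apply: open_comp => [x _|]; [exact: cf|exact: interval_open].
Qed.

Lemma measurable_rV_norm n : measurable_fun setT (fun x : 'rV[R]_n => `|x|).
Proof. by apply: continuous_rV_measurable => x; exact: norm_continuous. Qed.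

Lemma measurable_enorm n : measurable_fun setT (@enorm R n).
Proof. apply: continuous_rV_measurable; exact: enorm_continuous. Qed.

Lemma measurable_rV_add d (T : measurableType d) n (f g : T -> 'rV[R]_n) :
  measurable_fun setT f -> measurable_fun setT g ->
  measurable_fun setT (fun t => f t + g t).
Proof.
move=> mf mg; apply: measurable_rVP => i; under eq_fun do rewrite mxE.
by apply: measurable_funD; exact: (measurableT_comp (measurable_coord i)).
Qed.

Lemma measurable_rV_scale d (T : measurableType d) n (c : R) (f : T -> 'rV[R]_n) :
  measurable_fun setT f -> measurable_fun setT (fun t => c *: f t).
Proof.
move=> mf; apply: measurable_rVP => i; under eq_fun do rewrite mxE.
by apply: measurable_funM => //; exact: (measurableT_comp (measurable_coord i)).
Qed.

Lemma measurable_rV_sub d (T : measurableType d) n (f g : T -> 'rV[R]_n) :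
  measurable_fun setT f -> measurable_fun setT g ->
  measurable_fun setT (fun t => f t - g t).
Proof.
move=> mf mg; apply: measurable_rV_add => //.
have -> : (fun t => - g t) = (fun t => (-1) *: g t).
  by apply/funext => t; rewrite scaleN1r.
exact: measurable_rV_scale.
Qed.

(** The sigma-algebra on pairs is the product one, so an open set has to be written as a countable
    union of boxes, here with rational centres, radii and endpoints. *)
Lemma open_rVR_measurable n (A : set ('rV[R]_n * R)) : open A -> measurable A.
Proof.
move=> oA.
pose S (k : ('rV[rat]_n * rat) * (rat * rat)) : set ('rV[R]_n * R) :=
  ball (map_mx ratr k.1.1 : 'rV[R]_n) (ratr k.1.2) `*` `]ratr k.2.1, ratr k.2.2[.
have -> : A = \bigcup_k (if `[< S k `<=` A >] then S k else set0).
  apply/seteqP; split => [[x t] Axt|z [k _]]; last by case: asboolP => // kA /kA.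
  have /nbhs_ballP[e /= e0 xeA] := open_nbhs_nbhs (conj oA Axt : open_nbhs (x, t) A).
  have ob : open (ball x e) by exact: ball_open.
  have : ball x e x by exact: ballxx.
  rewrite {1}(rV_open_bigcup ob) => -[c _]; case: asboolP => // ce xc.
  have [q1] : exists q : rat, ratr q \in `]t - e, t[.
    by apply: rat_in_itvoo; rewrite gtrBl.
  have [q2] : exists q : rat, ratr q \in `]t, t + e[.
    by apply: rat_in_itvoo; rewrite ltrDl.
  rewrite !in_itv/= => /andP[h1 h2] /andP[h3 h4].
  exists (c, (q1, q2)) => //; case: asboolP => /= [_|].
    by split => //=; rewrite in_itv/= h4 h1.
  case=> -[y u] [/= yc]; rewrite in_itv/= => /andP[u1 u2].
  apply: xeA; split => /=; first exact: ce.
  by rewrite -ball_normE/= ltr_distlC; apply/andP; split; lra.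
apply: countable_bigcupT_measurable => [|k]; first exact: countableP.
case: ifPn => // _; apply: measurableX; last exact: measurable_itv.
have [k0|k0] := ltP 0 (ratr k.1.2 : R); first by apply: rV_open_measurable; exact: ball_open.
rewrite (_ : ball _ _ = set0); first exact: measurable0.
by apply/seteqP; split => // y [+ _]; rewrite ltNge k0.
Qed.

Lemma open_half_space n : open (@half_space R n).
Proof.
rewrite (_ : half_space = (fun z : 'rV[R]_n * R => z.2) @^-1` `]0, +oo[%classic).
  by apply: open_comp => [z _|]; [exact: cvg_snd|exact: interval_open].
by apply/seteqP; split => z; rewrite /half_space/= in_itv/= andbT.
Qed.

Lemma measurable_half_space n : measurable (@half_space R n).
Proof. by apply: open_rVR_measurable; exact: open_half_space. Qed.

(** The complement of a tent inside the half space is a union of such open cones with vertices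
    outside the base, hence tents over arbitrary sets are measurable. The parameters [nu] and [a]
    serve both the Euclidean tents and their narrower max-norm variants. *)
Lemma open_near_set n (nu : 'rV[R]_n -> R) (a : R) (S : set 'rV[R]_n) :
  continuous nu -> open [set z : 'rV[R]_n * R | exists2 y, S y & nu (y - z.1) < a * z.2].
Proof.
move=> cnu; rewrite (_ : mkset _ = \bigcup_(y in S)
    [set z : 'rV[R]_n * R | nu (y - z.1) < a * z.2]); last first.
  by apply/seteqP; split => z [y yS h]; exists y.
apply: bigcup_open => y _.
rewrite (_ : mkset _ = (fun z : 'rV[R]_n * R => a * z.2 - nu (y - z.1)) @^-1` `]0, +oo[%classic).
  apply: open_comp => [z _|]; last exact: interval_open.
  apply: cvgB; first by apply: cvgM; [exact: cvg_cst|exact: cvg_snd].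
  apply: (@continuous_comp _ _ _ (fun z : 'rV[R]_n * R => y - z.1) nu); last exact: cnu.
  by apply: cvgB; [exact: cvg_cst|exact: cvg_fst].
by apply/seteqP; split => z /=; rewrite in_itv/= andbT subr_gt0.
Qed.

Lemma measurable_tent n (O : set 'rV[R]_n) : measurable (tent O).
Proof.
rewrite (_ : tent O = half_space `\`
    [set z : 'rV[R]_n * R | exists2 y, (~` O) y & enorm (y - z.1) < 1 * z.2]).
  apply: measurableD; first exact: measurable_half_space.
  by apply: open_rVR_measurable; apply: open_near_set; exact: enorm_continuous.
apply/seteqP; split => z /= [hz h]; split => //.
  by move=> [y Oy]; rewrite mul1r => /h.
by move=> y yz; apply: contrapT => Oy; apply: h; exists y; rewrite ?mul1r.
Qed.

Lemma open_eball n (x : 'rV[R]_n) r : open (eball x r).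
Proof.
rewrite (_ : eball x r = (fun y => enorm (y - x)) @^-1` `]-oo, r[%classic).
  apply: open_comp => [z _|]; last exact: interval_open.
  apply: (@continuous_comp _ _ _ (fun z : 'rV[R]_n => z - x)); last exact: enorm_continuous.
  exact: cvgB cvg_id (cvg_cst _).
by apply/seteqP; split => z /=; rewrite in_itv.
Qed.

End rV_measurability.

Section rV_integration.
Context {R : realType}.
Local Open Scope ereal_scope.
Notation leb := (@lebesgue_measure R).

Lemma integral_rV_cons n (f : 'rV[R]_n.+1 -> \bar R) :
  measurable_fun setT f -> (forall x, 0 <= f x) ->
  \int[lebesgue_rV n.+1]_x f x =
  \int[leb]_t \int[lebesgue_rV n]_y f (rV_cons (t, y)).
Proof.
move=> mf f0; pose m0 : {measure set 'rV[R]_n.+1 -> \bar R} :=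
  pushforward (leb \x lebesgue_rV n) (@rV_cons R n : measurableTypeR R * 'rV[R]_n -> _).
have mc := @measurable_rV_cons R n.
rewrite (@eq_measure_integral _ _ _ setT (m0 mc))//.
rewrite ge0_integral_pushforward//= preimage_setT.
rewrite (@fubini_tonelli1 _ _ _ _ _ leb (lebesgue_rV n) (f \o @rV_cons R n))//.
- exact: measurableT_comp.
- by move=> x; exact: f0.
Qed.

(** Induction on the dimension through the recursive definition of the measure; each coordinate
    contributes one factor [c^-1]. *)
Lemma integral_rV_affine n (a : 'rV[R]_n) (c : R) (f : 'rV[R]_n -> \bar R) :
  (0 < c)%R -> measurable_fun setT f -> (forall x, 0 <= f x) ->
  \int[lebesgue_rV n]_x f (a + c *: x)%R =
  (c^-1 ^+ n)%:E * \int[lebesgue_rV n]_x f x.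
Proof.
move=> c0; elim: n a f => [|n ih] a f mf f0.
  rewrite expr0 mul1e; apply: eq_integral => x _; congr (f _).
  by apply/rowP => -[].
have maff : measurable_fun setT (fun x : 'rV[R]_n.+1 => f (a + c *: x)%R).
  apply: (measurableT_comp mf); apply: measurable_rV_add => //.
  by apply: measurable_rV_scale; exact: measurable_id.
have mfc : measurable_fun setT (f \o @rV_cons R n).
  by apply: (measurableT_comp mf); exact: measurable_rV_cons.
rewrite integral_rV_cons// [in RHS]integral_rV_cons//.
pose a' : 'rV[R]_n := (\row_i a ord0 (lift ord0 i))%R.
pose G t := \int[lebesgue_rV n]_y f (rV_cons (t, y)).
have mG : measurable_fun setT G.
  exact: (@measurable_fun_fubini_tonelli_F _ _ _ _ _ (lebesgue_rV n) (f \o @rV_cons R n) mfc (fun x => f0 _)).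
have G0 t : 0 <= G t by exact: integral_ge0.
transitivity (\int[leb]_t ((c^-1 ^+ n)%:E * G (a ord0 ord0 + c * t)%R)).
  apply: eq_integral => t _.
  rewrite -(ih a' (fun y => f (rV_cons ((a ord0 ord0 + c * t)%R, y))))//.
    apply: eq_integral => y _; congr (f _); apply/rowP => i; rewrite [LHS]mxE [X in (_ + X)%R]mxE.
    case: (unliftP ord0 i) => [j ->|->]; last by rewrite !rV_cons0.
    by rewrite !rV_consS/= !mxE.
  apply: (measurableT_comp mf); apply: (measurableT_comp (@measurable_rV_cons R n)).
  by apply: measurable_fun_pair => //; exact: measurable_id.
have cn0 : 0 <= (c^-1 ^+ n)%:E by rewrite lee_fin exprn_ge0// invr_ge0 ltW.
have maffc : measurable_fun setT (fun t : R => (a ord0 ord0 + c * t)%R).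
  by apply: measurable_funD => //; apply: measurable_funM => //; exact: measurable_id.
have mGa : measurable_fun setT (fun t : R => G (a ord0 ord0 + c * t)%R).
  exact: (measurableT_comp mG maffc).
rewrite (ge0_integralZl leb measurableT mGa (fun _ _ => G0 _) cn0).
by rewrite (integral_affine _ c0 mG G0) muleA -EFinM -exprSr.
Qed.

Lemma lebesgue_rV_cube n (a : 'rV[R]_n) (l : R) : (0 <= l)%R ->
  lebesgue_rV n [set x : 'rV[R]_n | forall i, (a ord0 i <= x ord0 i < a ord0 i + l)%R]
  = (l ^+ n)%:E.
Proof.
move=> l0; have := @lebesgue_rV_box R n (fun i => `[a ord0 i, (a ord0 i + l)%R[%classic)
   (fun i => measurable_itv _).
set S := [set x | _]; rewrite (_ : S = [set x : 'rV[R]_n | forall i, (a ord0 i <= x ord0 i < a ord0 i + l)%R]); last first.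
  by apply/seteqP; split => x h i; have := h i; rewrite /= in_itv.
move=> ->; under eq_bigr => i _.
  rewrite lebesgue_measure_itv/= lte_fin ltrDl (_ : (if _ then _ else _) = l%:E); last first.
    case: ifPn => [_|]; first by rewrite -EFinB addrC addKr.
    by rewrite -leNgt => l1; congr EFin; apply/eqP; rewrite eq_le l0 l1.
  over.
by rewrite prodEFin prodr_const card_ord.
Qed.

Lemma lebesgue_rV_ball_le n (a : 'rV[R]_n) (r : R) : (0 <= r)%R ->
  lebesgue_rV n [set x : 'rV[R]_n | (`|x - a| < r)%R] <= ((2 * r) ^+ n)%:E.
Proof.
move=> r0; rewrite -(@lebesgue_rV_cube n (\row_i (a ord0 i - r))%R) ?mulr_ge0//.
apply: le_measure; rewrite ?inE.
- rewrite (_ : mkset _ = (fun x : 'rV[R]_n => `|x - a|%R) @^-1` `]-oo, r[%classic).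
    rewrite -[X in measurable X]setTI; apply: (_ : measurable_fun setT _) => //.
    apply: (measurableT_comp (@measurable_rV_norm R n)).
    by apply: measurable_rV_sub => //; exact: measurable_id.
  by apply/seteqP; split => x /=; rewrite in_itv.
- rewrite (_ : mkset _ = \bigcap_(i in [set: 'I_n]) ((fun x : 'rV[R]_n => x ord0 i) @^-1`
     `[(a ord0 i - r)%R, (a ord0 i - r + 2 * r)%R[)).
    apply: fin_bigcap_measurable => // i _; rewrite -[X in measurable X]setTI.
    exact: measurable_coord.
  by apply/seteqP; split => x h i; have := h i; rewrite /= in_itv/= mxE// => /(_ Logic.I).
- move=> x /= xr i; have := le_lt_trans (rV_coord_le (x - a)%R i) xr; rewrite !mxE ltr_norml.
  by move=> /andP[h1 h2]; apply/andP; split; lra.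
Qed.

Lemma measurable_rV_nball n (a : 'rV[R]_n) (r : R) :
  measurable [set x : 'rV[R]_n | (`|x - a| < r)%R].
Proof.
rewrite (_ : mkset _ = (fun x : 'rV[R]_n => `|x - a|%R) @^-1` `]-oo, r[%classic).
  rewrite -[X in measurable X]setTI; apply: (_ : measurable_fun setT _) => //.
  apply: (measurableT_comp (@measurable_rV_norm R n)).
  by apply: measurable_rV_sub => //; exact: measurable_id.
by apply/seteqP; split => x /=; rewrite in_itv.
Qed.

End rV_integration.

Section partitions.
Context {R : realType}.
Local Open Scope ereal_scope.

Lemma esum_single (I : choiceType) (a : I -> \bar R) i0 :
  (forall i, i != i0 -> a i = 0) -> 0 <= a i0 -> \esum_(i in setT) a i = a i0.
Proof.
move=> a0 ai0; rewrite -[RHS](@esum_set1 _ _ i0 a)// [in RHS]esum_mkcond.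
apply: eq_esum => i _; case: ifPn => //; rewrite notin_setE/= => /eqP; exact: a0.
Qed.

Lemma integral_partition d (T : measurableType d) (mu : {measure set T -> \bar R})
    (I : countType) (J : I -> set T) (D : set T) (F : T -> \bar R) :
  (forall i, measurable (J i)) -> (forall i j x, J i x -> J j x -> i = j) ->
  (forall x, D x <-> exists i, J i x) -> measurable_fun setT F -> (forall x, 0 <= F x) ->
  \int[mu]_(x in D) F x = \esum_(i in setT) \int[mu]_(x in J i) F x.
Proof.
move=> mJ uJ DJ mF F0; rewrite integral_mkcond.
under [RHS]eq_esum do rewrite integral_mkcond.
have mFJ i : measurable_fun setT (F \_ (J i)).
  by apply/(measurable_restrictT _ _).1 => //; exact: measurable_funS mF.
have F0J i x : 0 <= (F \_ (J i)) x by rewrite /patch; case: ifPn.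
rewrite -integral_esum//; apply: eq_integral => x _.
have [/[dup] Dx /DJ[i Jix]|nDx] := pselect (D x).
  rewrite (@esum_single _ _ i)//; first by rewrite /patch !mem_set.
  move=> j ji; rewrite /patch memNset// => Jjx; move: ji.
  by rewrite (uJ _ _ _ Jix Jjx) eqxx.
rewrite /patch memNset// esum1// => i _; rewrite memNset// => Jix.
by apply: nDx; apply/DJ; exists i.
Qed.

Lemma geometric_ex (b x : R) : (1 < b)%R -> (0 < x)%R ->
  exists j : int, (b `^ j%:~R < x <= b `^ (j + 1)%:~R)%R.
Proof.
move=> b1 x0; have b0 : (0 < b)%R by lra.
have lb : (0 < ln b)%R by rewrite ln_gt0.
pose t := (ln x / ln b)%R.
have xE : x = (b `^ t)%R.
  by rewrite /powR gt_eqF// /t divfK ?gt_eqF// lnK// posrE.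
have h r : (b `^ r = expR (r * ln b))%R by rewrite /powR gt_eqF.
exists (Num.ceil t - 1)%R; rewrite subrK xE !h ltr_expR ler_expR ltr_pM2r// ler_pM2r//.
by have /andP[h1 h2] := real_ceil_itv (num_real t); rewrite h2 andbT.
Qed.

Lemma geometric_uniq (b x : R) (i j : int) : (1 < b)%R ->
  (b `^ i%:~R < x <= b `^ (i + 1)%:~R)%R -> (b `^ j%:~R < x <= b `^ (j + 1)%:~R)%R -> i = j.
Proof.
move=> b1; have b0 : (0 < b)%R by lra.
have lb : (0 < ln b)%R by rewrite ln_gt0.
have h r : (b `^ r = expR (r * ln b))%R by rewrite /powR gt_eqF.
move=> /andP[h1 h2] /andP[h3 h4].
have := lt_le_trans h1 h4; have := lt_le_trans h3 h2.
rewrite !h !ltr_expR !ltr_pM2r// !ltr_int !ltzD1 => a c.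
by apply/eqP; rewrite eq_le a c.
Qed.

Lemma integral_geometric (b : R) (F : R -> \bar R) : (1 < b)%R ->
  measurable_fun setT F -> (forall x, 0 <= F x) ->
  \int[lebesgue_measure]_(x in `]0%R, +oo[) F x =
  \esum_(j in [set: int])
     \int[lebesgue_measure]_(x in `](b `^ j%:~R)%R, (b `^ (j + 1)%:~R)%R]) F x.
Proof.
move=> b1 mF F0; apply: integral_partition => //.
- by move=> i j x /=; rewrite !in_itv/=; exact: geometric_uniq.
- move=> x /=; rewrite in_itv/= andbT; split=> [x0|[j]].
    by have [j hj] := geometric_ex b1 x0; exists j; rewrite /= in_itv.
  by rewrite /= in_itv/= => /andP[h _]; apply: le_lt_trans h; exact: powR_ge0.
Qed.

End partitions.

(** * Iterated differences *)

Section difference_expansion.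
Context {R : realType}.

(** The binomial expansion with the term [g x] isolated. The list comes from the recursion for
    differences, so an offset may occur several times in it. What matters later is that one list
    serves all [g], [v], [x], and that its offsets are at least [1], which makes [v -> x + e v] an
    expanding change of variables. *)
Lemma fdiff_expansion (k : nat) : exists s : seq (R * nat),
  (forall e, e \in s -> (1 <= e.2 <= k)%N) /\
  forall n (g : 'rV[R]_n -> R) (v x : 'rV[R]_n),
    iter k (fdiff v) g x =
    (-1) ^+ k * (g x - \sum_(e <- s) e.1 * g (x + e.2%:R *: v)).
Proof.
elim: k => [|k [s [sk ih]]].
  by exists [::]; split => // n g v x; rewrite big_nil subr0 expr0 mul1r.
exists ((1, 1%N) :: [seq (- e.1, e.2.+1) | e <- s] ++ s); split.
  move=> e; rewrite inE mem_cat => /orP[/eqP->//|/orP[/mapP[e' e's ->]/=|/sk/andP[-> /leqW]//]].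
  by have /andP[_] := sk _ e's; rewrite ltnS.
move=> n g v x; rewrite iterS /fdiff -/(fdiff v) !ih.
rewrite big_cons big_cat big_map/= mul1r scale1r.
have -> : \sum_(j <- s) - j.1 * g (x + j.2.+1%:R *: v) =
    - \sum_(j <- s) j.1 * g (x + v + j.2%:R *: v).
  rewrite -sumrN; apply: eq_bigr => e _; rewrite mulNr -addrA; congr (- (_ * g (_ + _))).
  by rewrite -[X in X + _]scale1r -scalerDl -natr1 addrC.
rewrite exprS; set A := \sum_(_ <- _) _; set B := \sum_(_ <- _) _; ring.
Qed.

End difference_expansion.

Section fdiff_measurable.
Context {R : realType} {n : nat}.

Lemma measurable_fdiff2 (f : 'rV[R]_n -> R) k : measurable_fun setT f ->
  measurable_fun setT (fun hx : 'rV[R]_n * 'rV[R]_n => iter k (fdiff hx.1) f hx.2).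
Proof.
move=> mf; elim: k => [|k ih]; first exact: (measurableT_comp mf).
have msh : measurable_fun setT (fun hx : 'rV[R]_n * 'rV[R]_n => (hx.1, hx.2 + hx.1)).
  by apply: measurable_fun_pair => //; exact: measurable_rV_add.
exact: (measurable_funB (measurableT_comp ih msh) ih).
Qed.

Local Open Scope ereal_scope.

Definition besov_energy (k : nat) (p : R) (f : 'rV[R]_n -> R) (h : 'rV[R]_n) : \bar R :=
  \int[lebesgue_rV n]_x (`|iter k (fdiff h) f x| `^ p)%:E.

Lemma besov_energy_ge0 k p f h : 0 <= besov_energy k p f h.
Proof. by apply: integral_ge0 => x _; rewrite lee_fin powR_ge0. Qed.

Lemma measurable_fdiff_powR (f : 'rV[R]_n -> R) k p : measurable_fun setT f ->
  measurable_fun setT (fun hx : 'rV[R]_n * 'rV[R]_n =>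
     (`|iter k (fdiff hx.1) f hx.2| `^ p)%:E).
Proof.
move=> mf; apply/measurable_EFinP; apply: (measurableT_comp (measurable_powR p)).
by apply: measurableT_comp => //; exact: measurable_fdiff2.
Qed.

Lemma measurable_besov_energy k p f : measurable_fun setT f ->
  measurable_fun setT (besov_energy k p f).
Proof.
move=> mf; have := @measurable_fun_fubini_tonelli_F _ _ _ _ _ (lebesgue_rV n) _
  (measurable_fdiff_powR k p mf).
by apply => x; rewrite lee_fin powR_ge0.
Qed.

Lemma besov_normE beta p f : (p != 0)%R ->
  besov_norm beta p p f `^ p = \int[lebesgue_rV n]_h
    (besov_energy (Num.truncn beta).+1 p f h * (enorm h `^ (- (n%:R + beta * p)))%:E).
Proof.
move=> p0; rewrite /besov_norm poweRVK//; last first.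
  by apply: integral_ge0 => h _; rewrite mule_ge0 ?poweR_ge0// lee_fin powR_ge0.
apply: eq_integral => h _; rewrite powR_Lnorm//; congr (_ * _).
Qed.

Lemma besov_norm_ge0 beta p q f : 0 <= @besov_norm R n beta p q f.
Proof. exact: poweR_ge0. Qed.

End fdiff_measurable.

Section extension_measurable.
Context {R : realType} {n : nat}.

Lemma measurable_poisson (s : R) : measurable_fun setT
  (fun zy : ('rV[R]_n * R) * 'rV[R]_n => poisson_kernel s zy.1.2 (zy.1.1 - zy.2)).
Proof.
rewrite (_ : (fun _ => _) = fun zy : ('rV[R]_n * R) * 'rV[R]_n =>
  @poisson_const R n s * zy.1.2 `^ s *
  (enorm (zy.1.1 - zy.2) ^+ 2 + zy.1.2 ^+ 2) `^ (- ((n%:R + s) / 2))); last first.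
  by apply/funext => zy; rewrite /poisson_kernel powRN.
have m1 : measurable_fun setT (fun zy : ('rV[R]_n * R) * 'rV[R]_n => zy.1.2).
  exact: (measurableT_comp measurable_snd).
have m2 : measurable_fun setT (fun zy : ('rV[R]_n * R) * 'rV[R]_n => enorm (zy.1.1 - zy.2)).
  apply: (measurableT_comp (@measurable_enorm R n)); apply: measurable_rV_sub => //.
  exact: (measurableT_comp measurable_fst).
apply: measurable_funM.
  by apply: measurable_funM => //; exact: (measurableT_comp (measurable_powR s) m1).
apply: (measurableT_comp (measurable_powR _)).
by apply: measurable_funD; apply: measurable_funX.
Qed.

(** The real integral is [fine] of a difference of two nonnegative integrals, each measurable in the
    parameter by Tonelli; integrability of the integrand is not an issue. *)
Lemma measurable_cs_extension (s : R) (f : 'rV[R]_n -> R) : measurable_fun setT f ->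
  measurable_fun setT (cs_extension s f).
Proof.
move=> mf; pose F (zy : ('rV[R]_n * R) * 'rV[R]_n) : \bar R :=
  (poisson_kernel s zy.1.2 (zy.1.1 - zy.2) * f zy.2)%:E.
have mF : measurable_fun setT F.
  apply/measurable_EFinP; apply: measurable_funM; first exact: measurable_poisson.
  exact: (measurableT_comp mf).
rewrite (_ : cs_extension s f = fun z => fine ((\int[lebesgue_rV n]_y F^\+%E (z, y)) -
    \int[lebesgue_rV n]_y F^\-%E (z, y))%E); last first.
  apply/funext => z; rewrite /cs_extension /Rintegral; congr fine; rewrite [LHS]integralE.
  by congr (_ - _)%E; apply: eq_integral => y _; rewrite ?(funeposE,funenegE).
apply: measurableT_comp => //; apply: emeasurable_funB.
  by apply: (@measurable_fun_fubini_tonelli_F _ _ _ _ _ (lebesgue_rV n) F^\+%E) => //;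
    exact: measurable_funepos.
by apply: (@measurable_fun_fubini_tonelli_F _ _ _ _ _ (lebesgue_rV n) F^\-%E) => //;
  exact: measurable_funeneg.
Qed.

Lemma measurable_level_set (g : 'rV[R]_n * R -> R) (l : R) : measurable_fun setT g ->
  measurable (level_set g l).
Proof.
move=> mg; rewrite (_ : level_set g l = half_space `&` (fun z => `|g z|) @^-1` `]l, +oo[%classic).
  apply: measurableI; first exact: measurable_half_space.
  rewrite -[X in measurable X]setTI; apply: (_ : measurable_fun setT _) => //.
  exact: measurableT_comp.
by apply/seteqP; split => z; rewrite /level_set/= in_itv/= andbT.
Qed.

Lemma Cc_smooth_continuous (f : 'rV[R]_n -> R) : Cc_smooth f -> continuous f.
Proof. by case=> /(_ 0%N)[]. Qed.

Lemma Cc_smooth_measurable (f : 'rV[R]_n -> R) : Cc_smooth f -> measurable_fun setT f.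
Proof. by move=> /Cc_smooth_continuous; exact: continuous_rV_measurable. Qed.

End extension_measurable.

(** * Layer-cake comparison of the Lorentz, Lebesgue and weak norms *)

Section layers.
Context {R : realType}.
Local Open Scope ereal_scope.

Lemma esum_int_shift (a : int -> \bar R) :
  \esum_(j in setT) a (j - 1)%R = \esum_(j in setT) a j.
Proof.
apply/esym; apply: (@reindex_esum R int int setT setT (fun j => j - 1)%R a).
split => //; first by move=> i j _ _ /addIr.
by move=> j _; exists (j + 1)%R => //; rewrite addrK.
Qed.

Lemma powR_intS (b : R) (j : int) : (0 < b)%R ->
  (b `^ (j + 1)%:~R = b * b `^ j%:~R)%R.
Proof.
move=> b0; have bn : b != 0%R by rewrite gt_eqF.
rewrite intrD powRD ?bn ?implybT//.
by rewrite powRr1 ?ltW// mulrC.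
Qed.

Lemma lebesgue_itv_oc (a b : R) : (a <= b)%R ->
  lebesgue_measure (`]a, b]%classic : set R) = (b - a)%:E.
Proof.
move=> ab; rewrite lebesgue_measure_itv/= lte_fin; case: ifPn => //.
by rewrite -leNgt => ba; rewrite (@le_anti _ _ a b) ?ab// subrr.
Qed.

Lemma integral_itv_ge (a b : R) (F : R -> \bar R) (c : \bar R) : (a <= b)%R -> 0 <= c ->
  (forall x, (a < x <= b)%R -> c <= F x) ->
  c * (b - a)%:E <= \int[lebesgue_measure]_(x in `]a, b]) F x.
Proof.
move=> ab c0 cF; rewrite -(lebesgue_itv_oc ab) -integral_cst//.
by apply: le_nnint => x //=; rewrite in_itv/= => h; exact: cF.
Qed.

Lemma integral_itv_le (a b : R) (F : R -> \bar R) (c : \bar R) : (a <= b)%R ->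
  (forall x, (a < x <= b)%R -> 0 <= F x <= c) ->
  \int[lebesgue_measure]_(x in `]a, b]) F x <= c * (b - a)%:E.
Proof.
move=> ab cF; rewrite -(lebesgue_itv_oc ab) -integral_cst//.
by apply: le_nnint => x /=; rewrite in_itv/= => /cF/andP[].
Qed.

(* A change of variables s = l^p up to constants, for monotone integrands only. *)
Lemma integral_powR_weight (p : R) (Phi : R -> \bar R) : (0 < p <= 1)%R ->
  (forall x, 0 <= Phi x) -> {homo Phi : x y / (x <= y)%R >-> y <= x} ->
  \int[lebesgue_measure]_(l in `]0%R, +oo[) (Phi (l `^ p)%R * (p * l `^ (p - 1))%:E) <=
  (p / (1 - (2 `^ p)^-1))%:E * \int[lebesgue_measure]_(s in `]0%R, +oo[) Phi s.
Proof.
move=> /andP[p0 p1] Phi0 niPhi.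
have [b bE] : exists b : R, b = (2 `^ p)%R by exists (2 `^ p)%R.
rewrite -bE.
have b1 : (1 < b)%R.
  rewrite bE.
  have : (1 `^ p < 2 `^ p :> R)%R by apply: gt0_ltr_powR; rewrite ?nnegrE//; lra.
  by rewrite powR1.
have b0 : (0 < b)%R by lra.
have bn0 : b != 0%R by rewrite gt_eqF.
have k0 : (0 < 1 - b^-1)%R by rewrite subr_gt0 invf_lt1.
have mPhi : measurable_fun setT Phi by exact: nonincreasing_measurable.
have mF : measurable_fun setT (fun l : R => Phi (l `^ p)%R * (p * l `^ (p - 1))%:E).
  apply: emeasurable_funM; first exact: (measurableT_comp mPhi (measurable_powR p)).
  by apply/measurable_EFinP; apply: measurable_funM => //; exact: measurable_powR.
rewrite (@integral_geometric _ 2%R)//; last 2 first.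
- by lra.
- by move=> l; rewrite mule_ge0// lee_fin mulr_ge0 ?powR_ge0 ?ltW.
rewrite (@integral_geometric _ b)//.
rewrite -(esum_int_shift (fun j => \int[lebesgue_measure]_(x in `](b `^ j%:~R)%R, (b `^ (j + 1)%:~R)%R]) Phi x)).
rewrite -esumZl; last 2 first.
- by rewrite divr_ge0 ?ltW.
- by move=> j; exact: integral_ge0.
apply: le_esum => j _.
have [A AE] : exists A : R, A = (2 `^ j%:~R)%R by exists (2 `^ j%:~R)%R.
have A0 : (0 < A)%R by rewrite AE powR_gt0.
have A2 : (2 `^ (j + 1)%:~R = 2 * A)%R by rewrite AE (powR_intS j (ltr0Sn R 1)).
have bj : (b `^ j%:~R = A `^ p)%R by rewrite bE AE -!powRrM mulrC.
have bj1 : (b `^ (j - 1)%:~R = b^-1 * A `^ p)%R.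
  have := @powR_intS b (j - 1)%R b0; rewrite subrK bj => ->.
  by rewrite (mulKf bn0).
(* Blocks are matched with a shift: [l] in [(A, 2 A]] against [s] in [(A ^ p / b, A ^ p]]. Since
   [Phi] and, for [p <= 1], the weight are nonincreasing, the value at [A] bounds the first
   integrand from above, while [Phi (A ^ p)] bounds the second from below; the lengths of the blocks
   give the factor [p / (1 - b^-1)]. *)
apply: (@le_trans _ _ (Phi (A `^ p)%R * (p * A `^ (p - 1))%:E * (2 * A - A)%:E)).
  rewrite A2 -AE; apply: integral_itv_le; first by lra.
  move=> l /andP[Al _]; have l0 : (0 < l)%R by apply: lt_trans Al.
  apply/andP; split; first by rewrite mule_ge0// lee_fin mulr_ge0 ?powR_ge0 ?ltW.
  apply: lee_pmul => //; first by rewrite lee_fin mulr_ge0 ?powR_ge0 ?ltW.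
  - by apply: niPhi; apply: ge0_ler_powR; rewrite ?nnegrE; exact: ltW.
  - rewrite lee_fin ler_pM2l//.
    rewrite -(opprB 1%R p) !powRN lef_pV2 ?posrE ?powR_gt0//.
    by apply: ge0_ler_powR; rewrite ?nnegrE ?subr_ge0//; exact: ltW.
have -> : Phi (A `^ p)%R * (p * A `^ (p - 1))%:E * (2 * A - A)%:E =
    (p / (1 - b^-1))%:E * (Phi (A `^ p)%R * (A `^ p - b^-1 * A `^ p)%:E).
  rewrite -muleA -EFinM [RHS]muleCA -EFinM; congr (_ * _%:E).
  rewrite -(mulr_powRB1 (ltW A0) p0); field.
  by apply/andP; split; [rewrite gt_eqF|rewrite subr_eq0 gt_eqF].
apply: lee_wpmul2l; first by rewrite lee_fin divr_ge0 ?ltW.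
rewrite subrK bj bj1; apply: integral_itv_ge => //.
  by rewrite ler_piMl ?powR_ge0// invf_le1// ltW.
by move=> x /andP[_ xA]; exact: niPhi.
Qed.

End layers.

Section norm_comparison.
Context {R : realType} {n : nat} (mu : {measure set ('rV[R]_n * R) -> \bar R}).
Local Open Scope ereal_scope.

Lemma layer_nonincreasing (g : 'rV[R]_n * R -> R) : measurable_fun setT g ->
  {homo (fun l => mu (level_set g l)) : x y / (x <= y)%R >-> y <= x}.
Proof.
move=> mg x y xy; apply: le_measure; rewrite ?inE; [exact: measurable_level_set..|].
by move=> z [hz /= h]; split => //; exact: le_lt_trans h.
Qed.

(** The exponent [p / q] is at most [1], so raising the dyadic layer-cake sum for the integral of
    [|g| ^ q] to this power distributes over the layers; each layer is then absorbed by the dyadic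
    block of the Lorentz integral just below it. *)
Lemma lebesgue_le_lorentz (p q : R) : (0 < p <= 1)%R -> (p <= q)%R ->
  forall g, measurable_fun setT g ->
  lebesgue_norm mu q g <= ((4 / p) `^ p^-1)%:E * lorentz_norm mu q p g.
Proof.
move=> /andP[p0 p1] pq g mg; have q0 : (0 < q)%R by lra.
pose m l := mu (level_set g l).
have m0 l : 0 <= m l by [].
have nim : {homo m : x y / (x <= y)%R >-> y <= x} by exact: layer_nonincreasing.
pose th := (p / q)%R.
have th01 : (0 < th <= 1)%R by rewrite divr_gt0//= ler_pdivrMr// mul1r.
have th0 : (0 < th)%R by case/andP: th01.
pose W := \int[lebesgue_measure]_(l in `]0%R, +oo[) (m l `^ th * (p * l `^ (p - 1))%:E).
have W0 : 0 <= W.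
  by apply: integral_ge0 => l _; rewrite mule_ge0 ?poweR_ge0// lee_fin mulr_ge0 ?powR_ge0// ltW.
suff main : (\int[mu]_(z in half_space) (`|g z| `^ q)%:E) `^ th <= (4 / p)%:E * W.
  rewrite /lebesgue_norm /lorentz_norm -/th -/W.
  rewrite (_ : q^-1 = th * p^-1)%R; last by rewrite /th; field; rewrite !gt_eqF.
  rewrite poweRrM -poweR_EFin -poweRM ?lee_fin ?divr_ge0 ?(ltW p0)//.
  by apply: le_poweR => //; [rewrite invr_ge0 ltW|exact: poweR_ge0].
have [A AE] : exists A : int -> R, forall j, A j = (2 `^ (j + 1)%:~R)%R.
  by exists (fun j => 2 `^ (j + 1)%:~R)%R.
have A0 j : (0 < A j)%R by rewrite AE powR_gt0.
have Ahalf j : (2 `^ j%:~R = A j / 2)%R.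
  by rewrite AE (powR_intS j (ltr0Sn R 1)) mulrAC mulfV ?mul1r.
have AS j : (2 `^ (j + 1 + 1)%:~R = 2 * A j)%R.
  by rewrite (powR_intS (j + 1)%R (ltr0Sn R 1)) -AE.
have step1 : \int[mu]_(z in half_space) (`|g z| `^ q)%:E <=
    \esum_(j in [set: int]) (((2 * A j) `^ q)%:E * m (A j)).
  have -> : \esum_(j in [set: int]) (((2 * A j) `^ q)%:E * m (A j)) =
    \esum_(j in [set: int]) \int[mu]_(z in half_space)
        (((2 * A j) `^ q)%:E * (\1_(level_set g (A j)) z)%:E).
    apply: eq_esum => j _; rewrite ge0_integralZl//; last 3 first.
    - exact: measurable_half_space.
    - apply/measurable_EFinP; apply: measurable_indic; exact: measurable_level_set.
    - by rewrite lee_fin powR_ge0.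
    rewrite integral_indic//; [|exact: measurable_half_space|exact: measurable_level_set].
    by congr (_ * mu _); apply/seteqP; split => [z [hz h]|z []//]; split.
  rewrite -integral_esum; last 3 first.
  - exact: measurable_half_space.
  - move=> j; apply: emeasurable_funM => //; apply/measurable_EFinP.
    by apply: measurable_indic; exact: measurable_level_set.
  - by move=> j z; rewrite mule_ge0// lee_fin powR_ge0.
  apply: le_nnint => z hz; first by rewrite lee_fin powR_ge0.
  have [gz|gz] := eqVneq (g z) 0%R.
    rewrite gz normr0 powR0 ?gt_eqF//; apply: esum_ge0 => j _.
    by rewrite mule_ge0// lee_fin powR_ge0.
  have gz0 : (0 < `|g z|)%R by rewrite normr_gt0.
  have [j0 /andP[h1 h2]] := @geometric_ex R 2%R _ ltac:(lra) gz0.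
  (* As [A j] is [2 ^ (j + 1)], the index is lowered by one to obtain [A j < |g z| <= 2 A j]. *)
  pose j := (j0 - 1)%R; have j0E : (j0 = j + 1)%R by rewrite subrK.
  have le1 : (`|g z| `^ q)%:E <= ((2 * A j) `^ q)%:E * (\1_(level_set g (A j)) z)%:E.
    rewrite indicE mem_set; last by split => //; rewrite AE -j0E.
    rewrite mule1 lee_fin; apply: ge0_ler_powR; rewrite ?nnegrE ?mulr_ge0 ?(ltW q0) ?(ltW (A0 _))//.
    by rewrite -AS -j0E.
  apply: (le_trans le1).
  apply: (@esum_ub R int (fun j => ((2 * A j) `^ q)%:E * (\1_(level_set g (A j)) z)%:E) j).
  by move=> i; rewrite mule_ge0// lee_fin powR_ge0.
have F0 : forall j, 0 <= ((2 * A j) `^ q)%:E * m (A j).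
  by move=> j; rewrite mule_ge0// lee_fin powR_ge0.
apply: (le_trans (le_poweR (ltW th0) (integral_ge0 _ _) step1)).
  by move=> z _; rewrite lee_fin powR_ge0.
apply: (le_trans (poweR_esum_subadd th01 F0)).
have mW : measurable_fun setT (fun l : R => m l `^ th * (p * l `^ (p - 1))%:E).
  apply: emeasurable_funM.
    by apply: (measurableT_comp (measurable_poweR th)); exact: nonincreasing_measurable.
  by apply/measurable_EFinP; apply: measurable_funM => //; exact: measurable_powR.
rewrite /W (@integral_geometric _ 2%R)//; last 2 first.
- by lra.
- by move=> l; rewrite mule_ge0 ?poweR_ge0// lee_fin mulr_ge0 ?powR_ge0 ?ltW.
rewrite -esumZl; last 2 first.
- by rewrite divr_ge0 ?ltW.
- move=> j; apply: integral_ge0 => l _.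
  by rewrite mule_ge0 ?poweR_ge0// lee_fin mulr_ge0 ?powR_ge0 ?ltW.
apply: le_esum => j _; rewrite Ahalf -AE.
rewrite poweRM ?lee_fin ?powR_ge0// poweR_EFin -powRrM.
rewrite (_ : q * th = p)%R; last by rewrite /th mulrCA mulfV ?mulr1// gt_eqF.
have lowb : (m (A j) `^ th * (p * A j `^ (p - 1))%:E) * (A j - A j / 2)%:E <=
   \int[lebesgue_measure]_(x in `](A j / 2)%R, (A j)]) (m x `^ th * (p * x `^ (p - 1))%:E).
  apply: integral_itv_ge.
  - by rewrite ler_pdivrMr//; have := A0 j; lra.
  - by rewrite mule_ge0 ?poweR_ge0// lee_fin mulr_ge0 ?powR_ge0 ?ltW.
  move=> x /andP[x1 x2]; have x0 : (0 < x)%R by apply: lt_trans x1; rewrite divr_gt0.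
  apply: lee_pmul; rewrite ?poweR_ge0//.
  - by rewrite lee_fin mulr_ge0 ?powR_ge0 ?ltW.
  - by apply: le_poweR => //; [exact: ltW|exact: nim].
  - rewrite lee_fin ler_pM2l// -(opprB 1%R p) !powRN lef_pV2 ?posrE ?powR_gt0//.
    by apply: ge0_ler_powR; rewrite ?nnegrE ?subr_ge0// ltW.
(* Origin of [4 / p]: the block has length [A j / 2] and weight at least [p A_j ^ (p - 1)], and
   [(2 A_j) ^ p <= 2 A_j ^ p] because [p <= 1]. *)
apply: (@le_trans _ _ ((4 / p)%:E * ((m (A j) `^ th * (p * A j `^ (p - 1))%:E) * (A j - A j / 2)%:E))); last first.
  by apply: lee_wpmul2l => //; rewrite lee_fin divr_ge0 ?ltW.
rewrite muleC [leRHS]muleC -!muleA -!EFinM; apply: lee_wpmul2l; first exact: poweR_ge0.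
rewrite lee_fin powRM ?(ltW (A0 _))//.
rewrite (_ : p * A j `^ (p - 1) * ((A j - A j / 2) * (4 / p)) = 2 * A j `^ p)%R.
  apply: ler_wpM2r; first exact: powR_ge0.
  by rewrite -[leRHS](@powRr1 _ 2%R)//; apply: ler_powR => //; lra.
by rewrite -(mulr_powRB1 (ltW (A0 j)) p0); field; rewrite gt_eqF.
Qed.

Lemma weak_le_lebesgue (q : R) : (0 < q)%R -> forall g, measurable_fun setT g ->
  weak_norm mu q g <= lebesgue_norm mu q g.
Proof.
move=> q0 g mg; apply: ge_ereal_sup => _ [l l0 <-].
have qi : (0 <= q^-1)%R by rewrite invr_ge0 ltW.
rewrite -[l%:E](@poweRK R q) ?gt_eqF ?lee_fin ?(ltW l0)//.
rewrite -poweRM ?poweR_ge0//; apply: le_poweR => //; first by rewrite mule_ge0 ?poweR_ge0.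
rewrite poweR_EFin -integral_cst; last exact: measurable_level_set.
apply: (@le_trans _ _ (\int[mu]_(z in level_set g l) (`|g z| `^ q)%:E)).
  apply: le_nnint => z [_ lz]; first by rewrite lee_fin powR_ge0.
  by rewrite lee_fin; apply: ge0_ler_powR; rewrite ?nnegrE ?(ltW q0)// ltW.
by apply: le_nnint_subset => [z _|z []//]; rewrite lee_fin powR_ge0.
Qed.

Lemma besov_cap_ge0 (beta p q : R) (E : set 'rV[R]_n) : 0 <= besov_cap beta p q E.
Proof.
apply: le_ereal_inf_tmp => _ [V _ <-]; apply: (@le_trans _ _ (besov_cap_compact beta p q set0)).
  by apply: le_ereal_inf_tmp => _ [f _ <-]; exact: poweR_ge0.
by apply: ereal_sup_ubound; exists set0 => //; split; [exact: compact0|].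
Qed.

(** The infimum [cap_min] involves the strict condition [t < mu (tent O)], so its bound is used at
    levels below the measure. If the conclusion failed, a level strictly between the two sides,
    after undoing the power, would contradict that bound; this also handles infinite measure. *)
Lemma open_of_cap_min (beta p q : R) (C : R) : (0 < p / q)%R -> (0 <= C)%R ->
  (forall t : R, (0 < t)%R -> (t `^ (p / q))%:E <= C%:E * cap_min beta p p mu t) ->
  forall O : set 'rV[R]_n, open O -> mu (tent O) `^ (p / q) <= C%:E * besov_cap beta p p O.
Proof.
move=> pq0 C0 h O oO.
have cap0 : 0 <= besov_cap beta p p O by exact: besov_cap_ge0.
have key (t : R) : (0 < t)%R -> t%:E < mu (tent O) -> (t `^ (p / q))%:E <= C%:E * besov_cap beta p p O.
  move=> t0 tO; apply: (le_trans (h t t0)); apply: lee_wpmul2l; first by rewrite lee_fin.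
  by apply: ereal_inf_lbound; exists O.
have RHS0 : 0 <= C%:E * besov_cap beta p p O by rewrite mule_ge0 ?lee_fin.
set X := C%:E * _ in RHS0 key *; set th := (p / q)%R in pq0 key *.
rewrite leNgt; apply/negP => lt.
have Xfin : X \is a fin_num by rewrite ge0_fin_numE// (lt_le_trans lt)// leey.
pose x := (fine X `^ th^-1)%R.
have xX : (x `^ th)%:E = X.
  by rewrite /x -powRrM mulVf ?gt_eqF// powRr1 ?fine_ge0// fineK.
have xm : x%:E < mu (tent O).
  rewrite ltNge; apply/negP => mx; move: lt; rewrite ltNge -xX -poweR_EFin.
  by rewrite le_poweR// ltW.
have [t xt tm] : exists2 t : R, (x < t)%R & t%:E < mu (tent O).
  case: (mu (tent O)) xm => [r|_|//].
    by rewrite lte_fin => xr; exists ((x + r) / 2)%R; rewrite ?lte_fin; lra.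
  by exists (x + 1)%R; rewrite ?ltry//; lra.
have x0 : (0 <= x)%R by exact: powR_ge0.
have := key t (le_lt_trans x0 xt) tm; rewrite -xX lee_fin leNgt => /negP; apply.
by apply: gt0_ltr_powR; rewrite ?nnegrE//; lra.
Qed.

End norm_comparison.

(** * Sampling operators and dyadic decomposition *)

Section averaging.
Context {R : realType}.
Local Open Scope ereal_scope.

(** If every value exceeded the mean [c], then [F - c] would be positive on [A] with zero integral,
    making [A] negligible. This selects one good step [v] where averaging over [v] is impossible. *)
Lemma exists_le_mean d (T : measurableType d) (mu : {measure set T -> \bar R})
    (A : set T) (F : T -> \bar R) : measurable A -> 0 < mu A -> mu A < +oo ->
  measurable_fun A F -> (forall x, A x -> 0 <= F x) ->
  exists2 x, A x & mu A * F x <= \int[mu]_(y in A) F y.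
Proof.
move=> mA A0 Aoo mF F0; apply: contrapT => h.
have lt x : A x -> \int[mu]_(y in A) F y < mu A * F x.
  by move=> Ax; rewrite ltNge; apply/negP => le; apply: h; exists x.
have [x0 Ax0] : A !=set0.
  by apply/set0P; apply: contraTneq A0 => ->; rewrite measure0 ltxx.
have Afin : mu A \is a fin_num by rewrite ge0_fin_numE.
have Ifin : \int[mu]_(y in A) F y \is a fin_num.
  rewrite ge0_fin_numE; last exact: integral_ge0.
  by rewrite (lt_le_trans (lt _ Ax0))// leey.
pose a : R := fine (mu A); have aE : mu A = a%:E by rewrite fineK.
have a0 : (0 < a)%R by rewrite -lte_fin -aE.
pose c : R := (fine (\int[mu]_(y in A) F y) / a)%R.
have cE : \int[mu]_(y in A) F y = (c * a)%:E.
  by rewrite /c divfK ?gt_eqF// fineK.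
have c0 : (0 <= c)%R by rewrite divr_ge0 ?fine_ge0 ?(ltW a0)//; exact: integral_ge0.
have ltF x : A x -> c%:E < F x.
  by move=> /lt; rewrite cE aE EFinM muleC lte_pmul2l// lte_fin.
have g0 x : A x -> 0 <= F x - c%:E by move=> Ax; rewrite sube_ge0// ltW// ltF.
have mg : measurable_fun A (fun x => F x - c%:E) by apply: emeasurable_funB.
have Ig : \int[mu]_(x in A) (F x - c%:E) = 0.
  have : \int[mu]_(x in A) (F x - c%:E) + \int[mu]_(x in A) (cst c%:E x) =
      \int[mu]_(x in A) F x.
    by rewrite -ge0_integralD//; apply: eq_integral => x _; rewrite subeK.
  rewrite integral_cst// cE aE -EFinM => /(congr1 (fun z => z - (c * a)%:E)).
  by rewrite addeK// subee.
have /ae_eq_integral_abs : \int[mu]_(x in A) `|F x - c%:E| = 0.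
  by rewrite -Ig; apply: eq_integral => x /[!inE] Ax; rewrite gee0_abs ?g0.
move=> /(_ mA mg) [N [mN N0 AN]].
suff : mu A <= mu N by rewrite N0 leNgt A0.
apply: le_measure; rewrite ?inE// => x Ax; apply: AN => h'; have := ltF _ Ax.
by rewrite -sube_gt0 (h' Ax) ltxx.
Qed.

Context d1 d2 (T1 : measurableType d1) (T2 : measurableType d2).
Context (m1 : {sigma_finite_measure set T1 -> \bar R}) (m2 : {sigma_finite_measure set T2 -> \bar R}).

Let patch_setXl (A : set T1) (B : set T2) (F : T1 * T2 -> \bar R) x y : A x ->
  (F \_ (A `*` B)) (x, y) = ((fun y => F (x, y)) \_ B) y.
Proof.
move=> Ax; rewrite /patch; have [By|By] := pselect (B y).
  by rewrite [in RHS]mem_set// mem_set.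
by rewrite [in RHS]memNset// memNset// => -[].
Qed.

Let patch_setXr (A : set T1) (B : set T2) (F : T1 * T2 -> \bar R) x y : B y ->
  (F \_ (A `*` B)) (x, y) = ((fun x => F (x, y)) \_ A) x.
Proof.
move=> By; rewrite /patch; have [Ax|Ax] := pselect (A x).
  by rewrite [in RHS]mem_set// mem_set.
by rewrite [in RHS]memNset// memNset// => -[].
Qed.

Lemma measurable_integral_set (B : set T2) (F : T1 * T2 -> \bar R) :
  measurable B -> measurable_fun setT F -> (forall z, 0 <= F z) ->
  measurable_fun setT (fun x => \int[m2]_(y in B) F (x, y)).
Proof.
move=> mB mF F0; pose G := F \_ (setT `*` B).
have mG : measurable_fun setT G.
  apply/(measurable_restrictT _ _).1; first exact: measurableX.
  exact: measurable_funS mF.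
have G0 z : 0 <= G z by rewrite /G /patch; case: ifPn.
rewrite (_ : (fun _ => _) = fun x => \int[m2]_y G (x, y)).
  exact: (@measurable_fun_fubini_tonelli_F _ _ _ _ _ m2 G mG G0).
apply/funext => x; rewrite integral_mkcond; apply: eq_integral => y _.
by rewrite /G patch_setXl.
Qed.

Lemma tonelli_set (A : set T1) (B : set T2) (F : T1 * T2 -> \bar R) :
  measurable A -> measurable B -> measurable_fun setT F -> (forall z, 0 <= F z) ->
  \int[m1]_(x in A) \int[m2]_(y in B) F (x, y) =
  \int[m2]_(y in B) \int[m1]_(x in A) F (x, y).
Proof.
move=> mA mB mF F0; pose G := F \_ (A `*` B).
have mG : measurable_fun setT G.
  apply/(measurable_restrictT _ _).1; first exact: measurableX.
  exact: measurable_funS mF.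
have G0 z : 0 <= G z by rewrite /G /patch; case: ifPn.
transitivity (\int[m1]_x \int[m2]_y G (x, y)).
  rewrite integral_mkcond; apply: eq_integral => x _.
  rewrite [LHS]/patch; have [Ax|Ax] := pselect (A x).
    rewrite mem_set// integral_mkcond; apply: eq_integral => y _.
    by rewrite /G patch_setXl.
  by rewrite memNset// integral0_eq// => y _; rewrite /G /patch memNset//= => -[].
rewrite (@fubini_tonelli _ _ _ _ _ m1 m2 G)//.
rewrite [RHS]integral_mkcond; apply: eq_integral => y _.
rewrite [RHS]/patch; have [By|By] := pselect (B y).
  rewrite mem_set// [RHS]integral_mkcond; apply: eq_integral => x _.
  by rewrite /G patch_setXr.
by rewrite memNset// integral0_eq// => x _; rewrite /G /patch memNset//= => -[].
Qed.

End averaging.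

Section sampling_operator.
Context {R : realType} {n : nat} (k : nat) (s : seq (R * nat)).
Hypothesis sk : forall e, e \in s -> (1 <= e.2 <= k)%N.
Hypothesis sE : forall (g : 'rV[R]_n -> R) (v x : 'rV[R]_n),
  iter k (fdiff v) g x = (-1) ^+ k * (g x - \sum_(e <- s) e.1 * g (x + e.2%:R *: v)).
Implicit Types (f g : 'rV[R]_n -> R) (v w x y : 'rV[R]_n).

Definition sampling v g x : R := \sum_(e <- s) e.1 * g (x + e.2%:R *: v).

Lemma sampling_error v g x : `|g x - sampling v g x| = `|iter k (fdiff v) g x|.
Proof. by rewrite sE normrM normrX normrN1 expr1n mul1r. Qed.

Lemma sampling_comm v w g x :
  sampling v (sampling w g) x = sampling w (sampling v g) x.
Proof.
rewrite /sampling; under eq_bigr do rewrite big_distrr/=.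
under [RHS]eq_bigr do rewrite big_distrr/=.
rewrite exchange_big/=; apply: eq_bigr => e _; apply: eq_bigr => e' _.
by rewrite mulrCA addrAC.
Qed.

Lemma samplingB v g g' x :
  sampling v g x - sampling v g' x =
  \sum_(e <- s) e.1 * (g (x + e.2%:R *: v) - g' (x + e.2%:R *: v)).
Proof. by rewrite -sumrB; apply: eq_bigr => e _; rewrite mulrBr. Qed.

(* Both samples are compared with T^v T^w g, so that only k-th differences of
   g appear although v and w are unrelated. *)
Lemma sampling_dist v w g x :
  `|sampling v g x - sampling w g x| <=
  \sum_(e <- s) `|e.1| * `|iter k (fdiff w) g (x + e.2%:R *: v)| +
  \sum_(e <- s) `|e.1| * `|iter k (fdiff v) g (x + e.2%:R *: w)|.
Proof.
have -> : sampling v g x - sampling w g x =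
    (sampling v g x - sampling v (sampling w g) x) -
    (sampling w g x - sampling w (sampling v g) x).
  by rewrite (sampling_comm w v); ring.
apply: (le_trans (ler_normB _ _)); rewrite !samplingB; apply: lerD;
  apply: (le_trans (ler_norm_sum _ _ _)); apply: ler_sum => e _;
  by rewrite normrM sampling_error.
Qed.

Lemma powR_sum_subadd (p : R) (I : Type) (t : seq I) (a : I -> R) : 0 < p <= 1 ->
  (forall i, 0 <= a i) -> (\sum_(i <- t) a i) `^ p <= \sum_(i <- t) a i `^ p.
Proof.
move=> p01 a0; elim: t => [|i t ih].
  by rewrite !big_nil powR0//; case/andP: p01 => /gt_eqF ->.
rewrite !big_cons; apply: le_trans (powR_subadd p01 _ _) _ => //; first exact: sumr_ge0.
exact: lerD.
Qed.

Lemma powR_normD (p a b : R) : 0 < p <= 1 -> `|a + b| `^ p <= `|a| `^ p + `|b| `^ p.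
Proof.
move=> p01; apply: le_trans (powR_subadd p01 _ _) => //.
by case/andP: p01 => p0 _; apply: ge0_ler_powR; rewrite ?nnegrE ?addr_ge0 ?(ltW p0)//; exact: ler_normD.
Qed.

Definition sampling_weight (p : R) : R := \sum_(e <- s) `|e.1| `^ p.

Lemma sampling_dist_powR (p : R) v w g x : 0 < p <= 1 ->
  `|sampling v g x - sampling w g x| `^ p <=
  \sum_(e <- s) `|e.1| `^ p * `|iter k (fdiff w) g (x + e.2%:R *: v)| `^ p +
  \sum_(e <- s) `|e.1| `^ p * `|iter k (fdiff v) g (x + e.2%:R *: w)| `^ p.
Proof.
move=> p01; have [p0 _] := andP p01.
apply: (@le_trans _ _ ((\sum_(e <- s) `|e.1| * `|iter k (fdiff w) g (x + e.2%:R *: v)| +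
  \sum_(e <- s) `|e.1| * `|iter k (fdiff v) g (x + e.2%:R *: w)|) `^ p)).
  apply: ge0_ler_powR; rewrite ?nnegrE ?(ltW p0)//; last exact: sampling_dist.
  by apply: addr_ge0; apply: sumr_ge0 => e _; rewrite mulr_ge0.
apply: (le_trans (powR_subadd p01 _ _)); [by apply: sumr_ge0 => e _; rewrite mulr_ge0..|].
by apply: lerD; (apply: le_trans (powR_sum_subadd _ p01 _) _ => [e|]; first by rewrite mulr_ge0);
  apply: ler_sum => e _; rewrite powRM.
Qed.

Lemma sampling_powR (p : R) v g x : 0 < p <= 1 ->
  `|sampling v g x| `^ p <= \sum_(e <- s) `|e.1| `^ p * `|g (x + e.2%:R *: v)| `^ p.
Proof.
move=> p01; have [p0 _] := andP p01.
apply: (@le_trans _ _ ((\sum_(e <- s) `|e.1| * `|g (x + e.2%:R *: v)|) `^ p)).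
  apply: ge0_ler_powR; rewrite ?nnegrE ?(ltW p0)//; first by apply: sumr_ge0 => e _; rewrite mulr_ge0.
  by apply: (le_trans (ler_norm_sum _ _ _)); apply: ler_sum => e _; rewrite normrM.
apply: le_trans (powR_sum_subadd _ p01 _) _ => [e|]; first by rewrite mulr_ge0.
by apply: ler_sum => e _; rewrite powRM.
Qed.

(** A k-th difference depends continuously on its step and vanishes at step [0], because [k > 0]. *)
Lemma fdiff_small g x (eps : R) : continuous g -> (0 < k)%N -> 0 < eps ->
  exists2 d : R, 0 < d & forall v, `|v| < d -> `|g x - sampling v g x| <= eps.
Proof.
move=> cg k0 eps0.
have cs : continuous (fun v => g x - sampling v g x).
  have ct : continuous (fun v => sampling v g x).
    apply: continuous_big => [|e _ v]; first exact: add_continuous.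
    have ch : continuous (fun v : 'rV[R]_n => g (x + e.2%:R *: v)).
      move=> w; apply: (@continuous_comp _ _ _ (fun v : 'rV[R]_n => x + e.2%:R *: v)); last exact: cg.
      exact: cvgD (cvg_cst _) (@scaler_continuous _ _ _ w).
    exact: cvgM (cvg_cst _) (ch v).
  by move=> v; exact: cvgB (cvg_cst _) (ct v).
have v0 : g x - sampling 0 g x = 0.
  apply/eqP; rewrite -normr_eq0 sampling_error.
  by case: k k0 => // m _; rewrite iterS /fdiff addr0 subrr normr0.
have /cvgrPdist_le := cs 0; rewrite v0 => /(_ _ eps0) /nbhs_ballP[d /= d0 h].
exists d => // v vd; have := h v; rewrite sub0r normrN; apply.
by rewrite -ball_normE/= sub0r normrN.
Qed.

Lemma measurable_sampling g x : measurable_fun setT g ->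
  measurable_fun setT (fun v => sampling v g x).
Proof.
move=> mg; apply: measurable_sum => e; apply: measurable_funM => //.
apply: (measurableT_comp mg); apply: measurable_rV_add => //.
exact: measurable_rV_scale.
Qed.

End sampling_operator.

Section geometric_sums.
Context {R : realType}.
Local Open Scope ereal_scope.

Lemma geometric_nneseries_le (a z : R) : (0 <= a)%R -> (0 <= z < 1)%R ->
  \sum_(0 <= i <oo) (a * z ^+ i)%:E <= (a / (1 - z))%:E.
Proof.
move=> a0 /andP[z0 z1]; have z1' : (0 < 1 - z)%R by rewrite subr_gt0.
apply: lime_le.
  by apply: is_cvg_nneseries => i _ _; rewrite lee_fin mulr_ge0// exprn_ge0.
apply: nearW => N; rewrite sumEFin lee_fin -mulr_sumr; apply: ler_wpM2l => //.
rewrite -[leRHS]mul1r ler_pdivlMr//.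
have -> : ((\sum_(0 <= i < N) z ^+ i) * (1 - z) = 1 - z ^+ N)%R.
  elim: N => [|N ih]; first by rewrite big_nil mul0r expr0 subrr.
  by rewrite big_nat_recr//= mulrDl ih exprSr; ring.
by rewrite gerBl exprn_ge0.
Qed.

(** The common tool for the explicit integral estimates below (Poisson kernel, bumps, Gamma
    function). The sets [E m] may overlap, so full balls can be used as shells; only the product
    [z * y] of the decay of [f] and the growth of the measure has to be less than [1]. *)
Lemma integral_shells_le d (T : measurableType d) (mu : {measure set T -> \bar R})
    (D : set T) (f : T -> \bar R) (E : nat -> set T) (c z b y : R) :
  (0 <= c)%R -> (0 <= z)%R -> (0 <= b)%R -> (0 <= y)%R -> (z * y < 1)%R ->
  (forall m, measurable (E m)) -> (forall m, mu (E m) <= (b * y ^+ m)%:E) ->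
  (forall x, D x -> 0 <= f x) ->
  (forall x, D x -> exists2 m, E m x & f x <= (c * z ^+ m)%:E) ->
  \int[mu]_(x in D) f x <= (c * b / (1 - z * y))%:E.
Proof.
move=> c0 z0 b0 y0 zy mE muE f0 fE.
have w0 m : (0 <= c * z ^+ m)%R by rewrite mulr_ge0// exprn_ge0.
pose g m x : \bar R := (c * z ^+ m * \1_(E m) x)%:E.
have g0 m x : 0 <= g m x by rewrite lee_fin mulr_ge0// indicE.
have mi m : measurable_fun setT (fun x => (\1_(E m) x)%:E : \bar R).
  by apply/measurable_EFinP; exact: measurable_indic.
have mg m : measurable_fun setT (g m).
  by rewrite /g; under eq_fun do rewrite EFinM; exact: emeasurable_funM.
apply: (@le_trans _ _ (\int[mu]_x (\sum_(0 <= m <oo) g m x))).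
  rewrite integral_mkcond; apply: le_nnint => x _.
    by rewrite /patch; case: ifPn => //; rewrite inE => /f0.
  rewrite /patch; case: ifPn => [|_]; last by apply: nneseries_ge0 => m _ _; exact: g0.
  rewrite inE => /fE[m Em fm]; rewrite (nneseriesD1 (n := m) (fun k _ => g0 k x))//.
  apply: le_trans fm _; rewrite /g indicE mem_set// mulr1.
  by apply: leeDl; apply: nneseries_ge0 => k _ _; exact: g0.
rewrite integral_nneseries//.
apply: le_trans (geometric_nneseries_le (a := (c * b)%R) (z := (z * y)%R) _ _); last 2 first.
- by rewrite mulr_ge0.
- by rewrite mulr_ge0.
apply: lee_nneseries => [m _ _|m _]; first by apply: integral_ge0 => x _; exact: g0.
rewrite /g; under eq_integral do rewrite EFinM.
rewrite ge0_integralZl//; last by rewrite lee_fin.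
rewrite integral_indic// setIT; apply: (le_trans (lee_wpmul2l _ (muE m))); first by rewrite lee_fin.
by rewrite -EFinM lee_fin exprMn mulrACA.
Qed.

Lemma geometric_tail_le (g M : R) : (0 < g)%R -> (0 < M)%R ->
  \esum_(j in [set: int]) (if (2 `^ j%:~R < M)%R then (2 `^ (j%:~R * g))%:E else 0) <=
  ((1 - 2 `^ (- g))^-1 * M `^ g)%:E.
Proof.
move=> g0 M0; have [j0 /andP[h1 h2]] := @geometric_ex R 2%R M ltac:(lra) M0.
have z01 : (0 <= (2 : R) `^ (- g) < 1)%R by rewrite powR_ge0 powR2_lt1.
have z1 : (0 < 1 - (2 : R) `^ (- g))%R by rewrite subr_gt0; case/andP: z01.
have two (x y : R) : ((2 `^ x < 2 `^ y) = (x < y))%R.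
  rewrite /powR (_ : (2 == 0 :> R)%R = false) ?gt_eqF// ltr_expR ltr_pM2r//.
  by rewrite ln_gt0; lra.
have below (j : int) : (2 `^ j%:~R < M)%R -> (j <= j0)%R.
  by move=> /lt_le_trans/(_ h2); rewrite two ltr_int ltzD1.
(* Counting downwards from [j0], the largest exponent with [2 ^ j0 < M], turns the sum into a
   geometric series. *)
pose e (i : nat) : int := (j0 - i%:Z)%R.
have -> : \esum_(j in [set: int]) (if (2 `^ j%:~R < M)%R then (2 `^ (j%:~R * g))%:E else 0) =
   \esum_(j in e @` setT) (if (2 `^ j%:~R < M)%R then (2 `^ (j%:~R * g))%:E else 0).
  rewrite [RHS]esum_mkcond; apply: eq_esum => j _; case: ifPn => [jM|_]; last by case: ifP.
  rewrite mem_set//; exists `|(j0 - j)%R|%N => //.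
  by rewrite /e gez0_abs ?subr_ge0 ?below// opprB addrC subrK.
rewrite esum_image; last by move=> i i' _ _; rewrite /e => /addrI/oppr_inj[].
rewrite -nneseries_esumT; last by move=> i; case: ifP => // _; rewrite lee_fin powR_ge0.
apply: (@le_trans _ _ (\sum_(0 <= i <oo) (2 `^ (j0%:~R * g) * (2 `^ (- g)) ^+ i)%:E)).
  apply: lee_nneseries => [i *|i *]; first by case: ifP => // _; rewrite lee_fin powR_ge0.
  have -> : (2 `^ (j0%:~R * g) * (2 `^ (- g)) ^+ i = 2 `^ ((e i)%:~R * g))%R.
    rewrite -powR_mulrn ?powR_ge0// -powRrM -powRD; last by rewrite (_ : (2 != 0 :> R)%R) ?implybT.
    by congr (_ `^ _)%R; rewrite /e intrB; ring.
  by case: ifP => // _; rewrite lee_fin powR_ge0.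
apply: (le_trans (geometric_nneseries_le (powR_ge0 _ _) z01)).
rewrite lee_fin mulrC; apply: ler_wpM2l; first by rewrite invr_ge0 ltW.
by rewrite powRrM; apply: ge0_ler_powR; rewrite ?nnegrE ?powR_ge0 ?ltW.
Qed.

End geometric_sums.

Section cubes.
Context {R : realType} {n : nat}.
Implicit Types (x y a : 'rV[R]_n) (r : R).
Local Notation L := (@lebesgue_rV R n).

Definition cube a r : set 'rV[R]_n :=
  [set x | forall i, a ord0 i <= x ord0 i < a ord0 i + r].

Definition nball a r : set 'rV[R]_n := [set x | `|x - a| < r].

Lemma measurable_cube a r : measurable (cube a r).
Proof.
rewrite (_ : cube a r = \bigcap_(i in [set: 'I_n]) ((fun x : 'rV[R]_n => x ord0 i) @^-1`
     `[(a ord0 i), (a ord0 i + r)[)).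
  apply: fin_bigcap_measurable => // i _; rewrite -[X in measurable X]setTI.
  exact: measurable_coord.
by apply/seteqP; split => x h i; have := h i; rewrite /= in_itv//= => /(_ Logic.I).
Qed.

Lemma measurable_nball a r : measurable (nball a r).
Proof. exact: measurable_rV_nball. Qed.

Lemma cube_measure a r : 0 <= r -> (L (cube a r) = (r ^+ n)%:E)%E.
Proof. exact: lebesgue_rV_cube. Qed.

Lemma cube_dist a r x y : 0 < r -> cube a r x -> cube a r y -> `|x - y| < r.
Proof.
move=> r0 hx hy; apply: rV_norm_lt => // i; rewrite !mxE ltr_norml.
have /andP[x1 x2] := hx i; have /andP[y1 y2] := hy i.
by apply/andP; split; lra.
Qed.

Lemma cube_sub_nball r : 0 < r -> cube 0 r `<=` nball 0 r.
Proof.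
move=> r0 x hx; rewrite /nball/= -(subr0 x) subr0; apply: (cube_dist r0 hx) => i.
by rewrite mxE add0r lexx r0.
Qed.

Definition scale (j : int) : R := 2 `^ (- (j%:~R)).

Lemma scale_gt0 j : 0 < scale j. Proof. exact: powR_gt0. Qed.

Lemma scaleS j : scale (j + 1) = scale j / 2.
Proof.
by rewrite /scale !powRN (powR_intS j (ltr0Sn R 1)) invfM mulrC.
Qed.

Definition dyadic_cube (q : int * 'rV[int]_n) : set 'rV[R]_n :=
  cube (scale q.1 *: map_mx intr q.2) (scale q.1).

(** Reading the index off from floors yields at once existence and uniqueness of the cube of a given
    generation through a point. *)
Lemma dyadic_cubeP j m x : dyadic_cube (j, m) x <->
  m = \row_i Num.floor (x ord0 i / scale j).
Proof.
have c0 := scale_gt0 j.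
have eqv i : (scale j *: map_mx intr m : 'rV[R]_n) ord0 i <= x ord0 i <
    (scale j *: map_mx intr m : 'rV[R]_n) ord0 i + scale j <->
    m ord0 i = Num.floor (x ord0 i / scale j).
  rewrite !mxE -[X in _ + X]mulr1 -mulrDr.
  split => [/andP[h1 h2]|->].
    apply/esym/floor_def; rewrite ler_pdivlMr// ltr_pdivrMr// mulrC h1/=.
    by rewrite intrD mulrC.
  have /andP[h1 h2] := real_floor_itv (num_real (x ord0 i / scale j)).
  move: h1 h2; rewrite ler_pdivlMr// ltr_pdivrMr// intrD => h1 h2.
  by rewrite ![scale j * _]mulrC h1 h2.
split => [h|mE i]; last by apply/eqv; rewrite mE mxE.
by apply/rowP => i; rewrite mxE; apply/eqv; exact: h.
Qed.

Lemma dyadic_cube_uniq j m m' x : dyadic_cube (j, m) x -> dyadic_cube (j, m') x -> m = m'.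
Proof. by move=> /dyadic_cubeP -> /dyadic_cubeP ->. Qed.

Lemma dyadic_cube_ex j x : exists m, dyadic_cube (j, m) x.
Proof. by eexists; apply/dyadic_cubeP; reflexivity. Qed.

End cubes.

Section decomposition.
Context {R : realType} {n : nat} (k : nat) (s : seq (R * nat)).
Hypothesis sk : forall e, e \in s -> (1 <= e.2 <= k)%N.
Hypothesis sE : forall (g : 'rV[R]_n -> R) (v x : 'rV[R]_n),
  iter k (fdiff v) g x = (-1) ^+ k * (g x - \sum_(e <- s) e.1 * g (x + e.2%:R *: v)).
Context (p : R) (p01 : 0 < p <= 1) (f : 'rV[R]_n -> R) (cf : continuous f).
Local Open Scope ereal_scope.
Local Notation L := (@lebesgue_rV R n).
Local Notation T v x := (sampling s v f x).
Local Notation M := (sampling_weight s p).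

Let mf : measurable_fun setT f. Proof. exact: continuous_rV_measurable. Qed.

Let M0 : (0 <= M)%R. Proof. by apply: sumr_ge0 => e _; exact: powR_ge0. Qed.

Let Phi (z : 'rV[R]_n * 'rV[R]_n) : \bar R := (`|iter k (fdiff z.1) f z.2| `^ p)%:E.

Let mPhi : measurable_fun setT Phi. Proof. exact: measurable_fdiff_powR. Qed.

Let Phi0 z : 0 <= Phi z. Proof. by rewrite lee_fin powR_ge0. Qed.

Definition local_diff r y := \int[L]_(h in nball 0 r) (`|iter k (fdiff h) f y| `^ p)%:E.

(** Not normalised by volumes. The radius [(k + 1) r] is what contains all sample points [x' + e v]
    with [e <= k] and [|v| < r], and still does after [x'] is moved by less than [r]. *)
Definition local_mean_diff r x := \int[L]_(y in nball x (k.+1%:R * r)%R) local_diff r y.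

Let local_diff_ge0 r y : 0 <= local_diff r y. Proof. exact: integral_ge0. Qed.

Let measurable_local_diff r : measurable_fun setT (local_diff r).
Proof.
have msw : measurable_fun setT (fun z : 'rV[R]_n * 'rV[R]_n => Phi (z.2, z.1)).
  by apply: (measurableT_comp mPhi); exact: measurable_fun_pair.
by have := measurable_integral_set L (measurable_nball 0%R r) msw (fun _ => Phi0 _).
Qed.

(** The substitution [y = x + e v] has Jacobian factor [e ^ (- n) <= 1], since [e >= 1], and it maps
    the cube into the ball on the right. *)
Lemma smear_le (G : 'rV[R]_n -> \bar R) x x' r (e : nat) :
  measurable_fun setT G -> (forall y, 0 <= G y) -> (0 < r)%R -> (1 <= e <= k)%N ->
  (`|x - x'| < r)%R ->
  \int[L]_(v in cube 0%R r) G (x + e%:R *: v)%R <=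
  \int[L]_(y in nball x' (k.+1%:R * r)%R) G y.
Proof.
move=> mG G0 r0 /andP[e1 ek] xx'.
pose G' := G \_ (nball x' (k.+1%:R * r)%R).
have mG' : measurable_fun setT G'.
  apply/(measurable_restrictT _ _).1; first exact: measurable_nball.
  exact: measurable_funS mG.
have G'0 y : 0 <= G' y by rewrite /G' /patch; case: ifPn.
have e0 : (0 < e%:R :> R)%R by rewrite ltr0n.
apply: (@le_trans _ _ (\int[L]_(v in cube 0%R r) G' (x + e%:R *: v)%R)).
  apply: le_nnint => v vr //; rewrite /G' /patch mem_set// /nball/=.
  rewrite addrAC; apply: (le_lt_trans (ler_normD _ _)); rewrite normrZ ger0_norm ?ltW//.
  have vr' : (`|v| < r)%R by have := cube_sub_nball r0 vr; rewrite /nball/= subr0.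
  rewrite -natr1 mulrDl mul1r [ltRHS]addrC; apply: ltr_leD => //.
  apply: ler_pM => //; [by rewrite ler_nat|exact: ltW].
apply: (@le_trans _ _ (\int[L]_v G' (x + e%:R *: v)%R)).
  by apply: le_nnint_subset.
rewrite integral_rV_affine// [leRHS]integral_mkcond -/G' -[leRHS]mul1e.
apply: lee_wpmul2r; first exact: integral_ge0.
have ei : (e%:R^-1 <= 1 :> R)%R by rewrite invf_le1// ler1n.
by rewrite lee_fin exprn_ile1// invr_ge0 ltW.
Qed.

Let pair_shift (x : 'rV[R]_n) (e : nat) :
  measurable_fun setT (fun z : 'rV[R]_n * 'rV[R]_n => Phi (z.2, x + e%:R *: z.1)%R).
Proof.
apply: (measurableT_comp mPhi); apply: measurable_fun_pair => //.
by apply: measurable_rV_add => //; exact: measurable_rV_scale.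
Qed.

Let pair_shift' (x : 'rV[R]_n) (e : nat) :
  measurable_fun setT (fun z : 'rV[R]_n * 'rV[R]_n => Phi (z.1, x + e%:R *: z.2)%R).
Proof.
apply: (measurableT_comp mPhi); apply: measurable_fun_pair => //.
by apply: measurable_rV_add => //; exact: measurable_rV_scale.
Qed.

Lemma integral2_sum (A B : set 'rV[R]_n) (t : seq (R * nat))
    (F : R * nat -> 'rV[R]_n * 'rV[R]_n -> \bar R) (K : \bar R) :
  measurable A -> measurable B -> (forall e, measurable_fun setT (F e)) ->
  (forall e z, 0 <= F e z) -> 0 <= K ->
  (forall e, e \in t -> \int[L]_(v in A) \int[L]_(w in B) F e (v, w) <= K) ->
  \int[L]_(v in A) \int[L]_(w in B) (\sum_(e <- t) (`|e.1| `^ p)%:E * F e (v, w)) <=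
  (\sum_(e <- t) `|e.1| `^ p)%:E * K.
Proof.
move=> mA mB mF F0 K0 FK.
have c0 e : 0 <= (`|e.1| `^ p)%:E by rewrite lee_fin powR_ge0.
have mFv e v : measurable_fun setT (fun w => F e (v, w)).
  by apply: (measurableT_comp (mF e)); exact: measurable_fun_pair.
have mI e : measurable_fun setT (fun v => \int[L]_(w in B) F e (v, w)).
  exact: measurable_integral_set.
have I0 e v : 0 <= \int[L]_(w in B) F e (v, w) by exact: integral_ge0.
under eq_integral => v _.
  rewrite ge0_integral_sum//; last 2 first.
  - by move=> e; apply: emeasurable_funM => //; exact: measurable_funS (mFv e v).
  - by move=> e w _; rewrite mule_ge0.
  under eq_bigr => e _.
    rewrite ge0_integralZl//; last exact: measurable_funS (mFv e v).
    over.
  over.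
rewrite ge0_integral_sum//; last 2 first.
- by move=> e; apply: emeasurable_funM => //; exact: measurable_funS (mI e).
- by move=> e v _; rewrite mule_ge0.
rewrite -sumEFin ge0_sume_distrl//.
rewrite big_seq [leRHS]big_seq; apply: lee_sum => e et.
rewrite ge0_integralZl//; last exact: measurable_funS (mI e).
by apply: lee_wpmul2l => //; exact: FK.
Qed.

Lemma integral2D (A B : set 'rV[R]_n) (F G : 'rV[R]_n * 'rV[R]_n -> \bar R) :
  measurable A -> measurable B -> measurable_fun setT F -> measurable_fun setT G ->
  (forall z, 0 <= F z) -> (forall z, 0 <= G z) ->
  \int[L]_(v in A) \int[L]_(w in B) (F (v, w) + G (v, w)) =
  \int[L]_(v in A) \int[L]_(w in B) F (v, w) + \int[L]_(v in A) \int[L]_(w in B) G (v, w).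
Proof.
move=> mA mB mF mG F0 G0.
have ms (S : 'rV[R]_n * 'rV[R]_n -> \bar R) v : measurable_fun setT S ->
    measurable_fun B (fun w => S (v, w)).
  move=> mS; apply: (@measurable_funS _ _ _ _ setT) => //.
  by apply: (measurableT_comp mS); exact: measurable_fun_pair.
rewrite -ge0_integralD//.
- by apply: eq_integral => v _; rewrite ge0_integralD//; exact: ms.
- by move=> v _; exact: integral_ge0.
- by apply: (@measurable_funS _ _ _ _ setT) => //; exact: measurable_integral_set.
- by move=> v _; exact: integral_ge0.
- by apply: (@measurable_funS _ _ _ _ setT) => //; exact: measurable_integral_set.
Qed.

(** In [sampling_dist_powR] one of [v], [w] is the step of a k-th difference and the other only
    displaces the point, so integration over both reduces to [smear_le]. The factor [2] counts the
    two symmetric sums, exchanged by Tonelli. The point [x'] is left free so that the bound can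
    later be averaged over a cube. *)
Lemma sampling_osc_le a b r x x' : (0 < a <= r)%R -> (0 < b <= r)%R ->
  (`|x - x'| < r)%R ->
  \int[L]_(v in cube 0%R a) \int[L]_(w in cube 0%R b) (`|T v x - T w x| `^ p)%:E <=
  (2 * M)%:E * local_mean_diff r x'.
Proof.
move=> /andP[a0 ar] /andP[b0 br] xx'.
have r0 : (0 < r)%R by lra.
have sub c : (c <= r)%R -> cube 0%R c `<=` (cube 0%R r : set 'rV[R]_n).
  by move=> cr v hv i; have /andP[h1 h2] := hv i; rewrite h1/=; lra.
pose F1 (e : R * nat) (z : 'rV[R]_n * 'rV[R]_n) := Phi (z.2, x + e.2%:R *: z.1)%R.
pose F2 (e : R * nat) (z : 'rV[R]_n * 'rV[R]_n) := Phi (z.1, x + e.2%:R *: z.2)%R.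
pose S1 z := \sum_(e <- s) (`|e.1| `^ p)%:E * F1 e z.
pose S2 z := \sum_(e <- s) (`|e.1| `^ p)%:E * F2 e z.
have S10 z : 0 <= S1 z by apply: sume_ge0 => e _; rewrite mule_ge0// lee_fin powR_ge0.
have S20 z : 0 <= S2 z by apply: sume_ge0 => e _; rewrite mule_ge0// lee_fin powR_ge0.
have mS1 : measurable_fun setT S1.
  by apply: emeasurable_sum => e; apply: emeasurable_funM => //; exact: pair_shift.
have mS2 : measurable_fun setT S2.
  by apply: emeasurable_sum => e; apply: emeasurable_funM => //; exact: pair_shift'.
have mQ := @measurable_cube R n 0%R r.
have H0 : 0 <= local_mean_diff r x' by exact: integral_ge0.
have key e : e \in s -> \int[L]_(v in cube 0%R r) \int[L]_(w in cube 0%R r) F1 e (v, w) <=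
    local_mean_diff r x'.
  move=> /sk e1k.
  apply: (le_trans _ (smear_le (measurable_local_diff r) (fun y => local_diff_ge0 r y) r0 e1k xx')).
  apply: le_nnint => v _; first by apply: integral_ge0 => w _; exact: Phi0.
  by apply: le_nnint_subset; [move=> w _; exact: Phi0|exact: cube_sub_nball].
have pt v w : (`|T v x - T w x| `^ p)%:E <= S1 (v, w) + S2 (v, w).
  have -> : S1 (v, w) + S2 (v, w) =
     (\sum_(e <- s) `|e.1| `^ p * `|iter k (fdiff w) f (x + e.2%:R *: v)| `^ p +
      \sum_(e <- s) `|e.1| `^ p * `|iter k (fdiff v) f (x + e.2%:R *: w)| `^ p)%R%:E.
    rewrite EFinD -!sumEFin /S1 /S2.
    by congr (_ + _); apply: eq_bigr => e _; rewrite [in RHS]EFinM.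
  by rewrite lee_fin; apply: (sampling_dist_powR sE).
have i1 : \int[L]_(v in cube 0%R r) \int[L]_(w in cube 0%R r) S1 (v, w) <=
    M%:E * local_mean_diff r x'.
  exact: (@integral2_sum _ _ s F1 _ mQ mQ (fun e => pair_shift x e.2) (fun e z => Phi0 _) H0 key).
have i2 : \int[L]_(v in cube 0%R r) \int[L]_(w in cube 0%R r) S2 (v, w) <=
    M%:E * local_mean_diff r x'.
  apply: (@integral2_sum _ _ s F2 _ mQ mQ (fun e => pair_shift' x e.2) (fun e z => Phi0 _) H0).
  move=> e es; rewrite (@tonelli_set _ _ _ _ _ L L _ _ (F2 e) mQ mQ).
  - exact: key.
  - exact: pair_shift'.
  - by move=> z; exact: Phi0.
clearbody S1 S2.
have S120 z : 0 <= S1 z + S2 z by exact: (adde_ge0 (S10 z) (S20 z)).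
have M2 : (2 * M)%:E * local_mean_diff r x' =
    M%:E * local_mean_diff r x' + M%:E * local_mean_diff r x'.
  by rewrite mulrDl mul1r EFinD ge0_muleDl// lee_fin.
rewrite M2; apply: (le_trans _ (leeD i1 i2)).
rewrite -(integral2D mQ mQ mS1 mS2 S10 S20).
apply: (@le_trans _ _ (\int[L]_(v in cube 0%R a) \int[L]_(w in cube 0%R r)
  (S1 (v, w) + S2 (v, w)))); last first.
  apply: le_nnint_subset; last exact: sub.
  by move=> v _; apply: integral_ge0 => w _; exact: S120.
apply: le_nnint => v _; first by apply: integral_ge0 => w _; rewrite lee_fin powR_ge0.
apply: (@le_trans _ _ (\int[L]_(w in cube 0%R b) (S1 (v, w) + S2 (v, w)))); last first.
  by apply: le_nnint_subset; [move=> w _; exact: S120|exact: sub].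
by apply: le_nnint => w _; [rewrite lee_fin powR_ge0|exact: pt].
Qed.

Lemma sampling_select r x : (0 < r)%R -> exists2 v, cube 0%R r v &
  (r ^+ n)%:E * \int[L]_(w in cube 0%R r) (`|T v x - T w x| `^ p)%:E <=
  \int[L]_(v in cube 0%R r) \int[L]_(w in cube 0%R r) (`|T v x - T w x| `^ p)%:E.
Proof.
move=> r0; have mQ := @measurable_cube R n 0%R r.
have cm := cube_measure (0%R : 'rV[R]_n) (ltW r0).
have c0 : 0 < L (cube 0%R r) by rewrite cm lte_fin exprn_gt0.
have coo : L (cube 0%R r) < +oo by rewrite cm ltry.
rewrite -cm; apply: (exists_le_mean mQ c0 coo).
- apply: (@measurable_funS _ _ _ _ setT) => //.
  have mT : measurable_fun setT
      (fun z : 'rV[R]_n * 'rV[R]_n => (`|T z.1 x - T z.2 x| `^ p)%:E).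
    apply/measurable_EFinP; apply: (measurableT_comp (measurable_powR p)).
    apply: measurableT_comp => //; apply: measurable_funB.
      exact: (measurableT_comp (measurable_sampling s x mf)).
    exact: (measurableT_comp (measurable_sampling s x mf)).
  apply: (measurable_integral_set L mQ mT) => z.
  by rewrite lee_fin powR_ge0.
- by move=> v _; apply: integral_ge0 => w _; rewrite lee_fin powR_ge0.
Qed.

End decomposition.

(** * Selected sample values at each point and scale *)

Section mean_values.
Context {R : realType} {n : nat} (k : nat) (s : seq (R * nat)).
Hypothesis k0 : (0 < k)%N.
Hypothesis sk : forall e, e \in s -> (1 <= e.2 <= k)%N.
Hypothesis sE : forall (g : 'rV[R]_n -> R) (v x : 'rV[R]_n),
  iter k (fdiff v) g x = (-1) ^+ k * (g x - \sum_(e <- s) e.1 * g (x + e.2%:R *: v)).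
Context (p : R) (p01 : 0 < p <= 1) (f : 'rV[R]_n -> R) (cf : continuous f).
Local Open Scope ereal_scope.
Local Notation L := (@lebesgue_rV R n).
Local Notation T v x := (sampling s v f x).
Local Notation M := (sampling_weight s p).
Local Notation H := (local_mean_diff k p f).

Let mf : measurable_fun setT f. Proof. exact: continuous_rV_measurable. Qed.

Let M0 : (0 <= M)%R. Proof. by apply: sumr_ge0 => e _; exact: powR_ge0. Qed.

Let H0 r x : 0 <= H r x.
Proof. by apply: integral_ge0 => y _; apply: integral_ge0 => h _; rewrite lee_fin powR_ge0. Qed.

(** A substitute for the mean of [T^w x] over the cube: a single sample whose mean deviation, in
    p-th power, is at most the mean over all samples. The inequality is multiplied by the volume
    [r ^ n] to avoid dividing extended reals. *)
Definition is_mean_value r x (c : R) := exists2 v, cube 0%R r v & c = T v x /\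
  (r ^+ n)%:E * \int[L]_(w in cube 0%R r) (`|c - T w x| `^ p)%:E <=
  \int[L]_(v in cube 0%R r) \int[L]_(w in cube 0%R r) (`|T v x - T w x| `^ p)%:E.

Lemma mean_values_exist : exists c : R -> 'rV[R]_n -> R,
  forall r x, (0 < r)%R -> is_mean_value r x (c r x).
Proof.
have h (z : R * 'rV[R]_n) : exists c : R, (0 < z.1)%R -> is_mean_value z.1 z.2 c.
  have [z0|z0] := ltP 0%R z.1; last by exists 0%R => ?; lra.
  have [v vQ hv] := sampling_select s p cf z.2 z0.
  by exists (T v z.2) => _; exists v.
have [c hc] := choice h.
by exists (fun r x => c (r, x)) => r x r0; exact: (hc (r, x) r0).
Qed.

Let meas_sampling_dist (c : R) x :
  measurable_fun setT (fun w : 'rV[R]_n => (`|c - T w x| `^ p)%:E).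
Proof.
apply/measurable_EFinP; apply: (measurableT_comp (measurable_powR p)).
by apply: measurableT_comp => //; apply: measurable_funB => //; exact: measurable_sampling.
Qed.

Let powR_dist_trans (a b c d : R) :
  (`|a - d| `^ p)%:E <= (`|a - b| `^ p)%:E + (`|b - c| `^ p)%:E + (`|c - d| `^ p)%:E.
Proof.
rewrite -!EFinD lee_fin (_ : (a - d = (a - b) + ((b - c) + (c - d)))%R); last by ring.
apply: (le_trans (powR_normD (a - b)%R ((b - c) + (c - d))%R p01)).
by rewrite -[leRHS]addrA; apply: lerD => //; exact: (powR_normD (b - c)%R (c - d)%R p01).
Qed.

Lemma integral2_fst (A B : set 'rV[R]_n) (F : 'rV[R]_n -> \bar R) (b : R) :
  measurable A -> measurable B -> measurable_fun setT F -> (forall z, 0 <= F z) ->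
  (0 <= b)%R -> L B = b%:E ->
  \int[L]_(v in A) \int[L]_(w in B) F v = b%:E * \int[L]_(v in A) F v.
Proof.
move=> mA mB mF F0 b0 Bb; rewrite -(ge0_integralZl L mA)//; last exact: measurable_funS mF.
apply: eq_integral => v _; rewrite (integral_cst L mB (F v)) muleC.
by congr (_ * _); exact: Bb.
Qed.

Lemma integral2_snd (A B : set 'rV[R]_n) (F : 'rV[R]_n -> \bar R) (a : R) :
  measurable A -> L A = a%:E ->
  \int[L]_(v in A) \int[L]_(w in B) F w = a%:E * \int[L]_(w in B) F w.
Proof.
move=> mA Aa; rewrite (integral_cst L mA (\int[L]_(w in B) F w)) muleC.
by congr (_ * _); exact: Aa.
Qed.

(** With [K = 2 M H], the integrated triangle inequality of [mean_value_step] reads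
    [al be |c1 - c2| ^ p <= (2 + 2 ^ n) K] for the cube volumes [al = r ^ n] and [be = al / 2 ^ n];
    division by [al be] gives this constant times [r ^ (- 2 n)]. *)
Definition step_const : R := (2 ^+ n * ((2 + 2 ^+ n) * (2 * M)))%R.

Lemma step_const_ge0 : (0 <= step_const)%R.
Proof.
apply: mulr_ge0; first exact: exprn_ge0.
by apply: mulr_ge0; [apply: addr_ge0 => //; exact: exprn_ge0|exact: mulr_ge0].
Qed.

(** The triangle inequality for p-th powers through [T^v x] and [T^w x] is integrated over [v] in
    the cube of side [r] and [w] in that of side [r / 2]. The outer terms are controlled by the
    selection of [c1] and [c2], the middle one by [sampling_osc_le]. *)
Lemma mean_value_step r x x' (c1 c2 : R) : (0 < r)%R -> (`|x - x'| < r)%R ->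
  is_mean_value r x c1 -> is_mean_value (r / 2) x c2 ->
  (`|c1 - c2| `^ p)%:E <= (step_const * r^-1 ^+ (2 * n))%:E * H r x'.
Proof.
move=> r0 xx' [v1 _ [_ h1]] [v2 _ [_ h2]].
have r2 : (0 < r / 2)%R by rewrite divr_gt0.
have rr : (0 < r <= r)%R by rewrite r0 lexx.
have r2r : (0 < r / 2 <= r)%R by rewrite r2/= ler_pdivrMr//; lra.
have osc := sampling_osc_le sk sE p01 cf rr rr xx'.
have osc2 := sampling_osc_le sk sE p01 cf r2r r2r xx'.
have oscm := sampling_osc_le sk sE p01 cf rr r2r xx'.
set K := (2 * M)%:E * H r x' in osc osc2 oscm.
have K0 : 0 <= K by apply: mule_ge0; [rewrite lee_fin mulr_ge0|exact: H0].
have KE : K = (2 * M)%:E * H r x' by [].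
clearbody K.
pose al : R := (r ^+ n)%R; pose be : R := ((r / 2) ^+ n)%R.
have al0 : (0 < al)%R by rewrite exprn_gt0.
have be0 : (0 < be)%R by rewrite exprn_gt0.
have mQa := @measurable_cube R n 0%R r.
have mQb := @measurable_cube R n 0%R (r / 2)%R.
have ca := cube_measure (0%R : 'rV[R]_n) (ltW r0).
have cb := cube_measure (0%R : 'rV[R]_n) (ltW r2).
have ia (c : \bar R) : \int[L]_(w in cube 0%R r) c = c * al%:E.
  by rewrite (integral_cst L mQa c); congr (_ * _); exact: ca.
have ib (c : \bar R) : \int[L]_(w in cube 0%R (r / 2)) c = c * be%:E.
  by rewrite (integral_cst L mQb c); congr (_ * _); exact: cb.
pose A v := (`|c1 - T v x| `^ p)%:E; pose B w := (`|T w x - c2| `^ p)%:E.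
have A0 v : 0 <= A v by rewrite lee_fin powR_ge0.
have B0 v : 0 <= B v by rewrite lee_fin powR_ge0.
have mA : measurable_fun setT A by exact: meas_sampling_dist.
have mB : measurable_fun setT B.
  rewrite (_ : B = fun w => (`|c2 - T w x| `^ p)%:E); first exact: meas_sampling_dist.
  by apply/funext => w; rewrite /B distrC.
pose D (z : 'rV[R]_n * 'rV[R]_n) := (`|T z.1 x - T z.2 x| `^ p)%:E.
have D0 z : 0 <= D z by rewrite lee_fin powR_ge0.
have mD : measurable_fun setT D.
  apply/measurable_EFinP; apply: (measurableT_comp (measurable_powR p)).
  apply: measurableT_comp => //; apply: measurable_funB.
    exact: (measurableT_comp (measurable_sampling s x mf)).
  exact: (measurableT_comp (measurable_sampling s x mf)).
pose I1 := \int[L]_(v in cube 0%R r) A v.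
pose I2 := \int[L]_(v in cube 0%R r) \int[L]_(w in cube 0%R (r / 2)) D (v, w).
pose I3 := \int[L]_(w in cube 0%R (r / 2)) B w.
have I1K : al%:E * I1 <= K by apply: le_trans osc; exact: h1.
have I3K : be%:E * I3 <= K.
  apply: le_trans osc2; apply: le_trans h2; rewrite /I3.
  by under eq_integral do rewrite /B distrC.
have I2K : I2 <= K by exact: oscm.
have I10 : 0 <= I1 by exact: integral_ge0.
have I30 : 0 <= I3 by exact: integral_ge0.
have tri : (al * be)%:E * (`|c1 - c2| `^ p)%:E <= be%:E * I1 + I2 + al%:E * I3.
  have -> : (al * be)%:E * (`|c1 - c2| `^ p)%:E =
      \int[L]_(v in cube 0%R r) \int[L]_(w in cube 0%R (r / 2)) (`|c1 - c2| `^ p)%:E.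
    by rewrite ib ia -!EFinM mulrC (mulrC al) mulrA.
  have -> : be%:E * I1 = \int[L]_(v in cube 0%R r) \int[L]_(w in cube 0%R (r / 2)) (A v).
    exact/esym/(integral2_fst mQa mQb mA A0 (ltW be0) cb).
  have -> : al%:E * I3 = \int[L]_(v in cube 0%R r) \int[L]_(w in cube 0%R (r / 2)) (B w).
    exact/esym/(integral2_snd (cube 0%R (r / 2)) B mQa ca).
  have mA2 : measurable_fun setT (fun z : 'rV[R]_n * 'rV[R]_n => A z.1).
    exact: (measurableT_comp mA).
  have mB2 : measurable_fun setT (fun z : 'rV[R]_n * 'rV[R]_n => B z.2).
    exact: (measurableT_comp mB).
  rewrite -(integral2D mQa mQb mA2 mD (fun z => A0 z.1) D0).
  have mAD : measurable_fun setT (fun z : 'rV[R]_n * 'rV[R]_n => A z.1 + D z).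
    exact: (emeasurable_funD mA2 mD).
  rewrite -(integral2D mQa mQb mAD mB2 (fun z => adde_ge0 (A0 z.1) (D0 z)) (fun z => B0 z.2)).
  apply: le_nnint => v _; first by apply: integral_ge0 => w _; rewrite lee_fin powR_ge0.
  by apply: le_nnint => w _; [rewrite lee_fin powR_ge0|exact: powR_dist_trans].
clearbody I1 I2 I3.
have bal : (be = al / 2 ^+ n)%R by rewrite /be /al expr_div_n.
have two0 : (0 < 2 ^+ n :> R)%R by rewrite exprn_gt0.
have two1 : (1 <= 2 ^+ n :> R)%R by rewrite exprn_ege1// ler1n.
have {}tri : (al * be)%:E * (`|c1 - c2| `^ p)%:E <= (2 + 2 ^+ n)%:E * K.
  apply: (le_trans tri).
  have -> : (2 + 2 ^+ n)%:E * K = K + K + (2 ^+ n)%:E * K.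
    rewrite EFinD ge0_muleDl ?lee_fin ?(ltW two0)//; congr (_ + _).
    by rewrite (_ : 2 = 1 + 1)%R// EFinD ge0_muleDl ?lee_fin// mul1e.
  apply: leeD; first apply: leeD => //.
    apply: le_trans I1K; apply: lee_wpmul2r => //.
    by rewrite lee_fin bal ler_pdivrMr// ler_peMr// ltW.
  have -> : al%:E = (2 ^+ n)%:E * be%:E by rewrite -EFinM bal mulrC divfK// gt_eqF.
  by rewrite -muleA; apply: lee_wpmul2l => //; rewrite lee_fin ltW.
have ab0 : (0 < al * be)%R by rewrite mulr_gt0.
move: tri; rewrite -lee_pdivlMl// => /le_trans; apply.
rewrite KE !muleA -!EFinM; apply: lee_wpmul2r; first exact: H0.
rewrite lee_fin bal /step_const /al mulnC exprM -exprVn exprVn.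
rewrite le_eqVlt; apply/orP; left; apply/eqP.
have rn : (r ^+ n != 0)%R by rewrite gt_eqF// exprn_gt0.
have tn : (2 ^+ n != 0 :> R)%R by rewrite gt_eqF.
rewrite exprVn; move: (r ^+ n)%R (2 ^+ n)%R (sampling_weight s p) rn tn => X Y Z Xn Yn.
by field; rewrite Xn Yn.
Qed.

(** Shows that the selected values vanish at coarse scales. Of the factor [3], two parts bound the
    deviation of [c] from the samples and one the samples themselves, each by the integral of
    [|f| ^ p]. *)
Lemma mean_value_low r x (c : R) : (0 < r)%R -> is_mean_value r x c ->
  (`|c| `^ p)%:E <= (3 * M * r^-1 ^+ n)%:E * \int[L]_y (`|f y| `^ p)%:E.
Proof.
move=> r0 [v1 _ [_ h1]].
have mQ := @measurable_cube R n 0%R r.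
have cQ := cube_measure (0%R : 'rV[R]_n) (ltW r0).
pose al : R := (r ^+ n)%R; have al0 : (0 < al)%R by rewrite exprn_gt0.
pose A v := (`|T v x| `^ p)%:E.
have A0 v : 0 <= A v by rewrite lee_fin powR_ge0.
have mA : measurable_fun setT A.
  have := meas_sampling_dist 0%R x; congr (measurable_fun _ _); apply/funext => w.
  by rewrite /A sub0r normrN.
pose S := \int[L]_(v in cube 0%R r) A v.
have S0 : 0 <= S by exact: integral_ge0.
pose N := \int[L]_y (`|f y| `^ p)%:E.
have N0 : 0 <= N by apply: integral_ge0 => y _; rewrite lee_fin powR_ge0.
have SN : S <= M%:E * N.
  apply: (@le_trans _ _ (\int[L]_(v in cube 0%R r)
     \sum_(e <- s) (`|e.1| `^ p)%:E * (`|f (x + e.2%:R *: v)| `^ p)%:E)).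
    apply: le_nnint => v _; first exact: A0.
    rewrite (_ : \sum_(e <- s) _ = (\sum_(e <- s) `|e.1| `^ p * `|f (x + e.2%:R *: v)| `^ p)%R%:E).
      by rewrite lee_fin sampling_powR.
    by rewrite -sumEFin; apply: eq_bigr => e _; rewrite EFinM.
  have mfe (e : R * nat) : measurable_fun setT (fun v : 'rV[R]_n => (`|f (x + e.2%:R *: v)| `^ p)%:E).
    apply/measurable_EFinP; apply: (measurableT_comp (measurable_powR p)).
    apply: measurableT_comp => //; apply: (measurableT_comp mf).
    by apply: measurable_rV_add => //; exact: measurable_rV_scale.
  have mfp : measurable_fun setT (fun y => (`|f y| `^ p)%:E).
    apply/measurable_EFinP; apply: (measurableT_comp (measurable_powR p)).
    exact: measurableT_comp.
  rewrite ge0_integral_sum//; last first.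
    by move=> e; apply: emeasurable_funM => //; exact: measurable_funS (mfe e).
  rewrite -sumEFin ge0_sume_distrl; last by move=> e _; rewrite lee_fin powR_ge0.
  rewrite big_seq [leRHS]big_seq; apply: lee_sum => e /sk/andP[e1 _].
  rewrite ge0_integralZl//; last exact: measurable_funS (mfe e).
  apply: lee_wpmul2l; first by rewrite lee_fin powR_ge0.
  apply: (@le_trans _ _ (\int[L]_v (`|f (x + e.2%:R *: v)| `^ p)%:E)).
    by apply: le_nnint_subset => // v _; rewrite lee_fin powR_ge0.
  have e0 : (0 < e.2%:R :> R)%R by rewrite ltr0n.
  rewrite (integral_rV_affine _ e0 mfp); last by move=> y; rewrite lee_fin powR_ge0.
  rewrite -[leRHS]mul1e; apply: lee_wpmul2r => //.
  have ei : (e.2%:R^-1 <= 1 :> R)%R by rewrite invf_le1// ler1n.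
  by rewrite lee_fin exprn_ile1// invr_ge0 ltW.
have I2S : \int[L]_(v in cube 0%R r) \int[L]_(w in cube 0%R r) (`|T v x - T w x| `^ p)%:E <=
    2%:E * al%:E * S.
  have mA1 : measurable_fun setT (fun z : 'rV[R]_n * 'rV[R]_n => A z.1).
    exact: (measurableT_comp mA).
  have mA2 : measurable_fun setT (fun z : 'rV[R]_n * 'rV[R]_n => A z.2).
    exact: (measurableT_comp mA).
  apply: (@le_trans _ _ (\int[L]_(v in cube 0%R r) \int[L]_(w in cube 0%R r) (A v + A w))).
    apply: le_nnint => v _; first by apply: integral_ge0 => w _; rewrite lee_fin powR_ge0.
    apply: le_nnint => w _; first by rewrite lee_fin powR_ge0.
    by rewrite -EFinD lee_fin -[in X in (_ <= _ + X `^ _)%R]normrN powR_normD.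
  have -> : \int[L]_(v in cube 0%R r) \int[L]_(w in cube 0%R r) (A v + A w) =
      al%:E * S + al%:E * S.
    apply: etrans (integral2D mQ mQ mA1 mA2 (fun z => A0 z.1) (fun z => A0 z.2)) _.
    congr (_ + _); first exact: (integral2_fst mQ mQ mA A0 (ltW al0) cQ).
    exact: (integral2_snd (cube 0%R r) A mQ cQ).
  clearbody S.
  by rewrite -muleA (_ : 2 = 1 + 1)%R// EFinD ge0_muleDl ?lee_fin// mul1e.
have cS : al%:E * (`|c| `^ p)%:E <= 3%:E * S.
  have -> : al%:E * (`|c| `^ p)%:E = \int[L]_(w in cube 0%R r) (cst (`|c| `^ p)%:E w).
    by rewrite (integral_cst L mQ (`|c| `^ p)%:E) muleC; congr (_ * _); exact/esym/cQ.
  apply: (@le_trans _ _ (\int[L]_(w in cube 0%R r) ((`|c - T w x| `^ p)%:E + A w))).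
    apply: le_nnint => w _; first by rewrite lee_fin powR_ge0.
    by rewrite -EFinD lee_fin; have := powR_normD (c - T w x)%R (T w x) p01; rewrite subrK.
  have mT : measurable_fun (cube 0%R r) (fun w : 'rV[R]_n => (`|c - T w x| `^ p)%:E).
    by apply: (@measurable_funS _ _ _ _ setT) => //; exact: meas_sampling_dist.
  have mA' : measurable_fun (cube 0%R r) A by exact: measurable_funS mA.
  rewrite (ge0_integralD L mQ _ mT _ mA'); last 2 first.
  - by move=> w _; rewrite lee_fin powR_ge0.
  - by move=> w _; exact: A0.
  rewrite -/S; clearbody S.
  rewrite (_ : 3 = 2 + 1)%R; last by rewrite natr1.
  rewrite EFinD ge0_muleDl ?lee_fin// mul1e; apply: leeD; last exact: lexx.
  rewrite -(lee_pmul2l _ (_ : 0 < al%:E)) ?lte_fin//.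
  by rewrite muleCA muleA; exact: le_trans h1 I2S.
clearbody S; rewrite -/N; clearbody N; rewrite -(lee_pmul2l _ (_ : 0 < al%:E)) ?lte_fin//.
apply: (le_trans cS); rewrite muleA -EFinM.
have -> : (al * (3 * M * r^-1 ^+ n) = 3 * M)%R.
  by rewrite /al exprVn; field; rewrite gt_eqF.
by rewrite EFinM -muleA; apply: lee_wpmul2l.
Qed.

Lemma mean_value_high x (eps : R) : (0 < eps)%R -> exists2 d : R, (0 < d)%R &
  forall r c, (0 < r <= d)%R -> is_mean_value r x c -> (`|f x - c| <= eps)%R.
Proof.
move=> eps0; have [d d0 hd] := fdiff_small sE x cf k0 eps0.
exists d => // r c /andP[r0 rd] [v vQ [-> _]]; apply: hd.
apply: lt_le_trans rd; have := cube_sub_nball r0 vQ.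
by rewrite /nball/= subr0.
Qed.

End mean_values.

Section compact_support.
Context {R : realType} {n : nat}.

Lemma Cc_smooth_bounded (f : 'rV[R]_n -> R) : Cc_smooth f ->
  exists B r : R, [/\ 0 < B, 0 < r, forall x, `|f x| <= B &
    forall x, r <= `|x| -> f x = 0].
Proof.
move=> fcc; have cf := Cc_smooth_continuous fcc; have [_ cK] := fcc.
set K := closure _ in cK.
have /compact_bounded[M [_ hM]] : compact (f @` K).
  by apply: continuous_compact => //; exact: continuous_subspaceT.
have /compact_bounded[r [_ hr]] := cK.
have out x : ~ K x -> f x = 0.
  move=> nK; apply/eqP; apply: contrapT => /negP fx; apply: nK.
  exact: subset_closure.
exists (`|M| + 1), (`|r| + 2); split; [by rewrite ltr_wpDl|by rewrite ltr_wpDl| |].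
  move=> x; have [Kx|/out ->] := pselect (K x); last by rewrite normr0 addr_ge0.
  apply: (hM (`|M| + 1)); last by exists x.
  by rewrite (le_lt_trans (ler_norm M))// ltrDl.
move=> x rx; apply: out => Kx; have := hr (`|r| + 1) _ x Kx.
rewrite (le_lt_trans (ler_norm r)) ?ltrDl// => /(_ isT) /=; lra.
Qed.

Lemma Cc_smooth_powR_integral (f : 'rV[R]_n -> R) (p : R) : 0 < p -> Cc_smooth f ->
  (\int[lebesgue_rV n]_x (`|f x| `^ p)%:E < +oo)%E.
Proof.
move=> p0 fcc; have [B [r [B0 r0 fB fr]]] := Cc_smooth_bounded fcc.
have mb := @measurable_nball R n 0 r.
apply: (@le_lt_trans _ _ (\int[lebesgue_rV n]_(x in nball 0 r) (cst (B `^ p)%:E x))%E).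
  rewrite [leRHS]integral_mkcond; apply: le_nnint => x _; first by rewrite lee_fin powR_ge0.
  rewrite /patch; case: ifPn => [_|].
    by rewrite lee_fin; apply: ge0_ler_powR; rewrite ?nnegrE ?(ltW p0) ?(ltW B0).
  rewrite notin_setE /nball/= subr0 => /negP; rewrite -leNgt => /fr ->.
  by rewrite normr0 powR0 ?gt_eqF.
rewrite (integral_cst (lebesgue_rV n) mb).
apply: (@le_lt_trans _ _ ((B `^ p)%:E * ((2 * r) ^+ n)%:E)%E); last by rewrite -EFinM ltry.
by apply: lee_wpmul2l; [rewrite lee_fin powR_ge0|exact: (lebesgue_rV_ball_le _ (ltW r0))].
Qed.

End compact_support.

Section scales.
Context {R : realType}.
Local Notation scale := (@scale R).

Lemma scale_nat (J : nat) : scale J = (2 ^+ J)^-1 /\ scale (- J%:Z) = 2 ^+ J.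
Proof.
by rewrite /scale intrN opprK -!pmulrn powR_invn// powR_mulrn.
Qed.

Lemma scale_extreme (d X : R) : 0 < d -> exists J : nat, scale J <= d /\ X <= scale (- J%:Z).
Proof.
move=> d0; pose J := Num.truncn (Num.max d^-1 X); exists J.
have [-> ->] := scale_nat J.
have h : Num.max d^-1 X <= 2 ^+ J.
  rewrite (le_trans (ltW (truncnS_gt _)))// -natrX ler_nat.
  exact: ltn_expl.
have [h1 h2] : d^-1 <= 2 ^+ J /\ X <= 2 ^+ J by move: h; rewrite ge_max => /andP.
by split => //; rewrite -[leRHS]invrK lef_pV2 ?posrE ?invr_gt0 ?exprn_gt0.
Qed.

Lemma telescope_int (c : int -> R) (J : nat) :
  (`|c (- J%:Z) - c J|%:E <= \esum_(j in [set: int]) (`|c j - c (j + 1)|)%:E)%E.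
Proof.
pose t := [seq (i%:Z - J%:Z)%R | i <- iota 0 (J + J)].
have ut : uniq t.
  by rewrite map_inj_uniq ?iota_uniq// => i i' /addIr[].
apply: (@le_trans _ _ (\sum_(j <- t) (`|c j - c (j + 1)|)%:E)%E); last first.
  by apply: esum_seq => // j; rewrite lee_fin.
rewrite sumEFin lee_fin /t big_map.
have step N : `|c (- J%:Z) - c (N%:Z - J%:Z)| <=
    \sum_(i <- iota 0 N) `|c (i%:Z - J%:Z) - c (i%:Z - J%:Z + 1)|.
  elim: N => [|N ih]; first by rewrite big_nil sub0r subrr normr0.
  rewrite -[N.+1]addn1 iotaD big_cat/= big_seq1 add0n.
  have -> : (N + 1)%N%:Z - J%:Z = N%:Z - J%:Z + 1 by rewrite PoszD addrAC.
  apply: le_trans (lerD ih (lexx _)).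
  by rewrite (le_trans _ (ler_normD _ _))// addrA subrK.
by have := step (J + J)%N; rewrite PoszD addrK.
Qed.

End scales.

(** * Coefficients attached to dyadic cubes *)

Section pieces.
Context {R : realType} {n : nat} (k : nat) (s : seq (R * nat)).
Hypothesis n0 : (0 < n)%N.
Hypothesis k0 : (0 < k)%N.
Hypothesis sk : forall e, e \in s -> (1 <= e.2 <= k)%N.
Hypothesis sE : forall (g : 'rV[R]_n -> R) (v x : 'rV[R]_n),
  iter k (fdiff v) g x = (-1) ^+ k * (g x - \sum_(e <- s) e.1 * g (x + e.2%:R *: v)).
Context (p : R) (p01 : 0 < p <= 1) (f : 'rV[R]_n -> R) (cf : continuous f).
Local Open Scope ereal_scope.
Local Notation L := (@lebesgue_rV R n).
Local Notation M := (sampling_weight s p).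
Local Notation H := (local_mean_diff k p f).
Local Notation W := (local_diff k p f).

Let mf : measurable_fun setT f. Proof. exact: continuous_rV_measurable. Qed.

Let W0 r x : 0 <= W r x.
Proof. by apply: integral_ge0 => h _; rewrite lee_fin powR_ge0. Qed.

Let H0 r x : 0 <= H r x.
Proof. by apply: integral_ge0 => y _; exact: W0. Qed.

Let mW r : measurable_fun setT (W r).
Proof.
have msw : measurable_fun setT (fun z : 'rV[R]_n * 'rV[R]_n =>
    (`|iter k (fdiff z.2) f z.1| `^ p)%:E).
  have mswap : measurable_fun setT (fun z : 'rV[R]_n * 'rV[R]_n => (z.2, z.1)).
    exact: measurable_fun_pair.
  exact: (measurableT_comp (measurable_fdiff_powR k p mf) mswap).
apply: (measurable_integral_set L (measurable_nball 0%R r) msw) => z.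
by rewrite lee_fin powR_ge0.
Qed.

(** Turns the domain of integration, which moves with the centre, into a jointly measurable factor,
    so that Tonelli applies. *)
Let near_ind (rho : R) (z : 'rV[R]_n * 'rV[R]_n) : R := \1_(nball 0%R rho) (z.2 - z.1)%R.

Let near_indE rho x y : near_ind rho (x, y) = \1_(nball x rho) y :> R.
Proof.
rewrite /near_ind !indicE/=; have [h|h] := pselect (nball x rho y).
  by rewrite !mem_set//; rewrite /nball/= subr0.
by rewrite !memNset//; rewrite /nball/= subr0.
Qed.

Let near_indW r rho z : 0 <= (near_ind rho z)%:E * W r z.2.
Proof. by apply: mule_ge0; [rewrite lee_fin /near_ind indicE|exact: W0]. Qed.

Let measurable_near_indW r rho :
  measurable_fun setT (fun z : 'rV[R]_n * 'rV[R]_n => (near_ind rho z)%:E * W r z.2).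
Proof.
apply: emeasurable_funM; last exact: (measurableT_comp (mW r)).
apply/measurable_EFinP.
apply: (measurableT_comp (measurable_indic (measurable_nball 0%R rho))).
by apply: measurable_rV_sub.
Qed.

Let local_mean_diffE r x :
  H r x = \int[L]_y ((near_ind (k.+1%:R * r) (x, y))%:E * W r y).
Proof.
rewrite /local_mean_diff integral_mkcond; apply: eq_integral => y _.
by rewrite near_indE indicE /patch; case: ifP => _; rewrite ?mul1e ?mul0e.
Qed.

Lemma measurable_local_mean_diff r : measurable_fun setT (H r).
Proof.
rewrite (_ : H r = fun x => \int[L]_y ((near_ind (k.+1%:R * r) (x, y))%:E * W r y)).
  exact: (@measurable_fun_fubini_tonelli_F _ _ _ _ _ L _
    (measurable_near_indW r (k.+1%:R * r)) (near_indW r (k.+1%:R * r))).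
by apply/funext => x; exact: local_mean_diffE.
Qed.

(** By Tonelli each [y] is counted for those [x] in a ball around it, whose volume is the constant
    on the right. *)
Lemma integral_local_mean_diff r : (0 < r)%R ->
  \int[L]_x H r x <= ((2 * (k.+1%:R * r)) ^+ n)%:E *
     \int[L]_(h in nball 0%R r) besov_energy k p f h.
Proof.
move=> r0; set rho := (k.+1%:R * r)%R; have rho0 : (0 < rho)%R by rewrite mulr_gt0.
under eq_integral do rewrite local_mean_diffE.
rewrite (@fubini_tonelli _ _ _ _ _ L L _ (measurable_near_indW r rho) (near_indW r rho)) /=.
have -> : \int[L]_(h in nball 0%R r) besov_energy k p f h = \int[L]_y W r y.
  rewrite /besov_energy (@tonelli_set _ _ _ _ _ L L _ _
    (fun z : 'rV[R]_n * 'rV[R]_n => (`|iter k (fdiff z.1) f z.2| `^ p)%:E)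
    (measurable_nball 0%R r) measurableT (measurable_fdiff_powR k p mf))//.
rewrite -(ge0_integralZl L measurableT (mW r) (fun y _ => W0 r y)); last first.
  by rewrite lee_fin exprn_ge0// mulr_ge0// ltW.
apply: le_nnint => y _; first by apply: integral_ge0 => x _; exact: near_indW (x, y).
have E x : near_ind rho (x, y) = \1_(nball y rho) x :> R.
  rewrite near_indE !indicE; have [h|h] := pselect (nball x rho y).
    by rewrite !mem_set//; move: h; rewrite /nball/= distrC.
  by rewrite !memNset//; move: h; rewrite /nball/= distrC.
under eq_integral => x _ do rewrite E.
have mi : measurable_fun setT (fun x : 'rV[R]_n => (\1_(nball y rho) x)%:E : \bar R).
  by apply/measurable_EFinP; apply: measurable_indic; exact: measurable_nball.
rewrite (ge0_integralZr L measurableT mi) //; apply: lee_wpmul2r; first exact: W0.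
rewrite integral_indic//; last exact: measurable_nball.
by rewrite setIT; exact: (lebesgue_rV_ball_le _ (ltW rho0)).
Qed.

(** The factor of [mean_value_step] at side [r = scale j], times [r ^ (- n)] for averaging over a
    cube of volume [r ^ n]. *)
Definition piece_coef (j : int) : R :=
  (@step_const R n s p * (scale j)^-1 ^+ (2 * n) * (scale j)^-1 ^+ n)%R.

Definition piece (q : int * 'rV[int]_n) : \bar R :=
  (piece_coef q.1)%:E * \int[L]_(x in dyadic_cube q) H (scale q.1) x.

Lemma piece_coef_ge0 j : (0 <= piece_coef j)%R.
Proof.
have i0 : (0 <= (@scale R j)^-1)%R by rewrite invr_ge0 ltW// scale_gt0.
apply: mulr_ge0; [apply: mulr_ge0; [exact: step_const_ge0|]|]; exact: exprn_ge0.
Qed.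

Lemma piece_ge0 q : 0 <= piece q.
Proof.
by apply: mule_ge0; [rewrite lee_fin piece_coef_ge0|apply: integral_ge0 => x _; exact: H0].
Qed.

(** The left-hand side of [mean_value_step] does not involve [x'], so its bound may be averaged over
    [x'] in the cube; the result is the same for all [x] in it. *)
Lemma piece_ub q x (c1 c2 : R) : dyadic_cube q x ->
  is_mean_value s p f (scale q.1) x c1 -> is_mean_value s p f (scale (q.1 + 1)) x c2 ->
  (`|c1 - c2| `^ p)%:E <= piece q.
Proof.
move=> xq h1; rewrite scaleS => h2.
set r := scale q.1 in h1 h2; have r0 : (0 < r)%R by exact: scale_gt0.
have mq : measurable (dyadic_cube q : set 'rV[R]_n) by exact: measurable_cube.
have cq : L (dyadic_cube q) = (r ^+ n)%:E by exact: (cube_measure _ (ltW r0)).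
pose K := (@step_const R n s p * r^-1 ^+ (2 * n))%R.
have K0 : (0 <= K)%R by rewrite mulr_ge0 ?step_const_ge0// exprn_ge0// invr_ge0 ltW.
have le1 : (r ^+ n)%:E * (`|c1 - c2| `^ p)%:E <= K%:E * \int[L]_(x in dyadic_cube q) H r x.
  have -> : (r ^+ n)%:E * (`|c1 - c2| `^ p)%:E =
      \int[L]_(x in dyadic_cube q) (cst (`|c1 - c2| `^ p)%:E x).
    by rewrite (integral_cst L mq) muleC; congr (_ * _); exact/esym/cq.
  rewrite -(ge0_integralZl L mq); last 3 first.
  - by apply: (@measurable_funS _ _ _ _ setT) => //; exact: measurable_local_mean_diff.
  - by move=> y _; exact: H0.
  - by rewrite lee_fin.
  apply: le_nnint => y yq; first by rewrite lee_fin powR_ge0.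
  by apply: (mean_value_step sk sE p01 cf r0 _ h1 h2); exact: (cube_dist r0 xq yq).
have rn0 : (0 < r ^+ n)%R by rewrite exprn_gt0.
rewrite /piece /piece_coef -/r -/K mulrC EFinM -muleA exprVn lee_pdivlMl//.
Qed.

(** The cubes of one generation tile the space, so the sum is a single integral of [H]; integrating
    [H] returns a volume [r ^ n] that cancels one of the three negative powers in [piece_coef]. *)
Lemma esum_piece_le j : \esum_(m in setT) piece (j, m) <=
  (@step_const R n s p * (2 * k.+1%:R) ^+ n * (scale j)^-1 ^+ (2 * n))%:E *
  \int[L]_(h in nball 0%R (scale j)) besov_energy k p f h.
Proof.
set r := scale j; have r0 : (0 < r)%R by exact: scale_gt0.
set V := \int[L]_(h in _) _.
have V0 : 0 <= V by apply: integral_ge0 => h _; exact: besov_energy_ge0.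
have -> : \esum_(m in setT) piece (j, m) = (piece_coef j)%:E * \int[L]_x H r x.
  rewrite (@integral_partition _ _ _ L _ (fun m => dyadic_cube (j, m)) setT (H r)).
  - rewrite -esumZl//; first exact: piece_coef_ge0.
    by move=> m; apply: integral_ge0 => x _; exact: H0.
  - by move=> m; exact: measurable_cube.
  - by move=> m m' x; exact: dyadic_cube_uniq.
  - by move=> x; split => // _; exact: dyadic_cube_ex.
  - exact: measurable_local_mean_diff.
  - by move=> x; exact: H0.
have i0 := integral_local_mean_diff r0; rewrite -/V in i0; clearbody V.
apply: (le_trans (lee_wpmul2l _ i0)); first by rewrite lee_fin piece_coef_ge0.
rewrite muleA -EFinM; apply: lee_wpmul2r => //; rewrite lee_fin.
rewrite /piece_coef -/r; move: (@step_const R n s p) => sc.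
rewrite exprMn [in leRHS]exprMn !exprMn le_eqVlt; apply/orP; left; apply/eqP.
have rn : (r ^+ n != 0)%R by rewrite gt_eqF// exprn_gt0.
have rrn : (r^-1 ^+ n * r ^+ n = 1)%R by rewrite exprVn mulVf.
rewrite -!mulrA; congr (_ * _)%R; rewrite [RHS]mulrA [RHS]mulrC; congr (_ * _)%R.
by rewrite mulrC -!mulrA [(r ^+ n * _)%R]mulrC rrn mulr1.
Qed.

(** Telescoping between the scales [2 ^ J] and [2 ^ (- J)], whose ends are handled by
    [mean_value_low] and [mean_value_high]. The cut-off [J] depends on [x] and on the tolerance [e];
    the bounding sum over all scales does not. *)
Lemma decomposition_pointwise (c : R -> 'rV[R]_n -> R) x :
  (forall r x, (0 < r)%R -> is_mean_value s p f r x (c r x)) ->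
  \int[L]_y (`|f y| `^ p)%:E < +oo ->
  (`|f x|)%:E <= \esum_(j in [set: int]) (`|c (scale j) x - c (scale (j + 1)) x|)%:E.
Proof.
move=> hc fin; have [p0 p1] := andP p01; apply/lee_addgt0Pr => e e0.
have e2 : (0 < e / 2)%R by rewrite divr_gt0.
have [d d0 hd] := mean_value_high k0 sE p cf x e2.
have N0 : 0 <= \int[L]_y (`|f y| `^ p)%:E by apply: integral_ge0 => y _; rewrite lee_fin powR_ge0.
have Nfin : \int[L]_y (`|f y| `^ p)%:E \is a fin_num by rewrite ge0_fin_numE.
pose N : R := fine (\int[L]_y (`|f y| `^ p)%:E).
have NE : \int[L]_y (`|f y| `^ p)%:E = N%:E by rewrite fineK.
have N0' : (0 <= N)%R by rewrite fine_ge0.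
have M0 : (0 <= M)%R by apply: sumr_ge0 => i _; exact: powR_ge0.
have ep : (0 < (e / 2) `^ p)%R by rewrite powR_gt0.
(* A side [r >= 1] satisfies [r <= r ^ n]; exceeding the second term of the maximum then makes the
   bound of [mean_value_low] at most [(e / 2) ^ p]. *)
pose X : R := Num.max 1%R (3 * M * N / (e / 2) `^ p)%R.
have [J [hJ1 hJ2]] := scale_extreme X d0.
have high : (`|f x - c (scale J) x| <= e / 2)%R.
  by apply: (hd (scale J)); [rewrite scale_gt0|apply: hc; exact: scale_gt0].
have low : (`|c (scale (- J%:Z)) x| <= e / 2)%R.
  have r0 := @scale_gt0 R (- J%:Z); set r := scale (- J%:Z) in r0 hJ2 *.
  have := mean_value_low sk p01 cf r0 (hc r x r0); rewrite NE -EFinM lee_fin => h.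
  have [r1 rX] : (1 <= r)%R /\ (3 * M * N / (e / 2) `^ p <= r)%R.
    by move: hJ2; rewrite /X ge_max => /andP.
  have h2 : (`|c r x| `^ p <= (e / 2) `^ p)%R.
    apply: (le_trans h).
    have rr : (r <= r ^+ n)%R by exact: ler_eXnr.
    have -> : (3 * M * r^-1 ^+ n * N = 3 * M * N / r ^+ n)%R by rewrite exprVn mulrAC.
    rewrite ler_pdivrMr ?exprn_gt0//; move: rX; rewrite ler_pdivrMr// => /le_trans; apply.
    by rewrite mulrC; apply: ler_wpM2l => //; exact: powR_ge0.
  rewrite leNgt; apply/negP => lt; move: h2; rewrite leNgt => /negP; apply.
  by apply: gt0_ltr_powR; rewrite ?nnegrE// ltW.
have tele := telescope_int (fun j => c (scale j) x) J.
rewrite /= in tele.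
apply: (@le_trans _ _ (`|c (scale (- J%:Z)) x - c (scale J) x| + e)%R%:E); last first.
  by rewrite EFinD; apply: leeD2r.
rewrite lee_fin.
have -> : f x = ((f x - c (scale J) x) - (c (scale (- J%:Z)) x - c (scale J) x) +
   c (scale (- J%:Z)) x)%R by ring.
apply: (le_trans (ler_normD _ _)).
have := ler_normB (f x - c (scale J) x)%R (c (scale (- J%:Z)) x - c (scale J) x)%R.
lra.
Qed.

End pieces.

Section decomposition.
Context {R : realType} {n : nat}.
Local Open Scope ereal_scope.
Local Notation L := (@lebesgue_rV R n).

(** Only scales larger than [|h|] contribute, and their geometric sum is dominated by the smallest
    of them: this rebuilds the continuous Besov weight. The factor [n ^ g] passes from the max norm
    to the Euclidean one. *)
Lemma fdiff_sum_scale (g : R) (h : 'rV[R]_n) : (0 < n)%N -> (0 < g)%R -> h != 0%R ->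
  \esum_(j in [set: int]) ((scale j)^-1 `^ g * \1_(nball 0%R (scale j)) h)%:E <=
  ((1 - 2 `^ (- g))^-1 * n%:R `^ g * enorm h `^ (- g))%:E.
Proof.
move=> n0 g0 h0; have nh : (0 < `|h|)%R by rewrite normr_gt0.
have M0 : (0 < `|h|^-1)%R by rewrite invr_gt0.
have z1 : (0 <= (1 - (2 : R) `^ (- g))^-1)%R by rewrite invr_ge0 subr_ge0 ltW// powR2_lt1.
apply: (@le_trans _ _ (\esum_(j in [set: int]) (if (2 `^ j%:~R < `|h|^-1)%R then (2 `^ (j%:~R * g))%:E else 0))).
  apply: le_esum => j _; rewrite indicE.
  have sj : ((scale j)^-1 = 2 `^ j%:~R :> R)%R by rewrite /scale powRN invrK.
  rewrite sj -powRrM; case: ifPn => hj.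
    rewrite lee_fin; apply: ler_piMr; first exact: powR_ge0.
    by case: (_ \in _).
  rewrite memNset ?mulr0//= /nball/= subr0 => hs; move/negP: hj; apply.
  by rewrite -sj ltf_pV2 ?posrE ?scale_gt0.
apply: (le_trans (geometric_tail_le g0 M0)); rewrite lee_fin -mulrA; apply: ler_wpM2l => //.
have e0 : (0 < enorm h)%R by rewrite (lt_le_trans nh)// norm_le_enorm.
have n0' : (0 < n%:R :> R)%R by rewrite ltr0n.
have e0' := ltW e0; have n0'' := ltW n0'.
rewrite -mulN1r powRrM powR_inv1// -powRM ?invr_ge0//.
apply: ge0_ler_powR; rewrite ?nnegrE ?invr_ge0 ?mulr_ge0 ?invr_ge0 ?(ltW g0)//.
by rewrite ler_pdivlMr// mulrC ler_pdivrMr// enorm_le_norm.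
Qed.

(** Here [B q] is the p-th power of the coefficient of the cube [q]. It is an extended real, since
    it is bounded through the Besov norm, which is not assumed finite. *)
Lemma besov_decomposition (beta p : R) : (0 < n)%N -> (0 < beta)%R -> (0 < p <= 1)%R ->
  exists2 K : R, (0 <= K)%R & forall f : 'rV[R]_n -> R, Cc_smooth f ->
  exists B : int * 'rV[int]_n -> \bar R, [/\ forall q, 0 <= B q,
    forall x, (`|f x|)%:E <= \esum_(q in [set: int * 'rV[int]_n])
       (B q `^ p^-1 * (\1_(dyadic_cube q) x)%:E) &
    \esum_(q in [set: int * 'rV[int]_n]) ((scale q.1 `^ (n%:R - p * beta))%:E * B q) <=
      K%:E * besov_norm beta p p f `^ p].
Proof.
move=> n0 b0 p01; have [p0 p1] := andP p01.
pose k := (Num.truncn beta).+1.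
have [s [sk sE']] := @fdiff_expansion R k.
have sE := sE' n; have k0 : (0 < k)%N by [].
pose g : R := (n%:R + beta * p)%R.
have g0 : (0 < g)%R by rewrite ltr_wpDl// mulr_gt0.
pose C : R := (@step_const R n s p * (2 * k.+1%:R) ^+ n)%R.
have C0 : (0 <= C)%R by rewrite mulr_ge0 ?step_const_ge0// exprn_ge0.
pose G : R := ((1 - 2 `^ (- g))^-1 * n%:R `^ g)%R.
have G0 : (0 <= G)%R by rewrite mulr_ge0 ?powR_ge0// invr_ge0 subr_ge0 ltW// powR2_lt1.
exists (C * G)%R => [|f fcc]; first exact: mulr_ge0.
have cf := Cc_smooth_continuous fcc; have mf := Cc_smooth_measurable fcc.
have B0 q : 0 <= piece k s p f q by exact: piece_ge0.
exists (piece k s p f); split => // [x|].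
  have [c hc] := mean_values_exist s p cf.
  have fin := Cc_smooth_powR_integral p0 fcc.
  have dp := @decomposition_pointwise _ _ k s n0 k0 sk sE p p01 f cf c.
  apply: (le_trans (dp x hc fin)); clear dp.
  rewrite (_ : [set: int * 'rV[int]_n] = [set: int] `*`` (fun=> [set: 'rV[int]_n])); last by apply/seteqP; split.
  rewrite -(@esum_esum _ _ _ _ _ (fun j m => piece k s p f (j, m) `^ p^-1 * (\1_(dyadic_cube (j, m)) x)%:E)); last first.
    by move=> j m; rewrite mule_ge0 ?poweR_ge0// lee_fin indicE.
  apply: le_esum => j _; have [m hm] := dyadic_cube_ex j x.
  have := @esum_ub R 'rV[int]_n (fun m => piece k s p f (j, m) `^ p^-1 * (\1_(dyadic_cube (j, m)) x)%:E) m.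
  move=> /(_ ltac:(move=> ?; rewrite mule_ge0 ?poweR_ge0// lee_fin indicE//)); apply: le_trans.
  rewrite indicE mem_set//= mule1.
  have := piece_ub sk sE p01 cf hm (hc _ x (scale_gt0 _)) (hc _ x (scale_gt0 _)).
  have pv : (0 <= p^-1)%R by rewrite invr_ge0 ltW.
  have d0 : 0 <= (`|c (scale j) x - c (scale (j + 1)) x| `^ p)%:E by rewrite lee_fin powR_ge0.
  move=> /(le_poweR pv d0); rewrite poweR_EFin -powRrM divff ?gt_eqF// powRr1//.
rewrite (_ : [set: int * 'rV[int]_n] = [set: int] `*`` (fun=> [set: 'rV[int]_n])); last by apply/seteqP; split.
rewrite -(@esum_esum _ _ _ _ _ (fun j m => (scale j `^ (n%:R - p * beta))%:E * piece k s p f (j, m))); last first.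
  by move=> j m _ _; rewrite mule_ge0// lee_fin powR_ge0.
pose E := @besov_energy R n k p f.
have E0 h : 0 <= E h by exact: besov_energy_ge0.
have mE : measurable_fun setT E by exact: measurable_besov_energy.
pose a (j : int) (h : 'rV[R]_n) : R := ((@scale R j)^-1 `^ g * \1_(nball 0%R (@scale R j)) h)%R.
have a0 j h : (0 <= a j h)%R by rewrite mulr_ge0 ?powR_ge0// indicE.
have ma j : measurable_fun setT (fun h : 'rV[R]_n => (a j h)%:E).
  apply/measurable_EFinP; apply: measurable_funM => //.
  by apply: measurable_indic; exact: measurable_nball.
apply: (@le_trans _ _ (\esum_(j in [set: int]) (C%:E * \int[L]_h ((a j h)%:E * E h)))).
  apply: le_esum => j _; rewrite esumZl ?powR_ge0//.
  have r0 := @scale_gt0 R j.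
  have bnd := esum_piece_le k s p cf j.
  apply: (le_trans (lee_wpmul2l _ bnd)); first by rewrite lee_fin powR_ge0.
  rewrite muleA -EFinM -/C.
  (* The exponents combine as [n - p beta - 2 n = - (n + beta p)], the homogeneity of the Besov
     weight. *)
  have -> : (scale j `^ (n%:R - p * beta) * (C * (scale j)^-1 ^+ (2 * n)) = C * (scale j)^-1 `^ g)%R.
    rewrite mulrCA; congr (_ * _)%R.
    rewrite -powR_mulrn ?invr_ge0 ?ltW// -!powR_inv1 ?ltW// -!powRrM -powRD; last first.
      by rewrite pnatr_eq0 implybT.
    by congr powR; rewrite /g natrM; ring.
  rewrite EFinM -muleA; apply: lee_wpmul2l; first by rewrite lee_fin.
  have mb := @measurable_nball R n 0%R (scale j).
  rewrite -(ge0_integralZl L mb) //; last 2 first.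
  - exact: measurable_funS mE.
  - by rewrite lee_fin powR_ge0.
  rewrite integral_mkcond; apply: le_nnint => h _.
    by rewrite /patch; case: ifP => // _; rewrite mule_ge0// lee_fin powR_ge0.
  rewrite /patch /a indicE; case: ifP => _; first by rewrite mulr1.
  by rewrite mulr0 mul0e.
rewrite esumZl//; last by move=> j; apply: integral_ge0 => h _; rewrite mule_ge0// lee_fin.
rewrite besov_normE ?gt_eqF// -/k -/g (EFinM C G) -muleA; apply: lee_wpmul2l; first by rewrite lee_fin.
rewrite -(integral_esum L measurableT); last 2 first.
- by move=> j; exact: emeasurable_funM (ma j) mE.
- by move=> j h; rewrite mule_ge0// lee_fin.
rewrite -ge0_integralZl//; last 2 first.
- apply: emeasurable_funM => //; apply/measurable_EFinP.
  exact: (measurableT_comp (measurable_powR (- g)%R) (@measurable_enorm R n)).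
- by move=> h _; rewrite mule_ge0// lee_fin powR_ge0.
apply: le_nnint => h _.
  by apply: esum_ge0 => j _; rewrite mule_ge0// lee_fin.
rewrite -/E.
(* At [h = 0] every scale contributes and the sum of the weights diverges, but the energy vanishes
   there, so both sides are [0]. *)
have [->|h0] := eqVneq h 0%R.
  have -> : E 0%R = 0.
    rewrite /E /besov_energy integral0_eq// => x _.
    suff -> : iter k (fdiff 0) f x = 0%R by rewrite normr0 powR0// gt_eqF.
    by rewrite /k iterS {1}/fdiff addr0 subrr.
  by rewrite mul0e mule0 esum1// => j _; rewrite mule0.
rewrite [X in _ <= _ * X]muleC muleA -EFinM.
apply: esum_le => t ut; rewrite -ge0_sume_distrl//; last by move=> j _; rewrite lee_fin.
apply: lee_wpmul2r => //.
apply: le_trans (fdiff_sum_scale n0 g0 h0).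
by apply: (@esum_seq R int (fun j => (a j h)%:E)) => // j; rewrite lee_fin.
Qed.

End decomposition.

(** * Carleson embedding for the extension *)

Section poisson_bounds.
Context {R : realType} {n : nat} (s : R).
Hypothesis s0 : 0 < s.
Local Notation L := (@lebesgue_rV R n).
Local Notation D := (`|@poisson_const R n s|).

(** The max norm is below the Euclidean one, so the base of the denominator is at least [d ^ 2]. The
    constant enters through its absolute value; its sign is settled later, where the kernel is
    bounded from below. *)
Lemma poisson_le (t d : R) (x : 'rV[R]_n) : 0 < t -> 0 < d -> d <= Num.max `|x| t ->
  `|poisson_kernel s t x| <= D * t `^ s * d `^ (- (n%:R + s)).
Proof.
move=> t0 d0 dm; rewrite /poisson_kernel; move: (poisson_const s) => pc.
rewrite !normrM normfV.
rewrite !(ger0_norm (powR_ge0 _ _)); apply: ler_wpM2l.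
  by rewrite mulr_ge0 ?powR_ge0.
have m0 : 0 < enorm x ^+ 2 + t ^+ 2 by rewrite ltr_wpDl ?exprn_gt0// sqr_ge0.
rewrite powRN lef_pV2 ?posrE ?powR_gt0//.
have -> : d `^ (n%:R + s) = (d ^+ 2) `^ ((n%:R + s) / 2).
  by rewrite -powR_mulrn ?ltW// -powRrM; congr powR; field.
apply: ge0_ler_powR; rewrite ?nnegrE ?sqr_ge0 ?(ltW m0)//.
  by rewrite divr_ge0// addr_ge0// ltW.
have [h|h] := leP `|x| t.
  have dt : d <= t by rewrite (le_trans dm)// ge_max h lexx.
  apply: ler_wpDl; first exact: sqr_ge0.
  by apply: lerXn2r; rewrite ?nnegrE ?(ltW d0) ?(ltW t0).
have dx : d <= enorm x.
  by rewrite (le_trans dm)// ge_max (ltW (lt_le_trans h (norm_le_enorm x))) norm_le_enorm.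
apply: ler_wpDr; first exact: sqr_ge0.
by apply: lerXn2r; rewrite ?nnegrE ?(ltW d0) ?enorm_ge0.
Qed.

Lemma poisson_le_inv (t d : R) (x : 'rV[R]_n) : 0 < t -> 0 < d -> d <= Num.max `|x| t ->
  `|poisson_kernel s t x| <= D * d^-1 ^+ n.
Proof.
move=> t0 d0 dm; set m := Num.max `|x| t in dm *.
have m0 : 0 < m by exact: lt_le_trans dm.
have tm : t <= m by rewrite le_max lexx orbT.
apply: (le_trans (poisson_le t0 m0 (lexx m))); rewrite -mulrA; apply: ler_wpM2l => //.
rewrite opprD powRD ?(gt_eqF m0) ?implybT// mulrCA.
apply: (@le_trans _ _ (m `^ (- n%:R) * 1)).
  apply: ler_wpM2l; first exact: powR_ge0.
  rewrite powRN ler_pdivrMr ?powR_gt0// mul1r.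
  by apply: ge0_ler_powR; rewrite ?nnegrE ?(ltW s0) ?(ltW t0) ?(ltW m0).
have m0' := ltW m0.
rewrite mulr1 powRN powR_mulrn// exprVn lef_pV2 ?posrE ?exprn_gt0//.
by apply: lerXn2r; rewrite ?nnegrE ?(ltW d0).
Qed.

Lemma poisson_le_geometric (t : R) (x : 'rV[R]_n) (k : nat) : 0 < t ->
  2 ^+ k * t <= Num.max `|x| t ->
  `|poisson_kernel s t x| <= D * t^-1 ^+ n * (2 `^ (- (n%:R + s))) ^+ k.
Proof.
move=> t0 km; have d0 : 0 < 2 ^+ k * t by rewrite mulr_gt0 ?exprn_gt0.
apply: (le_trans (poisson_le t0 d0 km)); rewrite -!mulrA; apply: ler_wpM2l => //.
have t0' := ltW t0.
have k2 : (0 <= 2 ^+ k :> R) by rewrite exprn_ge0.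
have -> : (2 ^+ k * t) `^ (- (n%:R + s)) = (2 `^ (- (n%:R + s))) ^+ k * t `^ (- (n%:R + s)).
  rewrite powRM//; congr (_ * _).
  rewrite -(powR_mulrn k (powR_ge0 2 (- (n%:R + s)))) -(powR_mulrn k (ler0n R 2)) -!powRrM.
  by congr powR; exact: mulrC.
have tE : t `^ s * t `^ (- (n%:R + s)) = t^-1 ^+ n.
  rewrite -powRD ?(gt_eqF t0) ?implybT//.
  by rewrite (_ : s - (n%:R + s) = - n%:R) ?powRN ?powR_mulrn ?exprVn//; ring.
by rewrite mulrCA tE mulrC.
Qed.

Lemma dyadic_shell (t X : R) : 0 < t -> t <= X ->
  exists k : nat, 2 ^+ k * t <= X < 2 ^+ k.+1 * t.
Proof.
move=> t0 tX; have ex : exists N : nat, X < 2 ^+ N.+1 * t.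
  exists (Num.truncn (X / t)); rewrite -ltr_pdivrMr//.
  rewrite (lt_le_trans (truncnS_gt _))// -natrX ler_nat ltnW//; exact: ltn_expl.
exists (ex_minn ex); case: ex_minnP => k -> hk; rewrite andbT.
case: k hk => [|k] hk; first by rewrite expr0 mul1r.
by rewrite leNgt; apply/negP => /hk; rewrite ltnn.
Qed.

Local Open Scope ereal_scope.

(** A bound for the mass uniform in [t]: on the k-th shell the kernel is at most
    [D t ^ (- n) 2 ^ (- k (n + s))], the enclosing ball has volume at most [(4 t) ^ n 2 ^ (k n)],
    and the ratio of the resulting series is [2 ^ (- s)]. *)
Definition poisson_mass : R := (D * 4 ^+ n / (1 - 2 `^ (- s)))%R.

Lemma poisson_mass_ge0 : (0 <= poisson_mass)%R.
Proof. by rewrite mulr_ge0 ?mulr_ge0 ?exprn_ge0// invr_ge0 subr_ge0 ltW// powR2_lt1. Qed.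

Lemma integral_poisson_le (t : R) (x : 'rV[R]_n) : (0 < t)%R ->
  \int[L]_y (`|poisson_kernel s t (x - y)%R|)%:E <= poisson_mass%:E.
Proof.
move=> t0; pose b : R := (2 `^ (- (n%:R + s)))%R.
have b0 : (0 <= b)%R by exact: powR_ge0.
have b2 : (b * 2 ^+ n = 2 `^ (- s))%R.
  rewrite /b -(powR_mulrn n (ler0n R 2)) -powRD ?pnatr_eq0 ?implybT//.
  by congr powR; ring.
have b21 : (b * 2 ^+ n < 1)%R by rewrite b2 powR2_lt1.
have D0 : (0 <= D * t^-1 ^+ n)%R by rewrite mulr_ge0// exprn_ge0// invr_ge0 ltW.
have e0 : (0 <= (4 * t) ^+ n)%R by rewrite exprn_ge0// mulr_ge0// ltW.
have n20 : (0 <= 2 ^+ n :> R)%R by exact: exprn_ge0.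
have mE k : measurable (nball x (2 ^+ k.+1 * t)%R) by exact: measurable_nball.
have LE k : L (nball x (2 ^+ k.+1 * t)%R) <= ((4 * t) ^+ n * (2 ^+ n) ^+ k)%:E.
  have r0 : (0 <= 2 ^+ k.+1 * t)%R by rewrite mulr_ge0 ?exprn_ge0// ltW.
  apply: (le_trans (lebesgue_rV_ball_le x r0)); rewrite lee_fin -exprM mulnC exprM -exprMn.
  by rewrite exprS (_ : 2 * (2 * 2 ^+ k * t) = 4 * t * 2 ^+ k)%R//; ring.
apply: (le_trans (integral_shells_le D0 b0 e0 n20 b21 mE LE _ _)) => [y _|y _|].
- by rewrite lee_fin.
- have tm : (t <= Num.max `|x - y| t)%R by rewrite le_max lexx orbT.
  have [k /andP[h1 h2]] := dyadic_shell t0 tm; exists k.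
    by rewrite /nball/= distrC (le_lt_trans _ h2)// le_max lexx.
  by rewrite lee_fin; exact: poisson_le_geometric.
rewrite lee_fin b2 /poisson_mass exprMn -!mulrA (mulrCA (t^-1 ^+ n)%R).
rewrite (mulrA (t^-1 ^+ n)%R) exprVn mulVf ?mul1r// expf_neq0// gt_eqF//.
Qed.

(** Covers both cases of [poisson_cube_le]. Near the cube, the box with [l = 2] is used and [4 ^ n]
    compensates [2 ^ (- n l)]; far from it, the pointwise bound of the kernel gives [D * 4 ^ n]. *)
Definition poisson_cube_const : R := (4 ^+ n * (poisson_mass + D * 4 ^+ n))%R.

Lemma poisson_cube_const_ge0 : (0 <= poisson_cube_const)%R.
Proof. by rewrite mulr_ge0 ?exprn_ge0// addr_ge0 ?poisson_mass_ge0// mulr_ge0 ?exprn_ge0. Qed.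

Definition carleson_box (a : 'rV[R]_n) (r : R) : set ('rV[R]_n * R) :=
  [set z | (0 < z.2 < r)%R /\ nball a r z.1].

(* The first box containing [(x, t)] carries the whole estimate: far from the cube the kernel
   is at most a constant times [d ^- n], where [d] is the larger of [t] and the distance. *)
Lemma poisson_cube_le (a : 'rV[R]_n) (r t : R) (x : 'rV[R]_n) : (0 < r)%R -> (0 < t)%R ->
  exists l : nat, carleson_box a (2 ^+ l * r)%R (x, t) /\
  \int[L]_(y in cube a r) (`|poisson_kernel s t (x - y)%R|)%:E <=
    (poisson_cube_const * (2 ^+ n)^-1 ^+ l)%:E.
Proof.
move=> r0 t0; pose d := Num.max `|x - a|%R t.
have [d4|d4] := ltP d (4 * r)%R.
  exists 2%N; split.
    move: d4; rewrite /d gt_max => /andP[h1 h2].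
    by rewrite /carleson_box/= /nball/= t0 (_ : 2 ^+ 2 = 4 :> R)%R ?h2//; ring.
  apply: (@le_trans _ _ poisson_mass%:E).
    apply: le_trans (integral_poisson_le x t0).
    by apply: le_nnint_subset => // y _; rewrite lee_fin.
  rewrite lee_fin /poisson_cube_const.
  have -> : ((2 ^+ n)^-1 ^+ 2 = (4 ^+ n)^-1 :> R)%R.
    by rewrite exprVn -exprM mulnC exprM; congr ((_ ^+ n)^-1)%R; ring.
  rewrite mulrAC divff ?expf_neq0 ?pnatr_eq0// mul1r lerDl mulr_ge0// exprn_ge0//.
have rd : (r <= d)%R by lra.
have [l /andP[l1 l2]] := dyadic_shell r0 rd.
exists l.+1; split.
  by move: l2; rewrite /d gt_max => /andP[h1 h2]; rewrite /carleson_box/= t0 h2.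
apply: (@le_trans _ _ (\int[L]_(y in cube a r) (cst (D * (d / 2)^-1 ^+ n)%:E y))).
  apply: le_nnint => y yQ; first by rewrite lee_fin.
  rewrite lee_fin; apply: poisson_le_inv => //; first by lra.
  (* Replacing [a] by [y] changes the distance to [x] by less than [r <= d / 4], so the larger of
     [t] and the distance is still at least [d / 2]. *)
  have ya : (`|y - a| < r)%R.
    by apply: (cube_dist r0 yQ) => i; rewrite lexx ltrDl.
  have := ler_distD y x a; rewrite le_max.
  by move: rd d4; rewrite /d; case: (leP `|x - a|%R t) => h1 h2 h3 h4; apply/orP; [right|left]; lra.
rewrite (integral_cst L (measurable_cube _ _)).
apply: (@le_trans _ _ ((D * (d / 2)^-1 ^+ n)%:E * (r ^+ n)%:E)).
  rewrite le_eqVlt; apply/orP; left; apply/eqP; congr (_ * _).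
  exact: (cube_measure a (ltW r0)).
rewrite -EFinM lee_fin -mulrA.
have -> : ((d / 2)^-1 ^+ n * r ^+ n = (2 * r / d) ^+ n)%R.
  by rewrite -exprMn; congr (_ ^+ n)%R; field; rewrite gt_eqF//; lra.
apply: (@le_trans _ _ (D * (4 * 2^-1 ^+ l.+1) ^+ n)%R).
  have d0 : (0 < d)%R by exact: lt_le_trans rd.
  apply: ler_wpM2l => //; apply: lerXn2r; rewrite ?nnegrE.
  - by rewrite divr_ge0 ?mulr_ge0// ltW.
  - by rewrite mulr_ge0// exprn_ge0// invr_ge0.
  rewrite ler_pdivrMr// exprS mulrA (_ : 4 / 2 = 2 :> R)%R; last by field.
  rewrite -mulrA; apply: ler_wpM2l => //; rewrite exprVn mulrC ler_pdivlMr ?exprn_gt0//.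
  by rewrite mulrC.
have -> : ((4 * 2^-1 ^+ l.+1) ^+ n = 4 ^+ n * (2 ^+ n)^-1 ^+ l.+1 :> R)%R.
  by rewrite exprMn -!exprVn -!exprM mulnC.
rewrite /poisson_cube_const mulrA; apply: ler_wpM2r.
  by rewrite exprn_ge0// invr_ge0 exprn_ge0.
apply: (@le_trans _ _ (poisson_mass + D * 4 ^+ n)%R).
  by rewrite lerDr poisson_mass_ge0.
apply: ler_peMl; first by rewrite addr_ge0 ?poisson_mass_ge0// mulr_ge0// exprn_ge0.
by rewrite exprn_ege1//; lra.
Qed.

(** A point within [t < r] of [x] is within [2 r] of [a] in the max norm, and [n] bounds the ratio
    of the two norms. *)
Lemma carleson_box_sub_tent (a : 'rV[R]_n) (r : R) : (0 < n)%N ->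
  carleson_box a r `<=` tent (eball a (2 * n%:R * r)).
Proof.
move=> n0 [x t] [/= /andP[t0 tr] xa]; split => // y /= yx.
have n0' : (0 < n%:R :> R)%R by rewrite ltr0n.
apply: (le_lt_trans (enorm_le_norm _)); rewrite mulrAC mulrC ltr_pM2r//.
have := ler_distD x y a; have := le_lt_trans (norm_le_enorm _) yx.
by move: xa; rewrite /nball/=; lra.
Qed.

Lemma measurable_carleson_box (a : 'rV[R]_n) (r : R) : measurable (carleson_box a r).
Proof.
rewrite (_ : carleson_box a r = (nball a r : set 'rV[R]_n) `*` `]0%R, r[%classic).
  by apply: measurableX; [exact: measurable_nball|exact: measurable_itv].
by apply/seteqP; split => -[x t] /= [h1 h2]; split => //; move: h2 h1; rewrite in_itv.
Qed.

Lemma cs_extension_abs_le (f : 'rV[R]_n -> R) (z : 'rV[R]_n * R) : measurable_fun setT f ->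
  (`|cs_extension s f z|)%:E <=
  \int[L]_y ((`|poisson_kernel s z.2 (z.1 - y)|)%:E * (`|f y|)%:E).
Proof.
move=> mf; rewrite /cs_extension /Rintegral.
pose F y : \bar R := (poisson_kernel s z.2 (z.1 - y)%R * f y)%:E.
have mF : measurable_fun setT F.
  apply/measurable_EFinP; apply: measurable_funM => //.
  have mz : measurable_fun setT (fun y : 'rV[R]_n => (z, y)) by exact: measurable_fun_pair.
  exact: (measurableT_comp (measurable_poisson s) mz).
apply: (@le_trans _ _ `|\int[L]_y F y|).
  by case: (\int[L]_y F y) => [r| |] /=; rewrite ?normr0 ?leey.
apply: (le_trans (le_abse_integral L measurableT mF)).
by apply: le_nnint => y _ //; rewrite /F /= normrM EFinM.
Qed.

End poisson_bounds.

Section carleson_embedding.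
Context {R : realType} {n : nat} (mu : {measure set ('rV[R]_n * R) -> \bar R}).
Context (s beta p q0 : R).
Hypothesis n0 : (0 < n)%N.
Hypothesis s0 : 0 < s.
Hypothesis b0 : 0 < beta.
Hypothesis p01 : 0 < p <= 1.
Hypothesis pq : p <= q0.
Hypothesis pn : n%:R < p * (n%:R + beta).
Local Notation L := (@lebesgue_rV R n).
Local Notation cubes := (int * 'rV[int]_n)%type.
Local Notation PC := (@poisson_cube_const R n s).
Local Open Scope ereal_scope.

Let box (i : cubes * nat) : set ('rV[R]_n * R) :=
  carleson_box (scale i.1.1 *: map_mx intr i.1.2)%R (2 ^+ i.2 * scale i.1.1)%R.

Let weight (b : cubes -> R) (i : cubes * nat) : R :=
  (PC `^ p * b i.1 * ((2 ^+ n)^-1 ^+ i.2) `^ p)%R.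

Let p0 : (0 < p)%R. Proof. by case/andP: p01. Qed.

Let PC0 : (0 <= PC)%R. Proof. exact: poisson_cube_const_ge0. Qed.

Let weight_ge0 b i : (forall q, 0 <= b q)%R -> (0 <= weight b i)%R.
Proof. by move=> h; rewrite /weight !mulr_ge0 ?powR_ge0. Qed.

(** The extension is estimated cube by cube, and since [p <= 1] the p-th power passes inside the
    sum. For each cube a single box from [poisson_cube_le] carries the estimate; the other boxes
    only add nonnegative terms, but make the bound a fixed combination of indicators. *)
Let extension_powR_le (f : 'rV[R]_n -> R) (b : cubes -> R) (z : 'rV[R]_n * R) :
  measurable_fun setT f -> (forall q, 0 <= b q)%R -> (0 < z.2)%R ->
  (forall x, (`|f x|)%:E <= \esum_(q in [set: cubes])
     ((b q)%:E `^ p^-1 * (\1_(dyadic_cube q) x)%:E)) ->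
  (`|cs_extension s f z| `^ p)%:E <=
    \esum_(i in [set: cubes * nat]) (weight b i * \1_(box i) z)%:E.
Proof.
move=> mf bq0 z0 fb.
pose P y : \bar R := (`|poisson_kernel s z.2 (z.1 - y)|)%:E.
have P0 y : 0 <= P y by rewrite lee_fin.
have mP : measurable_fun setT P.
  apply/measurable_EFinP; apply: measurableT_comp => //.
  have mz : measurable_fun setT (fun y : 'rV[R]_n => (z, y)) by exact: measurable_fun_pair.
  exact: (measurableT_comp (measurable_poisson s) mz).
pose v q : R := (b q `^ p^-1)%R.
have v0 q : (0 <= v q)%R by exact: powR_ge0.
pose I q : \bar R := \int[L]_(y in dyadic_cube q) P y.
have I0 q : 0 <= I q by exact: integral_ge0.
have mQ q : measurable (dyadic_cube q : set 'rV[R]_n) by exact: measurable_cube.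
have IE q : I q = \int[L]_y (P y * (\1_(dyadic_cube q) y)%:E).
  rewrite /I integral_mkcond; apply: eq_integral => y _.
  by rewrite indicE /patch; case: ifP => _; rewrite ?mule1 ?mule0.
have le1 : (`|cs_extension s f z|)%:E <= \esum_(q in [set: cubes]) ((v q)%:E * I q).
  apply: (le_trans (cs_extension_abs_le s z mf)).
  pose F (q : cubes) y : \bar R := (v q)%:E * (P y * (\1_(dyadic_cube q) y)%:E).
  have F0 q y : 0 <= F q y by rewrite !mule_ge0 ?lee_fin// indicE.
  have mi q : measurable_fun setT (fun y : 'rV[R]_n => P y * (\1_(dyadic_cube q) y)%:E).
    by apply: emeasurable_funM => //; apply/measurable_EFinP; exact: measurable_indic.
  have mF q : measurable_fun setT (F q) by apply: emeasurable_funM.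
  have -> : \esum_(q in [set: cubes]) ((v q)%:E * I q) = \esum_(q in [set: cubes]) \int[L]_y F q y.
    apply: eq_esum => q _; rewrite /F ge0_integralZl//; last 2 first.
    - by move=> y _; rewrite mule_ge0// lee_fin indicE.
    - by rewrite lee_fin.
    by rewrite IE.
  rewrite -(integral_esum L measurableT mF F0); apply: le_nnint => y _.
    by rewrite mule_ge0// lee_fin.
  apply: (le_trans (lee_wpmul2l _ (fb y))); first by rewrite lee_fin.
  have -> : F^~ y = fun q => (`|poisson_kernel s z.2 (z.1 - y)|)%:E *
      ((v q)%:E * (\1_(dyadic_cube q) y)%:E).
    by apply/funext => q; rewrite /F muleCA.
  by rewrite esumZl// => q; rewrite mule_ge0 ?lee_fin// indicE.
have le2 := le_poweR (ltW p0) (normr_ge0 _ : 0 <= (`|cs_extension s f z|)%:E) le1.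
rewrite poweR_EFin in le2; apply: (le_trans le2).
have vI0 q : 0 <= (v q)%:E * I q by rewrite mule_ge0// lee_fin.
apply: (le_trans (poweR_esum_subadd p01 vI0)).
rewrite (_ : [set: cubes * nat] = [set: cubes] `*`` (fun=> [set: nat])); last by apply/seteqP; split.
rewrite -(@esum_esum _ _ _ _ _ (fun q l => (weight b (q, l) * \1_(box (q, l)) z)%:E)); last first.
  by move=> q l _ _; rewrite lee_fin mulr_ge0 ?weight_ge0// indicE.
apply: le_esum => q _.
have [l [hl1 hl2]] := poisson_cube_le (s0) (scale q.1 *: map_mx intr q.2)%R z.1 (@scale_gt0 R q.1) z0.
have := @esum_ub R nat (fun l => (weight b (q, l) * \1_(box (q, l)) z)%:E) l.
move=> /(_ ltac:(move=> l'; rewrite lee_fin mulr_ge0 ?weight_ge0// indicE//)); apply: le_trans.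
rewrite indicE mem_set/=; last by move: hl1; rewrite -surjective_pairing.
have h2 : (v q)%:E * I q <= (v q * (PC * (2 ^+ n)^-1 ^+ l))%:E.
  by rewrite EFinM; apply: lee_wpmul2l; [rewrite lee_fin|exact: hl2].
apply: (le_trans (le_poweR (ltW p0) (vI0 q) h2)).
rewrite poweR_EFin lee_fin mulr1 /weight /=.
have X0 : (0 <= (2 ^+ n)^-1 ^+ l :> R)%R by rewrite exprn_ge0// invr_ge0 exprn_ge0.
rewrite (powRM p (v0 q) (mulr_ge0 PC0 X0)) (powRM p PC0 X0) /v -powRrM mulVf ?gt_eqF//.
by rewrite (powRr1 (bq0 q)) mulrCA mulrA.
Qed.

(** Along the enlargements of one cube the tent condition grows like [2 ^ (l (n - p beta))] while
    the weights decay like [2 ^ (- l n p)]; the ratio [2 ^ (n - p (n + beta))] is less than [1] by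
    [pn]. *)
Let weight_sum_le (b : cubes -> R) (A : R) : (forall q, 0 <= b q)%R -> (0 <= A)%R ->
  (forall x r, (0 < r)%R -> mu (tent (eball x r)) `^ (p / q0) <=
     (A * r `^ (n%:R - p * beta))%:E) ->
  \esum_(i in [set: cubes * nat]) ((weight b i)%:E * mu (box i) `^ (p / q0)) <=
  (PC `^ p * A * (2 * n%:R) `^ (n%:R - p * beta) /
     (1 - 2 `^ (n%:R - p * (n%:R + beta))))%:E *
  \esum_(q in [set: cubes]) ((scale q.1 `^ (n%:R - p * beta))%:E * (b q)%:E).
Proof.
move=> bq0 A0 hA.
set g := (n%:R - p * beta)%R; set zz : R := (2 `^ (n%:R - p * (n%:R + beta)))%R.
have th0 : (0 <= p / q0)%R by rewrite divr_ge0 ?(ltW p0)// (le_trans (ltW p0)).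
have zz1 : (zz < 1)%R.
  by rewrite /zz -(opprB (p * _)%R); apply: powR2_lt1; rewrite subr_gt0.
have zz0 : (0 <= zz)%R by exact: powR_ge0.
pose D : R := (PC `^ p * A * (2 * n%:R) `^ g)%R.
have D0 : (0 <= D)%R by rewrite !mulr_ge0 ?powR_ge0.
have Dz0 : (0 <= D / (1 - zz))%R by rewrite divr_ge0// subr_ge0 ltW.
rewrite -esumZl//; last by move=> q; rewrite -EFinM lee_fin mulr_ge0 ?powR_ge0.
rewrite (_ : [set: cubes * nat] = [set: cubes] `*`` (fun=> [set: nat])); last by apply/seteqP; split.
rewrite -(@esum_esum _ _ _ _ _ (fun q l => (weight b (q, l))%:E * mu (box (q, l)) `^ (p / q0))); last first.
  by move=> q l _ _; rewrite mule_ge0 ?poweR_ge0// lee_fin weight_ge0.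
apply: le_esum => q _; have r0 := @scale_gt0 R q.1.
have -> : (D / (1 - zz))%:E * ((scale q.1 `^ g)%:E * (b q)%:E) =
    ((D * (scale q.1 `^ g * b q)) / (1 - zz))%:E.
  by congr EFin; rewrite mulrAC.
apply: le_trans (geometric_nneseries_le _ _); last 2 first.
- by rewrite mulr_ge0// mulr_ge0// powR_ge0.
- by rewrite zz0.
rewrite nneseries_esumT; last by move=> l; rewrite lee_fin !mulr_ge0 ?powR_ge0 ?exprn_ge0.
apply: le_esum => l _.
have R0 : (0 < 2 * n%:R * (2 ^+ l * @scale R q.1))%R.
  by rewrite !mulr_gt0 ?exprn_gt0// ltr0n.
have le1 : mu (box (q, l)) `^ (p / q0) <= (A * (2 * n%:R * (2 ^+ l * @scale R q.1)) `^ g)%:E.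
  apply: le_trans (hA (scale q.1 *: map_mx intr q.2)%R _ R0).
  apply: le_poweR => //; apply: le_measure; rewrite ?inE.
  - exact: measurable_carleson_box.
  - exact: measurable_tent.
  - exact: carleson_box_sub_tent.
apply: (le_trans (lee_wpmul2l _ le1)); first by rewrite lee_fin weight_ge0.
rewrite -EFinM lee_fin le_eqVlt; apply/orP; left; apply/eqP.
have r0' := ltW r0.
have l0 : (0 <= 2 ^+ l :> R)%R by rewrite exprn_ge0.
have nn0 : (0 <= 2 * n%:R :> R)%R by rewrite mulr_ge0.
rewrite (powRM g nn0 (mulr_ge0 l0 r0')) (powRM g l0 r0').
have zl : (zz ^+ l = ((2 ^+ n)^-1 ^+ l) `^ p * (2 ^+ l) `^ g)%R.
  rewrite -exprVn -exprM -powR_inv1// -(powR_mulrn (n * l) (powR_ge0 2 (- 1))) -(powR_mulrn l zz0).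
  rewrite -(powR_mulrn l (ler0n R 2)) -!powRrM -powRD ?pnatr_eq0 ?implybT//.
  by congr powR; rewrite /g natrM; ring.
rewrite zl /D /weight /=; ring.
Qed.

Lemma lorentz_of_ball_growth :
  (exists C : R, forall (x : 'rV[R]_n) (r : R), (0 < r)%R ->
    mu (tent (eball x r)) `^ (p / q0) <= (C * r `^ (n%:R - p * beta))%:E) ->
  exists C : R, forall f : 'rV[R]_n -> R, Cc_smooth f ->
    lorentz_norm mu q0 p (cs_extension s f) <= C%:E * besov_norm beta p p f.
Proof.
move=> [A0 hA0]; pose A : R := `|A0|%R.
have A00 : (0 <= A)%R by exact: normr_ge0.
have hA x r : (0 < r)%R ->
    mu (tent (eball x r)) `^ (p / q0) <= (A * r `^ (n%:R - p * beta))%:E.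
  move=> r0; apply: (le_trans (hA0 x r r0)); rewrite lee_fin.
  by apply: ler_wpM2r; [exact: powR_ge0|exact: ler_norm].
have [K K0 dec] := @besov_decomposition R n beta p n0 b0 p01.
have [q00 th01] : (0 < q0)%R /\ (0 < p / q0 <= 1)%R.
  have q00 : (0 < q0)%R by exact: lt_le_trans pq.
  by split => //; rewrite divr_gt0//= ler_pdivrMr// mul1r.
have [C1 C1E] : exists C1 : R, C1 = (PC `^ p * A * (2 * n%:R) `^ (n%:R - p * beta) /
     (1 - 2 `^ (n%:R - p * (n%:R + beta))))%R by eexists.
pose C2 : R := (p / (1 - (2 `^ p)^-1) * `|C1| * K)%R.
have d0 : (0 <= 1 - (2 `^ p)^-1 :> R)%R by rewrite subr_ge0 -powRN ltW// powR2_lt1.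
have C20 : (0 <= C2)%R.
  apply: mulr_ge0 => //; apply: mulr_ge0 => //; apply: divr_ge0 => //; exact: ltW.
have C10 : (0 <= C1)%R.
  rewrite C1E; apply: divr_ge0; first by rewrite !mulr_ge0 ?powR_ge0.
  by rewrite -(opprB (p * _)%R) subr_ge0 ltW// powR2_lt1// subr_gt0.
(* The added [1] keeps the constant positive, so that the right-hand side is infinite whenever the
   Besov norm is. *)
exists (C2 `^ p^-1 + 1)%R => f fcc.
have mf := Cc_smooth_measurable fcc; have mu' := measurable_cs_extension s mf.
have [Bo|Bfin] := eqVneq (besov_norm beta p p f) +oo.
  by rewrite Bo gt0_muley ?leey// lte_fin ltr_pwDr// powR_ge0.
have N0 := besov_norm_ge0 beta p p f.
have [B [B0 fB sB]] := dec f fcc.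
pose N := besov_norm beta p p f.
have Nfin : N `^ p < +oo.
  rewrite /N; case: (besov_norm beta p p f) Bfin N0 => [r| |]//= _ _.
  by rewrite ltry.
have Bf q : B q \is a fin_num.
  rewrite ge0_fin_numE// -[B q]mul1e.
  have sq0 : (0 < scale q.1 `^ (n%:R - p * beta) :> R)%R by rewrite powR_gt0// scale_gt0.
  rewrite -(mulVf (lt0r_neq0 sq0)) EFinM -muleA.
  have h : (scale q.1 `^ (n%:R - p * beta))%:E * B q < +oo.
    apply: le_lt_trans (_ : K%:E * N `^ p < +oo); last by rewrite lte_mul_pinfty// poweR_ge0.
    apply: le_trans sB.
    apply: (@esum_ub R cubes (fun q => (scale q.1 `^ (n%:R - p * beta))%:E * B q)).
    move=> q'; apply: mule_ge0; [by rewrite lee_fin powR_ge0|exact: B0].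
  by rewrite lte_mul_pinfty// lee_fin invr_ge0 ltW.
pose b q : R := fine (B q).
have bE q : B q = (b q)%:E by rewrite /b fineK.
have bq0 q : (0 <= b q)%R by rewrite fine_ge0.
have fb x : (`|f x|)%:E <= \esum_(q in [set: cubes])
     ((b q)%:E `^ p^-1 * (\1_(dyadic_cube q) x)%:E).
  by apply: (le_trans (fB x)); apply: le_esum => q _; rewrite bE.
(* Pairs of a cube and an enlargement are enumerated by [nat] for [choquet_subadditive]; codes of no
   pair get weight [0] and the empty set. *)
pose w (k : nat) : R := oapp (weight b) 0%R (pickle_inv k).
pose E (k : nat) : set ('rV[R]_n * R) := oapp box set0 (pickle_inv k).
have w0 k : (0 <= w k)%R by rewrite /w; case: (pickle_inv k) => [i|]//=; exact: weight_ge0.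
have mE k : measurable (E k).
  rewrite /E; case: (pickle_inv k) => [i|]/=; last exact: measurable0.
  exact: measurable_carleson_box.
pose G z := \sum_(0 <= k <oo) (w k * \1_(E k) z)%:E.
have GE z : G z = \esum_(i in [set: cubes * nat]) (weight b i * \1_(box i) z)%:E.
  rewrite esum_countable; last by move=> i; rewrite lee_fin mulr_ge0 ?weight_ge0// indicE.
  apply: eq_eseriesr => k _; rewrite /w /E.
  by case: (pickle_inv k) => [i|]//=; rewrite mul0r.
have mG : measurable_fun setT G.
  apply: ge0_emeasurable_sum => [k z _ _|k _]; first by rewrite lee_fin mulr_ge0// indicE.
  by apply/measurable_EFinP; apply: measurable_funM => //; exact: measurable_indic.
pose S (t : R) := [set z | t%:E < G z].
have mS t : measurable (S t).
  by rewrite -[S t]setTI; exact: emeasurable_fun_o_infty.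
pose Phi (t : R) := mu (S t) `^ (p / q0).
have [th0 th1] := andP th01.
have Phi0 t : 0 <= Phi t by exact: poweR_ge0.
have Phid : {homo Phi : x y / (x <= y)%R >-> y <= x}.
  move=> x y xy; apply: le_poweR => //; first exact: ltW.
  apply: le_measure; rewrite ?inE//.
  by move=> z /=; apply: le_lt_trans; rewrite lee_fin.
have le1 : \int[lebesgue_measure]_(t in `]0%R, +oo[) Phi t <= C1%:E * (K%:E * N `^ p).
  apply: (le_trans (choquet_subadditive mu th01 w0 mE)).
  have -> : \sum_(0 <= i <oo) ((w i)%:E * mu (E i) `^ (p / q0)) =
      \esum_(i in [set: cubes * nat]) ((weight b i)%:E * mu (box i) `^ (p / q0)).
    rewrite esum_countable; last by move=> i; rewrite mule_ge0 ?poweR_ge0// lee_fin weight_ge0.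
    apply: eq_eseriesr => k _; rewrite /w /E.
    by case: (pickle_inv k) => [i|]//=; rewrite mul0e.
  apply: (le_trans (weight_sum_le bq0 A00 hA)); rewrite -C1E.
  apply: lee_wpmul2l; first by rewrite lee_fin.
  apply: le_trans sB; apply: le_esum => q _.
  by rewrite bE.
have le2 : \int[lebesgue_measure]_(l in `]0%R, +oo[)
    (mu (level_set (cs_extension s f) l) `^ (p / q0) * (p * l `^ (p - 1))%:E) <=
    C2%:E * N `^ p.
  (* As [G] dominates [|u| ^ p], the level set of [u] at [l] lies in the superlevel set of [G] at
     [l ^ p], to which [integral_powR_weight] applies. *)
  apply: (@le_trans _ _ (\int[lebesgue_measure]_(l in `]0%R, +oo[)
      (Phi (l `^ p)%R * (p * l `^ (p - 1))%:E))).
    apply: le_nnint => l; first by rewrite mule_ge0 ?poweR_ge0// lee_fin mulr_ge0 ?powR_ge0 ?(ltW p0).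
    rewrite /= in_itv/= andbT => l0; apply: lee_wpmul2r.
      by rewrite lee_fin mulr_ge0 ?powR_ge0 ?(ltW p0).
    apply: le_poweR => //; first exact: ltW.
    apply: le_measure; rewrite ?inE//; first exact: measurable_level_set.
    move=> z [z0 /= lz]; rewrite /S/= GE.
    apply: lt_le_trans (extension_powR_le mf bq0 z0 fb); rewrite lte_fin.
    by apply: gt0_ltr_powR => //; rewrite nnegrE// ltW.
  apply: (le_trans (integral_powR_weight p01 Phi0 Phid)).
  apply: (le_trans (lee_wpmul2l _ le1)).
    rewrite lee_fin divr_ge0 ?(ltW p0)//.
  by rewrite !muleA -!EFinM /C2 (ger0_norm C10).
rewrite /lorentz_norm.
have pv : (0 <= p^-1)%R by rewrite invr_ge0 ltW.
have i0 : 0 <= \int[lebesgue_measure]_(l in `]0%R, +oo[)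
    (mu (level_set (cs_extension s f) l) `^ (p / q0) * (p * l `^ (p - 1))%:E).
  by apply: integral_ge0 => l _; rewrite mule_ge0 ?poweR_ge0// lee_fin mulr_ge0 ?powR_ge0 ?(ltW p0).
apply: (le_trans (le_poweR pv i0 le2)).
rewrite poweRM ?poweR_ge0 ?lee_fin// poweRK ?gt_eqF// poweR_EFin.
apply: lee_wpmul2r => //; rewrite lee_fin lerDl//.
Qed.

End carleson_embedding.

(** * Smooth bumps and the capacity of balls *)

Section flat_functions.
Context {R : realType}.

(** The classical flat function [exp (- 1 / t)] together with the negative powers of [t] created by
    its derivatives; up to linear combination the family is closed under differentiation. *)
Definition flat (m : nat) (t : R) : R := if 0 < t then t^-1 ^+ m * expR (- t^-1) else 0.

Lemma flat_pos m t : 0 < t -> flat m t = t^-1 ^+ m * expR (- t^-1).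
Proof. by rewrite /flat => ->. Qed.

Lemma flat_neg m t : t <= 0 -> flat m t = 0.
Proof. by rewrite /flat leNgt => /negbTE ->. Qed.

Lemma flat_ge0 m t : 0 <= flat m t.
Proof.
rewrite /flat; case: ifPn => // t0.
by rewrite mulr_ge0 ?expR_ge0// exprn_ge0// invr_ge0 ltW.
Qed.

Lemma flat_le m t : flat m t <= m`!%:R.
Proof.
rewrite /flat; case: ifPn => // t0; rewrite expRN ler_pdivrMr ?expR_gt0//.
have u0 : 0 <= t^-1 by rewrite invr_ge0 ltW.
case: m => [|m]; first by rewrite expr0 fact0 mul1r; have := expR_ge1Dx t^-1; lra.
have := expR_ge1Dxn m u0; set e := expR _ => h.
have f0 : (0 < m.+1`!%:R :> R) by rewrite ltr0n fact_gt0.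
rewrite mulrC -ler_pdivrMr//; lra.
Qed.

Lemma flatS m t : flat m t = t * flat m.+1 t.
Proof.
rewrite /flat; case: ifPn => t0; last by rewrite mulr0.
by rewrite exprS !mulrA divff ?gt_eqF// mul1r.
Qed.

Lemma is_derive_flat m (t : R) : is_derive t 1 (flat m) (flat m.+2 t - m%:R * flat m.+1 t).
Proof.
have [t0|t0|->] := ltgtP t 0.
- rewrite !flat_neg ?ltW// mulr0 subr0; apply: near_eq_is_derive (is_derive_cst 0 t 1).
  by near=> x; rewrite /= flat_neg// ltW//; near: x; exact: lt_nbhsl.
- have dV : is_derive t 1 (fun y : R => y^-1) (- t^-1 ^+ 2).
    have tn : t != 0 by rewrite gt_eqF.
    apply: DeriveDef; first by apply: derivableV.
    by rewrite deriveV// derive_id -exprVn scaler1.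
  rewrite !flat_pos//.
  apply: (@near_eq_is_derive _ _ _ (fun x : R => x^-1 ^+ m * expR (- x^-1) : R)).
    by near=> x; rewrite flat_pos//; near: x; exact: lt_nbhsr.
  have dE : is_derive t 1 (fun y : R => expR (- y^-1)) (expR (- t^-1) * t^-1 ^+ 2).
    have := @is_derive1_comp R expR (fun y : R => - y^-1) t _ _ (is_derive_expR (- t^-1))
      (is_deriveN dV).
    by rewrite opprK.
  have dX : is_derive t 1 (fun y : R => y^-1 ^+ m) ((m%:R * t^-1 ^+ m.-1) *: - t^-1 ^+ 2).
    by have := is_deriveX m dV; rewrite exprfctE.
  apply: is_derive_eq (is_deriveM dX dE) _.
  rewrite /GRing.scale /=.
  have -> : t^-1 ^+ m.+2 = t^-1 ^+ m * t^-1 ^+ 2 by rewrite -exprD addn2.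
  have -> : m%:R * (t^-1 ^+ m.+1 * expR (- t^-1)) = expR (- t^-1) * (m%:R * t^-1 ^+ m.-1 * t^-1 ^+ 2).
    case: m dX => [|m] _; first by rewrite !mul0r mulr0.
    rewrite /= -(addn2 m) exprD; move: (expR _) (t^-1 ^+ m) (t^-1 ^+ 2) m.+1%:R => a b c d.
    by ring.
  move: (expR _) (t^-1 ^+ m) (t^-1 ^+ m.-1) (t^-1 ^+ 2) m%:R => a b c d e.
  by ring.
(* By [flatS] twice, the difference quotient at [0] equals [h * flat m.+2 h], and [flat_le] bounds
   the second factor. *)
have h0 : (fun h : R => h^-1 *: ((flat m \o shift 0) (h *: 1) - flat m 0)) h @[h --> 0^'] --> (0 : R).
  apply/cvgr0Pnorm_le => e e0; near=> h.
  have hn : h != 0 by near: h; exact: nbhs_dnbhs_neq.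
  rewrite /= /GRing.scale /= mulr1 addr0 (flat_neg m (lexx 0)) subr0 (flatS m) (flatS m.+1).
  rewrite (mulKf hn) normrM (ger0_norm (flat_ge0 _ _)).
  have f0 : (0 < m.+2`!%:R :> R) by rewrite ltr0n fact_gt0.
  apply: (@le_trans _ _ (`|h| * m.+2`!%:R)); first by apply: ler_wpM2l => //; exact: flat_le.
  rewrite -ler_pdivlMr//; near: h; apply: dnbhs0_le; exact: divr_gt0.
rewrite (flat_neg m.+2)// (flat_neg m.+1)// mulr0 subr0.
by apply: DeriveDef; [apply/cvg_ex; exists 0|exact: cvg_lim].
Unshelve. all: by end_near.
Qed.

End flat_functions.

Section flat_algebra.
Context {R : realType} {n : nat}.

(* Closed under partial derivatives and made of bounded functions: membership
   alone gives smoothness. *)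
Inductive flat_alg : ('rV[R]_n -> R) -> Prop :=
| flat_alg_cst c : flat_alg (fun=> c)
| flat_alg_coord m a b i : flat_alg (fun x => flat m (a * x ord0 i + b))
| flat_algD f g : flat_alg f -> flat_alg g -> flat_alg (fun x => f x + g x)
| flat_algM f g : flat_alg f -> flat_alg g -> flat_alg (fun x => f x * g x).

Lemma flat_alg_prod (I : Type) (r : seq I) (f : I -> 'rV[R]_n -> R) :
  (forall i, flat_alg (f i)) -> flat_alg (fun x => \prod_(i <- r) f i x).
Proof.
move=> hf; elim: r => [|i r ih].
  by under eq_fun do rewrite big_nil; exact: flat_alg_cst.
by under eq_fun do rewrite big_cons; exact: flat_algM.
Qed.

Lemma flat_alg_bounded f : flat_alg f -> exists2 M : R, 0 <= M & forall x, `|f x| <= M.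
Proof.
elim=> [c|m a b i|{}f g _ [M M0 hM] _ [N N0 hN]|{}f g _ [M M0 hM] _ [N N0 hN]].
- by exists `|c|.
- by exists m`!%:R => // x; rewrite ger0_norm ?flat_ge0 ?flat_le.
- by exists (M + N) => [|x]; [exact: addr_ge0|rewrite (le_trans (ler_normD _ _))// lerD].
- by exists (M * N) => [|x]; [exact: mulr_ge0|rewrite normrM ler_pM].
Qed.

Lemma continuous_flat m : continuous (@flat R m).
Proof.
by move=> t; apply/differentiable_continuous/derivable1_diffP; have [] := is_derive_flat m t.
Qed.

Lemma flat_alg_continuous f : flat_alg f -> continuous f.
Proof.
elim=> [c|m a b i|{}f g _ cf _ cg|{}f g _ cf _ cg] x.
- exact: cst_continuous.
- apply: (@continuous_comp _ _ _ (fun x : 'rV[R]_n => a * x ord0 i + b) (flat m)).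
    have cx : {for x, continuous (fun y : 'rV[R]_n => y ord0 i)} by exact: coord_continuous.
    exact: (cvgD (cvgM (cvg_cst a) cx) (cvg_cst b)).
  exact: continuous_flat.
- exact: cvgD (cf x) (cg x).
- exact: cvgM (cf x) (cg x).
Qed.

Lemma is_derive_line (f : 'rV[R]_n -> R) (x v : 'rV[R]_n) (t d : R) :
  is_derive t 1 (fun u : R => f (x + u *: v)) d <-> is_derive (x + t *: v) v f d.
Proof.
pose q := fun h : R => h^-1 *: ((f \o shift (x + t *: v)) (h *: v) - f (x + t *: v)) : R.
pose q' := fun h : R => h^-1 *:
  (((fun u : R => f (x + u *: v)) \o shift t) (h *: (1 : R)) - f (x + t *: v)) : R.
have qE : q = q'.
  apply/funext => h; rewrite /q /q' /= /GRing.scale /= mulr1; congr (_ * (f _ - _)).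
  by rewrite addrCA -scalerDl.
by split => -[h1 h2]; split; move: h1 h2; rewrite /derivable /derive -/q -/q' qE.
Qed.

Lemma flat_alg_derive f : flat_alg f -> exists g : 'I_n -> 'rV[R]_n -> R,
  (forall i, flat_alg (g i)) /\
  forall x v, is_derive x v f (\sum_i v ord0 i * g i x).
Proof.
elim=> [c|m a b i|{}f g _ [f' [hf' df]] _ [g' [hg' dg]]|{}f g hf [f' [hf' df]] hg [g' [hg' dg]]].
- exists (fun _ _ => 0); split=> [i|x v]; first exact: flat_alg_cst.
  rewrite big1 => [|i _]; last by rewrite mulr0.
  exact: is_derive_cst.
- pose l (x : 'rV[R]_n) := a * x ord0 i + b.
  exists (fun j x => (if j == i then a else 0) *
     (flat m.+2 (a * x ord0 i + b) + (- m%:R) * flat m.+1 (a * x ord0 i + b))); split.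
    move=> j; apply: flat_algM; first exact: flat_alg_cst.
    apply: flat_algD; first exact: flat_alg_coord.
    by apply: flat_algM; [exact: flat_alg_cst|exact: flat_alg_coord].
  move=> x v; rewrite (bigD1 i)//= eqxx big1 ?addr0; last first.
    by move=> j ji; rewrite (negbTE ji) mul0r mulr0.
  rewrite -[x]addr0 -[X in x + X](scale0r v); apply/is_derive_line.
  rewrite (_ : (fun u : R => _) = (flat m) \o (fun u : R => (a * v ord0 i) * u + (a * x ord0 i + b))); last first.
    by apply/funext => u /=; rewrite !mxE; congr flat; ring.
  have dl : is_derive (0 : R) 1 (fun u : R => (a * v ord0 i) * u + (a * x ord0 i + b)) (a * v ord0 i).
    apply: is_derive_eq (is_deriveD (is_deriveZ (a * v ord0 i) (is_derive_id (0 : R) 1))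
      (is_derive_cst (a * x ord0 i + b) (0 : R) 1)) _.
    by rewrite /GRing.scale /= mulr1 addr0.
  apply: is_derive_eq (is_derive1_comp (is_derive_flat m _) dl) _.
  by rewrite mulr0 add0r scale0r addr0; ring.
- exists (fun i x => f' i x + g' i x); split=> [i|x v]; first exact: flat_algD.
  under eq_bigr do rewrite mulrDr; rewrite big_split/=.
  exact: is_deriveD.
- exists (fun i x => f x * g' i x + g x * f' i x); split=> [i|x v].
    by apply: flat_algD; exact: flat_algM.
  under eq_bigr do rewrite mulrDr mulrCA [X in _ + X]mulrCA; rewrite big_split/= -!mulr_sumr.
  exact: is_deriveM.
Qed.

Lemma flat_alg_Ck k f : flat_alg f -> Ck k f.
Proof.
elim: k f => [|k ih] f hf; split => //; try exact: flat_alg_continuous.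
move=> i; have [g [hg dg]] := flat_alg_derive hf; split.
  by move=> x; have [] := dg x (delta_mx ord0 i).
rewrite (_ : (fun x => _) = g i); first exact: ih.
apply/funext => x; have [_ ->] := dg x (delta_mx ord0 i).
rewrite (bigD1 i)//= mxE !eqxx mul1r big1 ?addr0// => j ji.
by rewrite mxE (negbTE ji) andbF mul0r.
Qed.

Lemma fdiff_iter_derive k (f : 'rV[R]_n -> R) (g : 'I_n -> 'rV[R]_n -> R) (h v : 'rV[R]_n) :
  (forall x, is_derive x v f (\sum_i v ord0 i * g i x)) ->
  forall x, is_derive x v (iter k (fdiff h) f) (\sum_i v ord0 i * iter k (fdiff h) (g i) x).
Proof.
move=> df; elim: k => [|k ih] x; first exact: df.
pose F := iter k (fdiff h) f; pose G i := iter k (fdiff h) (g i).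
have -> : \sum_i v ord0 i * iter k.+1 (fdiff h) (g i) x =
    \sum_i v ord0 i * G i (x + h) - \sum_i v ord0 i * G i x.
  by rewrite -sumrB; apply: eq_bigr => i _; rewrite -mulrBr.
have dF : is_derive x v (fun y => F (y + h)) (\sum_i v ord0 i * G i (x + h)).
  rewrite -[X in is_derive X]addr0 -(scale0r v); apply/is_derive_line.
  rewrite (_ : (fun u : R => _) = (fun u : R => F ((x + h) + u *: v))); last first.
    by apply/funext => u; rewrite addrAC.
  by apply/is_derive_line; rewrite scale0r addr0; exact: ih.
exact: is_deriveB dF (ih x).
Qed.

(** The mean value theorem along the segment from [x] to [x + h] trades one difference for a
    derivative in the direction [h], that is for k-th differences of the partial derivatives, which
    lie in the algebra again. *)
Lemma fdiff_iter_bound k f : flat_alg f ->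
  exists2 M : R, 0 <= M & forall x h, `|iter k (fdiff h) f x| <= M * `|h| ^+ k.
Proof.
elim: k f => [|k ih] f hf.
  by have [M M0 hM] := flat_alg_bounded hf; exists M => // x h; rewrite expr0 mulr1 hM.
have [g [hg dg]] := flat_alg_derive hf.
have /choice[N hN] : forall i, exists N : R, 0 <= N /\ forall x h, `|iter k (fdiff h) (g i) x| <= N * `|h| ^+ k.
  by move=> i; have [N N0 hN] := ih _ (hg i); exists N.
exists (\sum_i N i) => [|x h]; first by apply: sumr_ge0 => i _; case: (hN i).
rewrite iterS /fdiff -/(fdiff h).
pose F := iter k (fdiff h) f; pose phi (u : R) := F (x + u *: h).
pose dphi (u : R) := \sum_i h ord0 i * iter k (fdiff h) (g i) (x + u *: h).
have dp (u : R) : is_derive u 1 phi (dphi u).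
  by apply/is_derive_line; apply: fdiff_iter_derive.
have cphi : continuous phi.
  by move=> u; apply/differentiable_continuous/derivable1_diffP; have [] := dp u.
have [c _ hc] := MVT ltr01 (fun u _ => dp u) (continuous_subspaceT cphi).
move: hc; rewrite subr0 mulr1 /phi scale1r scale0r addr0 => ->.
rewrite (le_trans (ler_norm_sum _ _ _))// mulr_suml; apply: ler_sum => i _.
rewrite normrM exprS mulrCA; apply: ler_pM => //; first exact: rV_coord_le.
by case: (hN i).
Qed.

End flat_algebra.

Section bump.
Context {R : realType} {n : nat}.
Local Notation L := (@lebesgue_rV R n).

(** Supported in the max-norm ball of radius [2 r]. For [|x - x0| <= r] both arguments of [flat 0]
    are at least [1], so each factor is at least [exp (- 1)]; the normalisation [expR 2] makes the
    product at least [1]. *)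
Definition bump (x0 : 'rV[R]_n) (r : R) (x : 'rV[R]_n) : R :=
  \prod_(i < n) (expR 2 * (flat 0 (2 - (x ord0 i - x0 ord0 i) / r) *
                           flat 0 (2 + (x ord0 i - x0 ord0 i) / r))).

Lemma flat_alg_bump x0 r : flat_alg (bump x0 r).
Proof.
apply: flat_alg_prod => i; apply: flat_algM; first exact: flat_alg_cst.
apply: flat_algM.
  rewrite (_ : (fun x : 'rV[R]_n => _) =
    (fun x : 'rV[R]_n => flat 0 (- r^-1 * x ord0 i + (2 + x0 ord0 i / r)))).
    exact: flat_alg_coord.
  by apply/funext => x; congr flat; ring.
rewrite (_ : (fun x : 'rV[R]_n => _) =
  (fun x : 'rV[R]_n => flat 0 (r^-1 * x ord0 i + (2 - x0 ord0 i / r)))).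
  exact: flat_alg_coord.
by apply/funext => x; congr flat; ring.
Qed.

Lemma bump_scale x0 r x : bump x0 r x = bump 0 1 (r^-1 *: (x - x0)).
Proof.
by apply: eq_bigr => i _; rewrite !mxE subr0 divr1 [r^-1 * _]mulrC.
Qed.

Lemma bump_ge0 x0 r x : 0 <= bump x0 r x.
Proof. by apply: prodr_ge0 => i _; rewrite !mulr_ge0 ?expR_ge0 ?flat_ge0. Qed.

Lemma bump_ge1 x0 r x : 0 < r -> `|x - x0| <= r -> 1 <= bump x0 r x.
Proof.
move=> r0 xr; rewrite /bump.
have low w : 1 <= w -> expR (- 1) <= flat 0 w :> R.
  move=> w1; rewrite flat_pos ?(lt_le_trans _ w1)// expr0 mul1r ler_expR lerN2.
  by rewrite invf_le1// (lt_le_trans _ w1).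
apply: (@le_trans _ _ (\prod_(i < n) 1)); first by rewrite big1.
apply: ler_prod => i _; rewrite ler01/=.
have : `|(x ord0 i - x0 ord0 i) / r| <= 1.
  rewrite normrM normfV (gtr0_norm r0) ler_pdivrMr// mul1r (le_trans _ xr)//.
  by have := rV_coord_le (x - x0) i; rewrite !mxE.
rewrite ler_norml => /andP[u1 u2].
have e0 : 0 <= expR (- 1) :> R by exact: expR_ge0.
apply: (@le_trans _ _ (expR 2 * (expR (- 1) * expR (- 1)))).
  by rewrite -!expRD (_ : 2 + (-1 + -1) = 0 :> R) ?expR0//; ring.
apply: ler_wpM2l; first exact: expR_ge0.
by apply: ler_pM => //; apply: low; lra.
Qed.

Lemma bump_eq0 x0 r x : 0 < r -> 2 * r <= `|x - x0| -> bump x0 r x = 0.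
Proof.
move=> r0 xr.
have [i hi] : exists i, 2 * r <= `|x ord0 i - x0 ord0 i|.
  apply: contrapT => /forallNP h; move: xr; rewrite leNgt => /negP; apply.
  apply: rV_norm_lt => [|i]; first by rewrite mulr_gt0.
  by rewrite !mxE ltNge; apply/negP; exact: h.
rewrite /bump (bigD1 i)//=.
set u := _ - _ in hi *.
have [u0|u0] := leP 0 u.
  have h : 2 - u / r <= 0 by rewrite subr_le0 ler_pdivlMr// (le_trans hi)// ger0_norm.
  by rewrite (flat_neg 0 h) mul0r mulr0 mul0r.
have h : 2 + u / r <= 0.
  have : 2 <= - u / r by rewrite ler_pdivlMr// -(ltr0_norm u0).
  by rewrite mulNr; lra.
by rewrite (flat_neg 0 h) !mulr0 mul0r.
Qed.

Lemma Cc_smooth_bump x0 r : 0 < r -> Cc_smooth (bump x0 r).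
Proof.
move=> r0; split=> [k|]; first by apply: flat_alg_Ck; exact: flat_alg_bump.
pose A : set 'rV[R]_n := [set x | `|x - x0| <= 2 * r].
have cA : closed A.
  rewrite (_ : A = (fun x : 'rV[R]_n => `|x - x0|) @^-1` [set u | u <= 2 * r])//.
  apply: closed_comp => [x _|]; last exact: closed_le.
  have c1 : (fun y : 'rV[R]_n => y - x0) y @[y --> x] --> x - x0.
    exact: (cvgB cvg_id (cvg_cst x0)).
  exact: (cvg_norm c1).
have sA : closure [set x | bump x0 r x != 0] `<=` A.
  rewrite [X in _ `<=` X](closure_id _).1//; apply: closure_subset => x /= /eqP nz.
  by rewrite /A/= leNgt; apply/negP => /ltW /(bump_eq0 r0).
apply: bounded_closed_compact; last exact: closed_closure.
exists (`|x0| + 2 * r); split; first exact: num_real.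
move=> M hM x /sA; rewrite /A/= => xA; rewrite -(subrK x0 x).
by rewrite (le_trans (ler_normD _ _))//; lra.
Qed.

Lemma fdiff_iter_scale k (f : 'rV[R]_n -> R) (x0 h : 'rV[R]_n) (c : R) x :
  iter k (fdiff h) (fun x => f (c *: (x - x0))) x = iter k (fdiff (c *: h)) f (c *: (x - x0)).
Proof.
elim: k x => [//|k ih] x; rewrite !iterS /fdiff -/(fdiff h) -/(fdiff (c *: h)) !ih.
by rewrite addrAC scalerDr.
Qed.

Lemma fdiff_iter_le k (f : 'rV[R]_n -> R) (M : R) h x : (forall x, `|f x| <= M) ->
  `|iter k (fdiff h) f x| <= 2 ^+ k * M.
Proof.
move=> fM; elim: k x => [|k ih] x; first by rewrite expr0 mul1r.
rewrite iterS /fdiff -/(fdiff h) (le_trans (ler_normB _ _))// exprS -mulrA mulr2n mulrDl mul1r.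
by apply: lerD; exact: ih.
Qed.

Lemma fdiff_iter_support k (f : 'rV[R]_n -> R) h x :
  (forall i, (i <= k)%N -> f (x + i%:R *: h) = 0) -> iter k (fdiff h) f x = 0.
Proof.
elim: k x => [|k ih] x hx; first by have := hx 0%N isT; rewrite scale0r addr0.
rewrite iterS /fdiff -/(fdiff h) (ih x) => [|i ik]; last by apply: hx; exact: leqW.
rewrite (ih (x + h)) ?subrr// => i ik.
by rewrite -addrA -[X in X + _ *: h]scale1r -scalerDl nat1r; apply: hx.
Qed.

Local Open Scope ereal_scope.

(** The difference at [x] vanishes unless one of [x, x + h, ..., x + k h] lies in the support ball,
    so it lives on [k + 1] translates of that ball. *)
Lemma besov_energy_le k (p r m : R) (x0 h : 'rV[R]_n) (f : 'rV[R]_n -> R) :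
  (0 < p)%R -> (0 < r)%R -> (0 <= m)%R ->
  (forall x, (r <= `|x - x0|)%R -> f x = 0%R) ->
  (forall x, `|iter k (fdiff h) f x| <= m)%R ->
  besov_energy k p f h <= (m `^ p * (k.+1%:R * (2 * r) ^+ n))%:E.
Proof.
move=> p0 r0 m0 fr fm; rewrite /besov_energy.
pose g (i : nat) (x : 'rV[R]_n) : \bar R := (m `^ p * \1_(nball (x0 - i%:R *: h) r) x)%:E.
have g0 i x : 0 <= g i x by rewrite lee_fin mulr_ge0 ?powR_ge0// indicE.
have mi i : measurable_fun setT (fun x : 'rV[R]_n => (\1_(nball (x0 - i%:R *: h) r) x)%:E : \bar R).
  by apply/measurable_EFinP; apply: measurable_indic; exact: measurable_nball.
have mg i : measurable_fun setT (g i).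
  by rewrite /g; under eq_fun do rewrite EFinM; exact: emeasurable_funM.
apply: (@le_trans _ _ (\int[L]_x \sum_(0 <= i < k.+1) g i x)).
  apply: le_nnint => x _; first by rewrite lee_fin powR_ge0.
  have [h0|] := pselect (forall i, (i <= k)%N -> f (x + i%:R *: h)%R = 0%R).
    rewrite (fdiff_iter_support h0) normr0 powR0 ?gt_eqF//.
    by apply: sume_ge0 => i _; exact: g0.
  move=> /existsNP[i /not_implyP[ik fi]].
  have xi : nball (x0 - i%:R *: h)%R r x.
    rewrite /nball/= opprB addrA ltNge; apply/negP => h1; exact: fi (fr _ h1).
  rewrite big_mkord (bigD1 (inord i : 'I_k.+1)) //= inordK//.
  apply: (@le_trans _ _ (g i x)); last by apply: leeDl; apply: sume_ge0 => j _; exact: g0.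
  rewrite /g indicE mem_set//= mulr1 lee_fin.
  by apply: ge0_ler_powR; rewrite ?nnegrE ?(ltW p0).
rewrite ge0_integral_sum//.
apply: (@le_trans _ _ (\sum_(0 <= i < k.+1) (m `^ p * (2 * r) ^+ n)%:E)).
  apply: lee_sum => i _; rewrite /g; under eq_integral do rewrite EFinM.
  rewrite ge0_integralZl//; last by rewrite lee_fin powR_ge0.
  rewrite EFinM; apply: lee_wpmul2l; first by rewrite lee_fin powR_ge0.
  rewrite integral_indic//; last exact: measurable_nball.
  by rewrite setIT; exact: (lebesgue_rV_ball_le _ (ltW r0)).
by rewrite sumEFin sumr_const_nat subn0 lee_fin [leRHS]mulrCA [leRHS]mulr_natl.
Qed.

End bump.

Section bump_norm.
Context {R : realType} {n : nat}.
Local Notation L := (@lebesgue_rV R n).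

Local Open Scope ereal_scope.

(** All bumps are rescalings of one function, hence the uniform constant. Steps [|h| >= r] use
    boundedness of the differences, steps [|h| < r] their size [(|h| / r) ^ k]. *)
Lemma besov_norm_bump_le (beta p : R) : (0 < n)%N -> (0 < beta)%R -> (0 < p)%R ->
  exists2 C : R, (0 <= C)%R & forall (x0 : 'rV[R]_n) (r : R), (0 < r)%R ->
    besov_norm beta p p (bump x0 r) `^ p <= (C * r `^ (n%:R - p * beta))%:E.
Proof.
move=> n0 b0 p0; pose k := (Num.truncn beta).+1; pose g : R := (n%:R + beta * p)%R.
have kb : (beta < k%:R)%R by exact: truncnS_gt.
have g0 : (0 <= g)%R by rewrite addr_ge0// mulr_ge0// ltW.
have [M0 M00 hM0] := flat_alg_bounded (@flat_alg_bump R n 0%R 1%R).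
have [M1 M10 hM1] := fdiff_iter_bound k (@flat_alg_bump R n 0%R 1%R).
pose A := Num.max (2 ^+ k * M0)%R M1.
have A0 : (0 <= A)%R by rewrite le_max M10 orbT.
have bE x0 r : bump x0 r = fun x : 'rV[R]_n => bump 0%R 1%R (r^-1 *: (x - x0))%R.
  by apply/funext => x; exact: bump_scale.
have hA1 x0 r h x : (`|iter k (fdiff h) (bump x0 r : 'rV[R]_n -> R) x| <= A)%R.
  rewrite bE fdiff_iter_scale; apply: le_trans (fdiff_iter_le k _ _ hM0) _.
  by rewrite le_max lexx.
have hA2 x0 r h x : (0 < r)%R ->
    (`|iter k (fdiff h) (bump x0 r : 'rV[R]_n -> R) x| <= A * (`|h| / r) ^+ k)%R.
  move=> r0; rewrite bE fdiff_iter_scale; apply: (le_trans (hM1 _ _)).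
  rewrite normrZ normfV (gtr0_norm r0) [(r^-1 * _)%R]mulrC; apply: ler_wpM2r.
    by rewrite exprn_ge0// divr_ge0// ltW.
  by rewrite le_max lexx orbT.
pose D (r : R) : R := (A `^ p * (k.+1%:R * (2 * (2 * r)) ^+ n))%R.
have D0 r : (0 < r)%R -> (0 <= D r)%R.
  by move=> r0; rewrite !mulr_ge0 ?powR_ge0 ?exprn_ge0// !mulr_ge0// ltW.
have E1 x0 r h : (0 < r)%R -> besov_energy k p (bump x0 r : 'rV[R]_n -> R) h <= (D r)%:E.
  move=> r0; apply: (@besov_energy_le _ _ _ _ _ _ x0) => //; first by rewrite mulr_gt0.
  by move=> x; exact: bump_eq0.
have E2 x0 r h : (0 < r)%R -> besov_energy k p (bump x0 r : 'rV[R]_n -> R) h <=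
    (D r * ((`|h| / r) `^ p) ^+ k)%:E.
  move=> r0; have u0 : (0 <= `|h| / r)%R by rewrite divr_ge0// ltW.
  have -> : (D r * ((`|h| / r) `^ p) ^+ k =
      (A * (`|h| / r) ^+ k) `^ p * (k.+1%:R * (2 * (2 * r)) ^+ n))%R.
    by rewrite (powRM p A0 (exprn_ge0 k u0)) (powR_exprC p k u0) /D mulrAC.
  apply: (@besov_energy_le _ _ _ _ _ _ x0) => //; first by rewrite mulr_gt0.
  - by rewrite mulr_ge0// exprn_ge0.
  - by move=> x; exact: bump_eq0.
  - by move=> x; exact: hA2.
pose z1 : R := (2 `^ (- g))%R; pose z2 : R := (2 `^ (g - k%:R * p))%R.
have z10 : (0 <= z1)%R by exact: powR_ge0.
have z20 : (0 <= z2)%R by exact: powR_ge0.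
(* Far shells [|h| ~ 2 ^ m r]: the weight [2 ^ (- g)] against the volume [2 ^ n] leaves the ratio
   [2 ^ (- beta p)]. *)
have c1 : (z1 * 2 ^+ n < 1)%R.
  rewrite /z1 -(powR_mulrn n (ler0n R 2)) -powRD ?pnatr_eq0 ?implybT//.
  rewrite (_ : - g + n%:R = - (beta * p))%R; last by rewrite /g; ring.
  by apply: powR2_lt1; rewrite mulr_gt0.
(* Near shells [|h| ~ 2 ^ (- m) r]: the ratio is [2 ^ (- (k - beta) p)], convergent because the
   order [k] exceeds [beta]. *)
have c2 : (z2 * 2^-1 ^+ n < 1)%R.
  rewrite exprVn -(powR_mulrn n (ler0n R 2)) -powRN /z2 -powRD ?pnatr_eq0 ?implybT//.
  rewrite (_ : g - k%:R * p + - n%:R = - ((k%:R - beta) * p))%R; last by rewrite /g; ring.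
  by apply: powR2_lt1; rewrite mulr_gt0// subr_gt0.
pose C0 : R := (4 ^+ n / (1 - z1 * 2 ^+ n) + 2 `^ g * 4 ^+ n / (1 - z2 * 2^-1 ^+ n))%R.
exists (A `^ p * (k.+1%:R * 4 ^+ n) * C0)%R => [|x0 r r0].
  have C00 : (0 <= C0)%R.
    have f0 : (0 <= 4 ^+ n :> R)%R by exact: exprn_ge0.
    have d1 : (0 <= 1 - z1 * 2 ^+ n)%R by rewrite subr_ge0 ltW.
    have d2 : (0 <= 1 - z2 * 2^-1 ^+ n)%R by rewrite subr_ge0 ltW.
    exact: (addr_ge0 (divr_ge0 f0 d1) (divr_ge0 (mulr_ge0 (powR_ge0 _ _) f0) d2)).
  apply: mulr_ge0 => //; apply: mulr_ge0; first exact: powR_ge0.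
  by apply: mulr_ge0 => //; exact: exprn_ge0.
have rD0 := D0 r r0.
rewrite besov_normE ?gt_eqF// -/k -/g.
set f := fun h => besov_energy k p (bump x0 r) h * (enorm h `^ (- g))%:E.
have f0 h : 0 <= f h by rewrite mule_ge0 ?besov_energy_ge0// lee_fin powR_ge0.
have mf : measurable_fun setT f.
  apply: emeasurable_funM.
    by apply: measurable_besov_energy; apply: Cc_smooth_measurable; exact: Cc_smooth_bump.
  apply/measurable_EFinP.
  exact: (measurableT_comp (measurable_powR (- g)%R) (@measurable_enorm R n)).
have wle (h : 'rV[R]_n) : h != 0%R -> (enorm h `^ (- g) <= `|h| `^ (- g))%R.
  by move=> h0; apply: le_powRN => //; [rewrite normr_gt0|exact: norm_le_enorm].
have mB (d : R) : measurable (nball 0%R d : set 'rV[R]_n) by exact: measurable_nball.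
have LB (y : R) m : (0 <= y)%R ->
    L (nball 0%R (2 * r * y ^+ m)) <= ((2 * (2 * r)) ^+ n * (y ^+ n) ^+ m)%:E.
  move=> y0; have d0 : (0 <= 2 * r * y ^+ m)%R by rewrite !mulr_ge0 ?exprn_ge0// ltW.
  apply: (le_trans (lebesgue_rV_ball_le 0%R d0)).
  by rewrite lee_fin mulrA exprMn -!exprM [(m * n)%N]mulnC.
have DR a : (0 <= a)%R -> (0 <= D r * a)%R by exact: mulr_ge0.
have b40 : (0 <= (2 * (2 * r)) ^+ n)%R by rewrite exprn_ge0// !mulr_ge0// ltW.
have i20 : (0 <= 2^-1 :> R)%R by rewrite invr_ge0.
have far : \int[L]_(h in ~` nball 0%R r) f h <=
    (D r * (r `^ (- g)) * (2 * (2 * r)) ^+ n / (1 - z1 * 2 ^+ n))%:E.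
  apply: (integral_shells_le (E := fun m => nball 0%R (2 * r * 2 ^+ m)%R)) => // [|m|h].
  - by apply: DR; exact: powR_ge0.
  - exact: LB.
  rewrite /nball/= subr0 => /negP; rewrite -leNgt => hr.
  have nh : (0 < `|h|)%R by exact: lt_le_trans hr.
  have [m /andP[m1 m2]] := dyadic_shell r0 hr.
  exists m; first by rewrite mulrAC -exprS.
  rewrite -mulrA EFinM.
  apply: lee_pmul; [exact: besov_energy_ge0|by rewrite lee_fin powR_ge0|exact: E1|].
  have h0 : h != 0%R by rewrite -normr_gt0.
  rewrite lee_fin; apply: (le_trans (wle h h0)).
  have d0 : (0 < 2 ^+ m * r)%R by rewrite mulr_gt0// exprn_gt0.
  apply: (le_trans (le_powRN d0 m1 g0)).
  by rewrite (powRM (- g)%R (exprn_ge0 m (ler0n R 2)) (ltW r0)) (powR_exprC (- g)%R m (ler0n R 2)) mulrC.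
have near : \int[L]_(h in nball 0%R r) f h <=
    (D r * (2 `^ g * r `^ (- g)) * (2 * (2 * r)) ^+ n / (1 - z2 * 2^-1 ^+ n))%:E.
  apply: (integral_shells_le (E := fun m => nball 0%R (2 * r * 2^-1 ^+ m)%R)) => // [|m|h].
  - by apply: DR; rewrite mulr_ge0 ?powR_ge0.
  - exact: LB.
  rewrite /nball/= subr0 => hr.
  have [->|h0] := eqVneq h 0%R.
    exists 0%N; first by rewrite normr0 !mulr_gt0.
    rewrite /f (_ : besov_energy k p (bump x0 r) 0%R = 0).
      by rewrite mul0e lee_fin mulr1; apply: DR; rewrite mulr_ge0 ?powR_ge0.
    rewrite /besov_energy integral0_eq// => x _.
    by rewrite /k iterS {1}/fdiff addr0 subrr normr0 powR0// gt_eqF.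
  have nh : (0 < `|h|)%R by rewrite normr_gt0.
  have [m /andP[m1 m2]] := dyadic_shell nh (ltW hr); exists m.
    rewrite exprVn ltr_pdivlMr ?exprn_gt0// mulrC.
    by rewrite (le_lt_trans m1)// mulr2n mulrDl mul1r ltrDl.
  apply: (@le_trans _ _ ((D r * ((`|h| / r) `^ p) ^+ k)%:E * (`|h| `^ (- g))%:E)).
    apply: lee_pmul; [exact: besov_energy_ge0|by rewrite lee_fin powR_ge0|exact: E2|].
    by rewrite lee_fin wle.
  rewrite -EFinM lee_fin -!(mulrA (D r)); apply: ler_wpM2l => //.
  have hm : (`|h| / r <= 2^-1 ^+ m)%R.
    by rewrite ler_pdivrMr// exprVn mulrC ler_pdivlMr ?exprn_gt0// mulrC.
  have u0 : (0 <= `|h| / r)%R by rewrite divr_ge0// ltW.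
  have v0 : (0 < 2^-1 ^+ m.+1 * r)%R by rewrite mulr_gt0// exprn_gt0// invr_gt0.
  have hv : (2^-1 ^+ m.+1 * r <= `|h|)%R.
    by rewrite exprVn mulrC ler_pdivrMr ?exprn_gt0// mulrC ltW.
  apply: (@le_trans _ _ (((2^-1 ^+ m) `^ p) ^+ k * (2^-1 ^+ m.+1 * r) `^ (- g))%R).
    apply: ler_pM; rewrite ?exprn_ge0 ?powR_ge0//; last exact: le_powRN.
    apply: lerXn2r; rewrite ?nnegrE ?powR_ge0//.
    by apply: ge0_ler_powR; rewrite ?nnegrE ?(ltW p0) ?exprn_ge0.
  rewrite le_eqVlt; apply/orP; left; apply/eqP.
  rewrite (powRM (- g)%R (exprn_ge0 m.+1 i20) (ltW r0)) mulrA [RHS]mulrAC; congr (_ * _)%R.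
  have half j (e : R) : ((2^-1 ^+ j) `^ e = 2 `^ (- (j%:R * e)) :> R)%R.
    by rewrite exprVn -(powR_mulrn j (ler0n R 2)) -powRN -powRrM mulNr.
  rewrite !half /z2 -(powR_mulrn k (powR_ge0 2 (- (m%:R * p)))).
  rewrite -(powR_mulrn m (powR_ge0 2 (g - k%:R * p))) -!powRrM -!powRD ?pnatr_eq0 ?implybT//.
  by congr powR; rewrite -natr1; ring.
have mC : measurable (~` nball 0%R r : set 'rV[R]_n) by exact: measurableC.
rewrite -(setUv (nball 0%R r)) ge0_integral_setU//; last 3 first.
- by rewrite setUv.
- by move=> h _; exact: f0.
- by rewrite disj_set2E setICr.
apply: (le_trans (leeD near far)); rewrite -EFinD lee_fin /D /C0.
have -> : (2 * (2 * r) = 4 * r)%R by ring.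
(* One [r ^ n] comes from the support, another from the volume of the shells, and [r ^ (- g)] from
   the weight. *)
have -> : (n%:R - p * beta = - g + n%:R + n%:R)%R by rewrite /g; ring.
have rD (a b : R) : (r `^ (a + b) = r `^ a * r `^ b)%R.
  by apply: powRD; rewrite (gt_eqF r0) implybT.
rewrite (rD (- g + n%:R)%R) (rD (- g)%R) (powR_mulrn n (ltW r0)).
rewrite (_ : ((4 * r) ^+ n = 4 ^+ n * r ^+ n)%R); last exact: exprMn.
rewrite le_eqVlt; apply/orP; left; apply/eqP.
move: (A `^ p)%R (r `^ _)%R (2 `^ g)%R (1 - _)%R^-1%R (1 - _)%R^-1%R (4 ^+ n)%R (r ^+ n)%R => *.
by ring.
Qed.

Lemma besov_cap_ball_le (beta p : R) : (0 < n)%N -> (0 < beta)%R -> (0 < p)%R ->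
  exists2 C : R, (0 <= C)%R & forall (x0 : 'rV[R]_n) (r : R), (0 < r)%R ->
    besov_cap beta p p (eball x0 r) <= (C * r `^ (n%:R - p * beta))%:E.
Proof.
move=> n0 b0 p0; have [C C0 hC] := besov_norm_bump_le n0 b0 p0.
exists C => // x0 r r0; apply: le_trans (hC x0 r r0).
apply: (@le_trans _ _ (ereal_sup [set besov_cap_compact beta p p K |
    K in [set K | compact K /\ K `<=` eball x0 r]])).
  by apply: ereal_inf_lbound; exists (eball x0 r) => //; split=> //; exact: open_eball.
apply: ge_ereal_sup => _ [K [_ KO] <-]; apply: ereal_inf_lbound.
exists (bump x0 r) => //; split; first exact: Cc_smooth_bump.
move=> x; rewrite indicE; have [Kx|Kx] := pselect (K x); last first.
  by rewrite memNset// bump_ge0.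
rewrite mem_set//; apply: bump_ge1 => //.
by rewrite (le_trans (norm_le_enorm _))// ltW//; exact: KO.
Qed.

Lemma ball_growth_of_open (mu : {measure set ('rV[R]_n * R) -> \bar R}) (beta p th : R) :
  (0 < n)%N -> (0 < beta)%R -> (0 < p)%R ->
  (exists C : R, forall O : set 'rV[R]_n, open O ->
    mu (tent O) `^ th <= C%:E * besov_cap beta p p O) ->
  exists C : R, forall (x : 'rV[R]_n) (r : R), (0 < r)%R ->
    mu (tent (eball x r)) `^ th <= (C * r `^ (n%:R - p * beta))%:E.
Proof.
move=> n0 b0 p0 [A hA]; have [C C0 hC] := besov_cap_ball_le n0 b0 p0.
exists (`|A| * C)%R => x r r0; have oB : open (eball x r) by exact: open_eball.
apply: (le_trans (hA _ oB)).
have cap0 : 0 <= besov_cap beta p p (eball x r) by exact: besov_cap_ge0.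
apply: (@le_trans _ _ (`|A|%:E * besov_cap beta p p (eball x r))).
  by apply: lee_wpmul2r => //; rewrite lee_fin ler_norm.
by rewrite -mulrA EFinM; apply: lee_wpmul2l; [rewrite lee_fin|exact: hC].
Qed.

End bump_norm.

(** * Positivity of the Poisson constant *)

Section gamma.
Context {R : realType}.
Local Open Scope ereal_scope.

Let gamma_density (a t : R) : R := (t `^ (a - 1) * expR (- t))%R.

Let gamma_density_ge0 a t : (0 <= gamma_density a t)%R.
Proof. by rewrite mulr_ge0 ?powR_ge0 ?expR_ge0. Qed.

(* Dyadic majorant: near infinity [t ^ N * exp (- t) <= N!] with [N > a] beats the power. *)
Lemma gamma_integral_lt_pinfty (a : R) : (0 < a)%R ->
  \int[lebesgue_measure]_(t in `]0%R, +oo[) (gamma_density a t)%:E < +oo.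
Proof.
move=> a0; pose N := (Num.truncn a).+1.
have aN : (a < N%:R)%R by exact: truncnS_gt.
pose I (d : R) : set R := `]0%R, d]%classic.
have mI d : measurable (I d) by exact: measurable_itv.
have LI d : (0 <= d)%R -> lebesgue_measure (I d) <= d%:E.
  by move=> d0; rewrite lebesgue_measure_itv/=; case: ifP => _; rewrite ?sube0 ?lee_fin.
pose z1 : R := (2 `^ (a - 1 - N%:R))%R; pose z2 : R := (2 `^ (1 - a))%R.
pose c1 : R := (2 `^ a * N`!%:R)%R.
have c10 : (0 <= c1)%R by rewrite mulr_ge0 ?powR_ge0.
have z10 : (0 <= z1)%R by exact: powR_ge0.
have z20 : (0 <= z2)%R by exact: powR_ge0.
have e1 : (z1 * 2 < 1)%R.
  rewrite /z1 -[X in (_ * X)%R](powRr1 (ler0n R 2)) -powRD ?pnatr_eq0 ?implybT//.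
  rewrite (_ : a - 1 - N%:R + 1 = - (N%:R - a))%R; last by ring.
  by apply: powR2_lt1; rewrite subr_gt0.
have e2 : (z2 * 2^-1 < 1)%R.
  rewrite /z2 -(powR_inv1 (ler0n R 2)) -powRD ?pnatr_eq0 ?implybT//.
  by rewrite (_ : 1 - a + -1 = - a)%R; [exact: powR2_lt1|ring].
have two0 : (0 <= 2 :> R)%R by [].
have half0 : (0 <= 2^-1 :> R)%R by rewrite invr_ge0.
have md : measurable_fun setT (fun t : R => (gamma_density a t)%:E).
  apply/measurable_EFinP; apply: measurable_funM; first exact: measurable_powR.
  by apply: measurableT_comp => //; exact: measurable_expR.
have dE (t : R) : (0 < t)%R -> (gamma_density a t = t `^ a * t^-1 * expR (- t))%R.
  move=> t0; rewrite /gamma_density.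
  by rewrite powRB ?(gt_eqF t0) ?implybT// powRr1// ltW.
have J1 : \int[lebesgue_measure]_(t in `]0%R, 1%R[) (gamma_density a t)%:E <=
    (2 * 2 / (1 - z2 * 2^-1))%:E.
  apply: (@integral_shells_le R _ _ (@lebesgue_measure R) _ _ (fun m => I (2 * 2^-1 ^+ m)%R) 2%R z2 2%R 2^-1%R) => // [m|m|t|t].
  - exact: mI.
  - by apply: LI; rewrite mulr_ge0// exprn_ge0.
  - by rewrite lee_fin.
  rewrite /= in_itv/= => /andP[t0 h]; have [m /andP[m1 m2]] := dyadic_shell t0 (ltW h).
  exists m.
    by rewrite /I/= in_itv/= t0 exprVn ler_pdivlMr ?exprn_gt0// mulrC (le_trans m1)// ler1n.
  rewrite lee_fin dE//.
  have q0 : (0 <= 2^-1 ^+ m :> R)%R by exact: exprn_ge0.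
  have ex : (expR (- t) <= 1)%R by rewrite expR_le1 oppr_le0 ltW.
  have ta : (t `^ a <= (2^-1 ^+ m) `^ a)%R.
    apply: ge0_ler_powR; rewrite ?nnegrE ?(ltW a0) ?(ltW t0)//.
    by rewrite exprVn -[leRHS]mul1r ler_pdivlMr ?exprn_gt0// mulrC.
  have ti : (t^-1 <= 2 ^+ m.+1)%R by rewrite -[leLHS]mul1r ler_pdivrMr// ltW.
  apply: (@le_trans _ _ ((2^-1 ^+ m) `^ a * 2 ^+ m.+1 * 1)%R).
    apply: ler_pM; rewrite ?expR_ge0 ?mulr_ge0 ?powR_ge0 ?invr_ge0 ?(ltW t0)//.
    by apply: ler_pM; rewrite ?powR_ge0 ?invr_ge0 ?(ltW t0).
  rewrite mulr1 (powR_exprC a m half0).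
  have -> : z2 = (2 * 2^-1 `^ a)%R.
    rewrite /z2 -(powR_inv1 two0) -powRrM -[X in (X * _)%R](powRr1 two0) -powRD ?pnatr_eq0 ?implybT//.
    by congr powR; ring.
  by rewrite exprMn exprS [leLHS]mulrC -[leLHS]mulrA.
have J2 : \int[lebesgue_measure]_(t in `[1%R, +oo[) (gamma_density a t)%:E <=
    (c1 * 2 / (1 - z1 * 2))%:E.
  apply: (@integral_shells_le R _ _ (@lebesgue_measure R) _ _ (fun m => I (2 * 2 ^+ m)%R) c1 z1 2%R 2%R) => // [m|m|t|t].
  - exact: mI.
  - by apply: LI; rewrite mulr_ge0// exprn_ge0.
  - by rewrite lee_fin.
  rewrite /= in_itv/= andbT => h; have t0 : (0 < t)%R by lra.
  have [m /andP[m1 m2]] := dyadic_shell ltr01 h; rewrite !mulr1 in m1 m2.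
  exists m; first by rewrite /I/= in_itv/= t0 -exprS ltW.
  rewrite lee_fin dE//.
  have q0 : (0 <= 2 ^+ m :> R)%R by exact: exprn_ge0.
  have ep : (expR (- t) <= N`!%:R * 2^-1 ^+ (m * N))%R.
    have := @flat_le R N t^-1; rewrite flat_pos ?invr_gt0// invrK.
    rewrite mulrC -ler_pdivlMr ?exprn_gt0// => /le_trans; apply.
    apply: ler_wpM2l => //; rewrite exprVn lef_pV2 ?posrE ?exprn_gt0// exprM.
    by apply: lerXn2r; rewrite ?nnegrE// ltW.
  have ti : (t^-1 <= 2^-1 ^+ m)%R by rewrite exprVn lef_pV2 ?posrE ?exprn_gt0.
  have ta : (t `^ a <= (2 ^+ m.+1) `^ a)%R.
    by apply: ge0_ler_powR; rewrite ?nnegrE ?(ltW a0) ?(ltW t0) ?exprn_ge0 ?(ltW m2).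
  apply: (@le_trans _ _ ((2 ^+ m.+1) `^ a * 2^-1 ^+ m * (N`!%:R * 2^-1 ^+ (m * N)))%R).
    apply: ler_pM; rewrite ?expR_ge0 ?mulr_ge0 ?powR_ge0 ?invr_ge0 ?(ltW t0)//.
    by apply: ler_pM; rewrite ?powR_ge0 ?invr_ge0 ?(ltW t0).
  rewrite exprS (powRM a two0 q0) (powR_exprC a m two0).
  have -> : (z1 ^+ m = (2 `^ a) ^+ m * 2^-1 ^+ m * 2^-1 ^+ (m * N))%R.
    have -> : z1 = (2 `^ a * 2^-1 * 2^-1 ^+ N)%R.
      rewrite /z1 exprVn -(powR_mulrn N two0) -powRN -(powR_inv1 two0) -!powRD ?pnatr_eq0 ?implybT//.
    by rewrite !exprMn -exprM [(N * m)%N]mulnC.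
  rewrite /c1 le_eqVlt; apply/orP; left; apply/eqP.
  set u := (2^-1 ^+ m)%R; set v := (2^-1 ^+ _)%R; set w := ((2 `^ a) ^+ m)%R.
  by clearbody u v w; ring.
rewrite (_ : `]0%R, +oo[%classic = `]0%R, 1%R[%classic `|` `[1%R, +oo[%classic); last first.
  apply/seteqP; split => t /=; rewrite !in_itv/= !andbT; last by case=> [/andP[]//|]; lra.
  by move=> t0; have [t1|t1] := ltP t 1%R; [left; rewrite t0|right].
rewrite ge0_integral_setU//; last 3 first.
- exact: measurable_funS md.
- by move=> t _; rewrite lee_fin.
- rewrite disj_set2E; apply/eqP; apply/seteqP; split => // t [/=]; rewrite !in_itv/= andbT.
  by move=> /andP[_ t1]; rewrite leNgt t1.
by apply: lte_add_pinfty; [exact: le_lt_trans J1 (ltry _)|exact: le_lt_trans J2 (ltry _)].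
Qed.

(** An infinite integral would be read as the real number [0], so finiteness comes first. The lower
    bound uses []1, 2]], where [t ^ (a - 1) >= 1 / t >= 1 / 2]. *)
Lemma Gamma_gt0 (a : R) : (0 < a)%R -> (0 < Gamma a)%R.
Proof.
move=> a0; rewrite /Gamma /Rintegral.
have fin := gamma_integral_lt_pinfty a0.
apply: fine_gt0; rewrite fin andbT.
pose J : set R := `]1%R, 2%R]%classic.
have mJ : measurable J by exact: measurable_itv.
pose c : R := (2^-1 * expR (- 2))%R.
have c0 : (0 < c)%R by rewrite mulr_gt0 ?expR_gt0// invr_gt0.
apply: (@lt_le_trans _ _ (\int[lebesgue_measure]_(t in J) (cst c%:E t))).
  have LJ : lebesgue_measure J = 1.
    rewrite /J lebesgue_measure_itv/= lte_fin ltr1n/= -EFinB.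
    by congr EFin; ring.
  have -> : \int[lebesgue_measure]_(t in J) (cst c%:E t) = c%:E * 1.
    by rewrite (integral_cst (@lebesgue_measure R) mJ); congr (_ * _); exact: LJ.
  by rewrite mule1 lte_fin.
apply: (@le_trans _ _ (\int[lebesgue_measure]_(t in J) (gamma_density a t)%:E)).
  apply: le_nnint => t; first by rewrite lee_fin ltW.
  rewrite /J/= in_itv/= => /andP[t1 t2]; rewrite lee_fin /gamma_density.
  have t0 : (0 < t)%R by lra.
  rewrite powRB ?(gt_eqF t0) ?implybT// powRr1 ?(ltW t0)//.
  apply: ler_pM; rewrite ?invr_ge0 ?expR_ge0 ?ler_expR ?lerN2//.
  apply: (@le_trans _ _ t^-1%R); first by rewrite lef_pV2 ?posrE.
  apply: ler_peMl; first by rewrite invr_ge0 ltW.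
  have : (1 `^ a <= t `^ a)%R by apply: ge0_ler_powR; rewrite ?nnegrE ?(ltW a0) ?(ltW t1) ?(ltW t0).
  by rewrite powR1.
apply: le_nnint_subset => [t _|t]; first by rewrite lee_fin.
by rewrite /J/= !in_itv/= andbT => /andP[t1 _]; lra.
Qed.

Lemma poisson_const_gt0 (n : nat) (s : R) : (0 < s)%R -> (0 < @poisson_const R n s)%R.
Proof.
move=> s0; have g1 : (0 < Gamma ((n%:R + s) / 2))%R.
  by apply: Gamma_gt0; apply: divr_gt0 => //; rewrite ltr_wpDl.
have g2 : (0 < Gamma (s / 2))%R by apply: Gamma_gt0; exact: divr_gt0.
by rewrite divr_gt0// mulr_gt0// powR_gt0// pi_gt0.
Qed.

End gamma.

(** * From the weak estimate to the capacitary condition *)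

Section exhaustion.
Context {R : realType} {n : nat} (mu : {measure set ('rV[R]_n * R) -> \bar R}).
Hypothesis n0 : (0 < n)%N.
Local Open Scope ereal_scope.

Let n0' : (0 < n%:R :> R)%R. Proof. by rewrite ltr0n. Qed.

(* A tent over [K] in the max norm; the factor [2 n] compares it with the Euclidean one. *)
Definition box_tent (K : set 'rV[R]_n) : set ('rV[R]_n * R) :=
  [set z | half_space z /\ nball z.1 ((2 * n%:R)^-1 * z.2) `<=` K].

Lemma measurable_box_tent K : measurable (box_tent K).
Proof.
rewrite (_ : box_tent K = half_space `\`
    [set z : 'rV[R]_n * R | exists2 y, (~` K) y & (`|y - z.1| < (2 * n%:R)^-1 * z.2)%R]).
  apply: measurableD; first exact: measurable_half_space.
  apply: open_rVR_measurable; apply: (open_near_set (nu := fun x : 'rV[R]_n => `|x|%R)).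
  exact: norm_continuous.
apply/seteqP; split => z [hz hK]; split => //.
  by move=> [y nK yz]; apply: nK; exact: hK.
by move=> y yz; apply: contrapT => nK; apply: hK; exists y.
Qed.

Definition inner_compact (O : set 'rV[R]_n) (j : nat) : set 'rV[R]_n :=
  [set y | (`|y| <= j%:R)%R /\ forall z, ~ O z -> (j.+1%:R^-1 <= `|y - z|)%R].

Lemma compact_inner O j : compact (inner_compact O j).
Proof.
apply: bounded_closed_compact.
  exists j%:R; split; first exact: num_real.
  by move=> M jM y [yj _] /=; rewrite (le_trans yj)// ltW.
rewrite (_ : inner_compact O j = [set y | (`|y| <= j%:R)%R] `&`
   \bigcap_(z in ~` O) [set y | (j.+1%:R^-1 <= `|y - z|)%R]); last first.
  by apply/seteqP; split => y [h1 h2].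
apply: closedI.
  rewrite (_ : mkset _ = (fun x : 'rV[R]_n => `|x|%R) @^-1` [set u | (u <= j%:R)%R])//.
  by apply: closed_comp => [x _|]; [exact: norm_continuous|exact: closed_le].
apply: closed_bigI => z _.
rewrite (_ : mkset _ = (fun x : 'rV[R]_n => `|x - z|%R) @^-1` [set u | (j.+1%:R^-1 <= u)%R])//.
apply: closed_comp => [x _|]; last exact: closed_ge.
have c1 : (fun y : 'rV[R]_n => y - z)%R y @[y --> x] --> (x - z)%R.
  exact: (cvgB cvg_id (cvg_cst z)).
exact: (cvg_norm c1).
Qed.

Lemma inner_compact_sub O j : inner_compact O j `<=` O.
Proof.
move=> y [_ hy]; apply: contrapT => /hy; rewrite subrr normr0 leNgt => /negP; apply.
by rewrite invr_gt0.
Qed.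

(** The narrower aperture leaves room: over a point of [tent O] at height [u], the max-norm ball of
    radius [v = u / (2 n)] stays at distance at least [v] from the complement of [O], hence inside
    some [inner_compact O j]. Continuity of [mu] from below then picks one [j]. *)
Lemma box_tent_exhaustion (O : set 'rV[R]_n) (t : R) : t%:E < mu (tent O) ->
  exists2 K, compact K /\ K `<=` O & t%:E < mu (box_tent K).
Proof.
move=> tO; pose A j := box_tent (inner_compact O j).
have mA j : measurable (A j) by exact: measurable_box_tent.
have ndA : nondecreasing_seq A.
  apply/nondecreasing_seqP => j; apply/subsetPset => z [hz hK]; split => // y /hK[h1 h2]; split.
    by rewrite (le_trans h1)// ler_nat.
  by move=> w /h2; apply: le_trans; rewrite lef_pV2 ?posrE// ler_nat.
have cover : tent O `<=` \bigcup_j A j.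
  move=> [x u] [/= u0 uO]; rewrite /half_space/= in u0.
  pose v := ((2 * n%:R)^-1 * u)%R.
  have v0 : (0 < v)%R by rewrite mulr_gt0// invr_gt0 mulr_gt0.
  have vE : (u = n%:R * (2 * v))%R by rewrite /v; field; rewrite gt_eqF.
  pose X := Num.max (`|x| + v)%R v^-1%R.
  have [X1 X2] : (`|x| + v <= X /\ v^-1 <= X)%R by rewrite !le_max !lexx orbT.
  exists (Num.truncn X).+1 => //; split => //= y yx; have XN := truncnS_gt X.
  rewrite /nball/= -/v in yx.
  have yN : (`|y| <= (Num.truncn X).+1%:R)%R.
    by have := ler_normD (y - x)%R x; rewrite subrK; lra.
  split => // z nz.
  apply: (@le_trans _ _ v).
    rewrite -[leRHS]invrK lef_pV2 ?posrE ?invr_gt0// (le_trans X2)// (le_trans (ltW XN))//.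
    by rewrite ler_nat.
  have zx : (u <= enorm (z - x))%R by rewrite leNgt; apply/negP => h; exact/nz/uO.
  have h2 : (2 * v <= `|z - x|)%R.
    by rewrite -(ler_pM2l n0') -vE (le_trans zx)// enorm_le_norm.
  have := ler_distD y z x; rewrite (distrC z y); lra.
apply: contrapT => h.
have le j : mu (A j) <= t%:E.
  rewrite leNgt; apply/negP => lt; apply: h; exists (inner_compact O j) => //.
  by split; [exact: compact_inner|exact: inner_compact_sub].
have cv := nondecreasing_cvg_mu (mu := mu) mA (bigcupT_measurable A mA) ndA.
have : mu (\bigcup_j A j) <= t%:E.
  by rewrite -(cvg_lim _ cv)//; apply: lime_le; [apply/cvg_ex; eexists; exact: cv|exact: nearW].
rewrite leNgt => /negP; apply; apply: (lt_le_trans tO).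
by apply: le_measure; rewrite ?inE//; [exact: measurable_tent|exact: bigcupT_measurable].
Qed.

End exhaustion.

Section weak_to_capacity.
Context {R : realType} {n : nat} (mu : {measure set ('rV[R]_n * R) -> \bar R}) (s : R).
Hypothesis n0 : (0 < n)%N.
Hypothesis s0 : 0 < s.
Local Notation L := (@lebesgue_rV R n).

Let n0' : 0 < n%:R :> R. Proof. by rewrite ltr0n. Qed.

Let pc0 : 0 <= @poisson_const R n s. Proof. exact/ltW/poisson_const_gt0. Qed.

(** Within Euclidean distance [t] the kernel is at least the first two factors times [t ^ (- n)]; a
    cube of side [t / (2 n)] has volume [t ^ n (2 n) ^ (- n)], and the powers of [t] cancel. *)
Definition extension_lb : R :=
  @poisson_const R n s * 2 `^ (- ((n%:R + s) / 2)) * (2 * n%:R)^-1 ^+ n.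

Lemma extension_lb_gt0 : 0 < extension_lb.
Proof.
apply: mulr_gt0; last by rewrite exprn_gt0// invr_gt0 mulr_gt0.
by apply: mulr_gt0; [exact: poisson_const_gt0|exact: powR_gt0].
Qed.

Lemma poisson_ge0 (t : R) (x : 'rV[R]_n) : 0 <= poisson_kernel s t x.
Proof. exact: (divr_ge0 (mulr_ge0 pc0 (powR_ge0 _ _)) (powR_ge0 _ _)). Qed.

Lemma poisson_near_ge (t : R) (x : 'rV[R]_n) : 0 < t -> enorm x <= t ->
  @poisson_const R n s * 2 `^ (- ((n%:R + s) / 2)) * t^-1 ^+ n <= poisson_kernel s t x.
Proof.
move=> t0 xt; rewrite /poisson_kernel; move: (poisson_const s) pc0 => pc hpc.
rewrite -!mulrA; apply: (ler_wpM2l hpc).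
set a := (n%:R + s) / 2.
have a0 : 0 <= a by rewrite divr_ge0// addr_ge0// ltW.
have t2 : 0 < t ^+ 2 by rewrite exprn_gt0.
have le2 : enorm x ^+ 2 + t ^+ 2 <= 2 * t ^+ 2.
  by rewrite mulr_natl mulr2n lerD2r lerXn2r// nnegrE ?(ltW t0) ?enorm_ge0.
have pos : 0 < enorm x ^+ 2 + t ^+ 2 by rewrite ltr_wpDl// sqr_ge0.
have key : (2 * t ^+ 2) `^ (- a) <= (enorm x ^+ 2 + t ^+ 2) `^ (- a) by exact: le_powRN.
rewrite -[X in _ <= _ * X]powRN.
apply: le_trans (ler_wpM2l (powR_ge0 _ _) key).
have two0 : 0 <= 2 :> R by [].
rewrite (powRM (- a) two0 (ltW t2)) mulrCA; apply: ler_wpM2l; first exact: powR_ge0.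
rewrite -(powR_mulrn 2 (ltW t0)) -powRrM -powRD ?(gt_eqF t0) ?implybT//.
have -> : s + 2 * - a = - n%:R by rewrite /a; field.
by rewrite powRN powR_mulrn ?(ltW t0)// exprVn.
Qed.

Lemma extension_ge (K : set 'rV[R]_n) (f : 'rV[R]_n -> R) (z : 'rV[R]_n * R) :
  Cc_smooth f -> (forall x, \1_K x <= f x) -> box_tent K z -> extension_lb <= cs_extension s f z.
Proof.
case: z => x t fcc fK [/= t0 hK]; rewrite /half_space/= in t0.
have mf := Cc_smooth_measurable fcc.
have f0 y : 0 <= f y by apply: le_trans (fK y); rewrite indicE.
have [B [_ [B0 _ fB _]]] := Cc_smooth_bounded fcc.
pose F y : \bar R := (poisson_kernel s t (x - y) * f y)%:E.
have F0 y : (0 <= F y)%E by rewrite lee_fin mulr_ge0// poisson_ge0.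
have mP : measurable_fun setT (fun y : 'rV[R]_n => (`|poisson_kernel s t (x - y)|)%:E : \bar R).
  apply/measurable_EFinP; apply: measurableT_comp => //.
  have mz : measurable_fun setT (fun y : 'rV[R]_n => ((x, t), y)) by exact: measurable_fun_pair.
  exact: (measurableT_comp (measurable_poisson s) mz).
(* The extension is a real-valued integral, so finiteness is needed to identify it with the extended
   integral that is bounded from below. *)
have fin : (\int[L]_y F y < +oo)%E.
  apply: (@le_lt_trans _ _ (\int[L]_y (B%:E * (`|poisson_kernel s t (x - y)|)%:E))%E).
    apply: le_nnint => y _; first exact: F0.
    rewrite -EFinM lee_fin mulrC (ger0_norm (poisson_ge0 _ _)); apply: ler_wpM2r.
      exact: poisson_ge0.
    by rewrite (le_trans (ler_norm _)).
  rewrite ge0_integralZl//; last by rewrite lee_fin ltW.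
  apply: (@le_lt_trans _ _ (B%:E * (@poisson_mass R n s)%:E)%E); last by rewrite -EFinM ltry.
  by apply: lee_wpmul2l; [rewrite lee_fin ltW|exact: integral_poisson_le].
have uE : (cs_extension s f (x, t))%:E = (\int[L]_y F y)%E.
  rewrite /cs_extension /Rintegral fineK// ge0_fin_numE//.
  by apply: integral_ge0 => y _; exact: F0.
rewrite -lee_fin uE; pose r := (2 * n%:R)^-1 * t.
have r0 : 0 < r by rewrite mulr_gt0// invr_gt0 mulr_gt0.
pose c := @poisson_const R n s * 2 `^ (- ((n%:R + s) / 2)) * t^-1 ^+ n.
apply: (@le_trans _ _ (\int[L]_(y in cube x r) (cst c%:E y))%E).
  have cm : L (cube x r) = (r ^+ n)%:E by exact: (cube_measure x (ltW r0)).
  have -> : (\int[L]_(y in cube x r) (cst c%:E y) = c%:E * (r ^+ n)%:E)%E.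
    by rewrite (integral_cst L (measurable_cube _ _)); congr (_ * _)%E; exact: cm.
  rewrite -EFinM lee_fin /extension_lb /c /r; move: (poisson_const s) => pc.
  have tn : t^-1 ^+ n * t ^+ n = 1 by rewrite exprVn mulVf// expf_neq0// gt_eqF.
  rewrite exprMn [X in _ <= _ * X]mulrC mulrA -(mulrA _ (t^-1 ^+ n)) tn mulr1.
  exact: lexx.
apply: (@le_trans _ _ (\int[L]_(y in cube x r) F y)%E); last first.
  by apply: le_nnint_subset => // y _; exact: F0.
have c0 : 0 <= c.
  apply: mulr_ge0; first exact: (mulr_ge0 pc0 (powR_ge0 _ _)).
  by rewrite exprn_ge0// invr_ge0 ltW.
apply: le_nnint => y yQ; first by rewrite lee_fin.
have yx : `|y - x| < r.
  by apply: (cube_dist r0 yQ) => i; rewrite lexx ltrDl.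
have fy : 1 <= f y by apply: le_trans (fK y); rewrite indicE mem_set//; exact: hK.
rewrite lee_fin -[leLHS]mulr1; apply: ler_pM => //; apply: poisson_near_ge => //.
rewrite (le_trans (enorm_le_norm _))// distrC -ler_pdivlMl// (le_trans (ltW yx))// /r.
by rewrite invfM -mulrA; apply: ler_piMl; [rewrite mulr_ge0 ?invr_ge0 ?(ltW t0)|lra].
Qed.

Local Open Scope ereal_scope.

(** Given an admissible open [U] and any open [V] around it, the exhaustion provides a compact [K]
    inside [U] with [mu (box_tent K) > t]. Each competitor for the capacity of [K] has its extension
    bounded below on [box_tent K], so the weak estimate limits [t]. *)
Lemma cap_min_of_weak (beta p q : R) : (0 < p)%R -> (0 < q)%R ->
  (exists C : R, forall f : 'rV[R]_n -> R, Cc_smooth f ->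
    weak_norm mu q (cs_extension s f) <= C%:E * besov_norm beta p p f) ->
  exists C : R, forall t : R, (0 < t)%R ->
    (t `^ (p / q))%:E <= C%:E * cap_min beta p p mu t.
Proof.
move=> p0 q0 [C0 hC0]; pose C : R := (`|C0| + 1)%R.
have C_gt0 : (0 < C)%R by rewrite ltr_wpDl.
have e0 := extension_lb_gt0; set e := extension_lb in e0.
pose D : R := ((C / (e / 2)) `^ p)%R.
have u0 : (0 < C / (e / 2))%R by rewrite !divr_gt0.
have D0 : (0 < D)%R by rewrite powR_gt0.
exists D => t t0.
rewrite -lee_pdivrMl//; apply: le_ereal_inf_tmp => _ [U [oU tU] <-].
apply: le_ereal_inf_tmp => _ [V [oV UV] <-].
have [K [cK KU] tK] := box_tent_exhaustion n0 tU.
apply: (@le_trans _ _ (besov_cap_compact beta p p K)); last first.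
  by apply: ereal_sup_ubound; exists K => //; split=> //; exact: subset_trans UV.
apply: le_ereal_inf_tmp => _ [f [fcc fK] <-].
rewrite lee_pdivrMl//.
have mu' := measurable_cs_extension s (Cc_smooth_measurable fcc).
have B0 := besov_norm_ge0 beta p p f.
have e20 : (0 < e / 2)%R by rewrite divr_gt0.
have h1 : (e / 2)%:E * t%:E `^ q^-1 <= C%:E * besov_norm beta p p f.
  apply: (@le_trans _ _ (C0%:E * besov_norm beta p p f)); last first.
    apply: lee_wpmul2r => //; rewrite lee_fin /C (le_trans (ler_norm _))// lerDl//.
  apply: le_trans (hC0 f fcc).
  (* Level sets are strict while the lower bound is [e <= u], so the level [e / 2] is used. *)
  apply: (@le_trans _ _ ((e / 2)%:E * mu (level_set (cs_extension s f) (e / 2)%R) `^ q^-1)).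
    apply: lee_wpmul2l; first by rewrite lee_fin ltW.
    apply: le_poweR; [by rewrite invr_ge0 ltW|by rewrite lee_fin ltW|].
    apply: (le_trans (ltW tK)); apply: le_measure; rewrite ?inE.
    - exact: measurable_box_tent.
    - exact: measurable_level_set.
    move=> z Kz; split; first by case: Kz.
    have := extension_ge fcc fK Kz; rewrite -/e => ez.
    by rewrite /= (lt_le_trans _ (ler_norm _))// (lt_le_trans _ ez)//; lra.
  by apply: ereal_sup_ubound; exists (e / 2)%R.
have h2 : (t `^ q^-1)%:E <= (C / (e / 2))%:E * besov_norm beta p p f.
  move: h1; rewrite poweR_EFin -lee_pdivlMl// muleA -EFinM => /le_trans; apply.
  by rewrite mulrC.
have tq0 : 0 <= (t `^ q^-1)%:E by rewrite lee_fin powR_ge0.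
have := le_poweR (ltW p0) tq0 h2.
rewrite poweR_EFin -powRrM mulrC poweRM ?lee_fin ?(ltW u0)// poweR_EFin.
Qed.

End weak_to_capacity.

(** * The cycle of six implications *)

Unset Implicit Arguments.
Set Strict Implicit.
Set Printing Implicit Defensive.

Theorem theorem4p1 (R : realType) (n : nat) (s beta p q0 : R)
  (mu : {measure set ('rV[R]_n * R) -> \bar R}) :
  (1 <= n)%N -> 0 < s < 2 ->
  (p = 1 /\ 0 < beta < n%:R) \/
  (0 < beta < 1 /\ n%:R / (n%:R + beta) < p < 1) ->
  p <= q0 ->
  half_space_radon mu ->
  [<->
    exists C : R, forall f : 'rV[R]_n -> R, Cc_smooth f ->
      (lorentz_norm mu q0 p (cs_extension s f) <= C%:E * besov_norm beta p p f)%E;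
    exists C : R, forall f : 'rV[R]_n -> R, Cc_smooth f ->
      (lebesgue_norm mu q0 (cs_extension s f) <= C%:E * besov_norm beta p p f)%E;
    exists C : R, forall f : 'rV[R]_n -> R, Cc_smooth f ->
      (weak_norm mu q0 (cs_extension s f) <= C%:E * besov_norm beta p p f)%E;
    exists C : R, forall t : R, 0 < t ->
      ((t `^ (p / q0))%:E <= C%:E * cap_min beta p p mu t)%E;
    exists C : R, forall O : set 'rV[R]_n, open O ->
      (mu (tent O) `^ (p / q0) <= C%:E * besov_cap beta p p O)%E;
    exists C : R, forall (x : 'rV[R]_n) (r : R), 0 < r ->
      (mu (tent (eball x r)) `^ (p / q0) <= (C * r `^ (n%:R - p * beta))%:E)%E
  ].
Proof.
move=> n0 /andP[s0 _] hyp pq _.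
(* Both parameter ranges enter only through these three inequalities; for [p = 1] the last one
   reduces to [beta > 0]. *)
have [b0 p01 pn] : [/\ 0 < beta, 0 < p <= 1 & n%:R < p * (n%:R + beta)].
  case: hyp => [[-> /andP[b0 _]]|[/andP[b0 _] /andP[np p1]]].
    by split=> //; rewrite ?ltr01 ?lexx// mul1r ltrDl.
  have nb : 0 < n%:R + beta by rewrite ltr_wpDl.
  split=> //; last by rewrite -ltr_pdivrMr.
  by rewrite (ltW p1) andbT (le_lt_trans _ np)// divr_ge0// ltW.
have [p0 p1] := andP p01; have q00 : 0 < q0 by exact: lt_le_trans pq.
have th0 : 0 < p / q0 by rewrite divr_gt0.
tfae.
- move=> [C hC]; exists ((4 / p) `^ p^-1 * C) => f fcc.
  have mu' := measurable_cs_extension s (Cc_smooth_measurable fcc).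
  apply: (le_trans (lebesgue_le_lorentz mu p01 pq mu')); rewrite EFinM -muleA.
  by apply: lee_wpmul2l; [rewrite lee_fin powR_ge0|exact: hC].
- move=> [C hC]; exists C => f fcc.
  have mu' := measurable_cs_extension s (Cc_smooth_measurable fcc).
  exact: le_trans (weak_le_lebesgue mu q00 mu') (hC f fcc).
- exact: cap_min_of_weak.
(* The absolute value supplies the nonnegative constant that [open_of_cap_min] asks for; enlarging
   is harmless since capacities are nonnegative. *)
- move=> [C hC]; exists `|C| => O oO; apply: open_of_cap_min => // t t0.
  apply: (le_trans (hC t t0)); apply: lee_wpmul2r; last by rewrite lee_fin ler_norm.
  by apply: le_ereal_inf_tmp => _ [V _ <-]; exact: besov_cap_ge0.
- exact: ball_growth_of_open.
- exact: lorentz_of_ball_growth.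
Qed.
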